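(* Let $M$ be an ${\bf R}^n$-aspherical manifold such that $\pi_1(M)$ acts on ${\bf R}^n$ by diffeomorphisms. Suppose that $M$ is compact and that $Aff(M)_0$ acts transitively on $M$. Then $M$ is a solvmanifold endowed with the structure of an affine manifold.
   Context: A group $G$ of homeomorphisms of ${\bf R}^n$ acts freely and properly discontinuously if (i) for all $x\in{\bf R}^n$ and $\gamma\in G$, $\gamma(x)=x$ implies $\gamma=Id_{{\bf R}^n}$; and (ii) every $x\in{\bf R}^n$ has an open neighbourhood $U$ such that for $\gamma\in G$, $\gamma(U)\cap U\neq\emptyset$ implies $\gamma=Id_{{\bf R}^n}$. An ${\bf R}^n$-aspherical manifold is a topological manifold $M$ given as the quotient of ${\bf R}^n$ by a group $G$ acting continuously, freely and properly discontinuously on ${\bf R}^n$; $G$ is identified with $\pi_1(M)$, and $p_M:{\bf R}^n\to M$ is the quotient (covering) map. When $\pi_1(M)$ acts by diffeomorphisms, $M$ is given the quotient differentiable structure. A homeomorphism $\hat f$ of ${\bf R}^n$ is a lift of a homeomorphism $f$ of $M$ if $p_M\circ\hat f=f\circ p_M$. $Aff(M)$ is the group of homeomorphisms of $M$ having at least one lift which is an affine transformation of ${\bf R}^n$; it is endowed with the compact-open topology, and $Aff(M)_0$ is the connected component of the identity of $Aff(M)$. An affine manifold is a manifold endowed with a connection whose curvature and torsion vanish identically; equivalently, a manifold with an atlas whose coordinate changes are affine transformations. *)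

(* Defs.v *)
From HB Require Import structures.
From mathcomp Require Import all_boot all_order all_algebra.
From mathcomp Require Import all_classical all_reals all_analysis.
Set Implicit Arguments.
Unset Strict Implicit.
Unset Printing Implicit Defensive.
Import Order.TTheory GRing.Theory Num.Theory.
Import numFieldNormedType.Exports.
Local Open Scope classical_set_scope.
Local Open Scope ring_scope.

(* Meant for open U: on a finite-dimensional V, f is C^(k+1) iff it is
   differentiable and all its directional derivatives are C^k. *)
Fixpoint Ck_on (R : realType) (V W : normedModType R) (k : nat)
    (U : set V) (f : V -> W) : Prop :=
  match k with
  | 0 => forall x, U x -> {for x, continuous f}
  | k'.+1 => (forall x, U x -> differentiable f x) /\
             (forall v : V, Ck_on k' U ('D_v f))
  end.

Definition smooth_on (R : realType) (V W : normedModType R)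
  (U : set V) (f : V -> W) : Prop := forall k, Ck_on k U f.

Definition homeomorphism (X Y : topologicalType) (f : X -> Y) : Prop :=
  continuous f /\
  exists g : Y -> X, [/\ continuous g, cancel f g & cancel g f].

Definition diffeomorphism (R : realType) (V W : normedModType R)
    (f : V -> W) : Prop :=
  smooth_on setT f /\
  exists g : W -> V, [/\ smooth_on setT g, cancel f g & cancel g f].

Definition affine_transformation (R : realType) (n : nat)
    (f : 'rV[R]_n -> 'rV[R]_n) : Prop :=
  exists (A : 'M[R]_n) (b : 'rV[R]_n),
    A \in unitmx /\ f = (fun x => x *m A + b).

Definition locally_affine_on (R : realType) (n : nat)
    (U : set 'rV[R]_n) (f : 'rV[R]_n -> 'rV[R]_n) : Prop :=
  forall x, U x -> exists2 a, affine_transformation a &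
    \forall y \near x, f y = a y.

(* A chart is given by its domain, the coordinate map and its inverse; both
   maps are total functions, whose values matter only on dom and fwd @` dom. *)
Record chart (X E : Type) := Chart {
  dom : set X;
  fwd : X -> E;
  bwd : E -> X
}.

Definition codom_chart (X E : Type) (c : chart X E) : set E :=
  fwd c @` dom c.

Definition is_chart (X E : topologicalType) (c : chart X E) : Prop :=
  [/\ open (dom c), open (codom_chart c),
      {within dom c, continuous (fwd c)},
      {within codom_chart c, continuous (bwd c)} &
      forall x, dom c x -> bwd c (fwd c x) = x].

(* P U f: the coordinate change f, defined on U, is admissible. *)
Definition atlas (X E : topologicalType) (P : set E -> (E -> E) -> Prop)
    (A : set (chart X E)) : Prop :=
  [/\ forall c, A c -> is_chart c,
      forall x, exists2 c, A c & dom c x &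
      forall c c', A c -> A c' ->
        P (fwd c @` (dom c `&` dom c')) (fwd c' \o bwd c)].

Definition topological_manifold (R : realType) (n : nat)
    (X : topologicalType) : Prop :=
  [/\ hausdorff_space X, @second_countable X &
      forall x : X, exists2 c : chart X 'rV[R]_n, is_chart c & dom c x].

Definition smooth_manifold (R : realType) (n : nat) (X : topologicalType)
    (A : set (chart X 'rV[R]_n)) : Prop :=
  topological_manifold R n X /\ atlas (@smooth_on R 'rV[R]_n 'rV[R]_n) A.

Definition affine_manifold (R : realType) (n : nat) (X : topologicalType)
    (A : set (chart X 'rV[R]_n)) : Prop :=
  topological_manifold R n X /\ atlas (@locally_affine_on R n) A.

(* The atlases A and B define the same differentiable structure. *)
Definition smoothly_compatible (R : realType) (n : nat) (X : topologicalType)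
    (A B : set (chart X 'rV[R]_n)) : Prop :=
  atlas (@smooth_on R 'rV[R]_n 'rV[R]_n) (A `|` B).

Definition smooth_map (R : realType) (X Y : topologicalType)
    (E F : normedModType R) (A : set (chart X E)) (B : set (chart Y F))
    (f : X -> Y) : Prop :=
  continuous f /\
  forall c c', A c -> B c' ->
    smooth_on (fwd c @` (dom c `&` f @^-1` dom c')) (fwd c' \o f \o bwd c).

Definition submersion (R : realType) (X Y : topologicalType)
    (E F : normedModType R) (A : set (chart X E)) (B : set (chart Y F))
    (f : X -> Y) : Prop :=
  smooth_map A B f /\
  forall c c' x, A c -> B c' -> dom c x -> dom c' (f x) ->
    forall w : F, exists v : E, 'd (fwd c' \o f \o bwd c) (fwd c x) v = w.

Definition prod_chart (X Y E F : Type) (c : chart X E) (c' : chart Y F) :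
    chart (X * Y) (E * F) :=
  Chart (dom c `*` dom c')
    (fun z => (fwd c z.1, fwd c' z.2)) (fun w => (bwd c w.1, bwd c' w.2)).

Definition prod_atlas (X Y E F : Type) (A : set (chart X E))
    (B : set (chart Y F)) : set (chart (X * Y) (E * F)) :=
  [set prod_chart c c' | c in A & c' in B].

#[short(type="topologicalGroupCarrierType")]
HB.structure Definition TopologicalGroupCarrier :=
  {L of Topological L & Group L}.

(* The continuity of the group operations is part of smooth_map. *)
Definition lie_group (R : realType) (d : nat)
    (L : topologicalGroupCarrierType) (A : set (chart L 'rV[R]_d)) : Prop :=
  [/\ smooth_manifold A,
      smooth_map (prod_atlas A A) A (fun z : L * L => (z.1 * z.2)%g) &
      smooth_map A A (fun x : L => (x^-1)%g)].

Definition subgroup (L : groupType) (H : set L) : Prop :=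
  [/\ H 1%g, (forall x y, H x -> H y -> H (x * y)%g) &
      (forall x, H x -> H (x^-1)%g)].

Definition derived_subgroup (L : groupType) (D : set L) : set L :=
  smallest (@subgroup L) [set commg x y | x in D & y in D].

Definition solvable_group (L : groupType) : Prop :=
  exists k, iter k (@derived_subgroup L) [set: L] = [set 1%g].

(* q identifies the manifold X with the homogeneous space L / H: the
   differentiable structure of L / H is the unique one for which the
   projection from L is a submersion. *)
Definition homogeneous_space_projection (R : realType) (d n : nat)
    (L : topologicalGroupCarrierType) (B : set (chart L 'rV[R]_d))
    (H : set L) (X : topologicalType) (A : set (chart X 'rV[R]_n))
    (q : L -> X) : Prop :=
  [/\ submersion B A q, (forall z, exists x, q x = z) &
      forall x y, q x = q y <-> H (x^-1 * y)%g].

(* A homogeneous space L / H of a connected solvable Lie group L, with H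
   closed but not necessarily discrete. *)
Definition solvmanifold (R : realType) (n : nat) (X : topologicalType)
    (A : set (chart X 'rV[R]_n)) : Prop :=
  smooth_manifold A /\
  exists (d : nat) (L : topologicalGroupCarrierType)
    (B : set (chart L 'rV[R]_d)) (H : set L) (q : L -> X),
    [/\ lie_group B, connected [set: L], solvable_group L,
        subgroup H /\ closed H & homogeneous_space_projection B H A q].

Definition homeomorphism_group (X : topologicalType) (G : set (X -> X)) :
    Prop :=
  [/\ forall g, G g -> homeomorphism g, G id,
      forall g h, G g -> G h -> G (g \o h) &
      forall g, G g -> exists2 h, G h & cancel g h /\ cancel h g].

Definition acts_freely (X : Type) (G : set (X -> X)) : Prop :=
  forall x g, G g -> g x = x -> g = id.

Definition acts_properly_discontinuously (X : topologicalType)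
    (G : set (X -> X)) : Prop :=
  forall x, exists2 U, open_nbhs x U &
    forall g, G g -> (g @` U) `&` U !=set0 -> g = id.

Definition quotient_map (X M : topologicalType) (G : set (X -> X))
    (p : X -> M) : Prop :=
  [/\ forall m, exists x, p x = m,
      forall x y, p x = p y <-> exists2 g, G g & g x = y &
      forall V : set M, open V <-> open (p @^-1` V)].

(* M, with its projection p, is the quotient of R^n by G = pi_1(M). *)
Definition aspherical_manifold (R : realType) (n : nat)
    (G : set ('rV[R]_n -> 'rV[R]_n)) (M : topologicalType)
    (p : 'rV[R]_n -> M) : Prop :=
  [/\ homeomorphism_group G, acts_freely G,
      acts_properly_discontinuously G, quotient_map G p &
      topological_manifold R n M].

(* The charts of the quotient differentiable structure are the local inverses
   of p; this is a smooth atlas when the group acts by diffeomorphisms. *)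
Definition quotient_atlas (R : realType) (n : nat) (M : topologicalType)
    (p : 'rV[R]_n -> M) : set (chart M 'rV[R]_n) :=
  [set c | is_chart c /\ forall m, dom c m -> p (fwd c m) = m].

Definition is_lift (X M : topologicalType) (p : X -> M) (f : M -> M)
    (fhat : X -> X) : Prop :=
  homeomorphism fhat /\ p \o fhat = f \o p.

Definition Aff (R : realType) (n : nat) (M : topologicalType)
    (p : 'rV[R]_n -> M) : set {compact-open, M -> M} :=
  [set f | homeomorphism (f : M -> M) /\
    exists2 a, affine_transformation a & is_lift p f a].

Definition Aff0 (R : realType) (n : nat) (M : topologicalType)
    (p : 'rV[R]_n -> M) : set {compact-open, M -> M} :=
  connected_component (Aff p) (id : M -> M).

Definition acts_transitively (M : Type) (F : set (M -> M)) : Prop :=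
  forall x y, exists2 f, F f & f x = y.

(* Main.v *)
(* Let [H] be the group of the affine maps that commute with [G]. As [M] is compact, an
   affine lift close to the identity commutes with a generating set of [G], so that it is
   in [H]; transitivity and Baire's theorem then show that the elements of [H] close to the
   identity move every point in all directions, and the affine fields tangent to [H] span
   every tangent space. A field tangent to [H] that vanishes at [x] vanishes on the orbit
   [G x]. A trace computation shows that the determinant of a frame of such fields does
   not change along [G x]; it is thus a bounded polynomial, hence constant, and the Lie
   algebra of [H] is simply transitive. It is described by a left-symmetric product with
   nilpotent right multiplications, and such a product makes its Lie algebra solvable:
   otherwise the vanishing of [H^1] on an irreducible module (Casimir element) would give a
   right multiplication that is not nilpotent. By Lie's theorem the linear parts are
   simultaneously triangular over the complex numbers.
   Products of small elements of [H] along rays give a continuous section of the orbit map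
   of [0]. Its linear part [A] makes R^n a solvable Lie group for [x * y = x + y A(x)], and
   [G] acts by right translations, so that [M] is the quotient by the discrete subgroup
   [p^-1(p 0)]. In the charts of [p] composed with the inversion, the coordinate changes are
   left translations [y |-> c + y A(c)], which are affine. *)

Require Import Defs.
From HB Require Import structures.
From mathcomp Require Import all_boot all_order all_algebra.
From mathcomp Require Import boolp complex.
Set Implicit Arguments.
Unset Strict Implicit.
Unset Printing Implicit Defensive.
Import Order.TTheory GRing.Theory Num.Theory.
Local Open Scope ring_scope.

(** The group [H] is only known as a closed group of matrices, so its tangent vectors are defined by
    limits, and [tangent_exp] takes the place of the exponential: it gives an element of [H] equal
    to [1 + X] up to second order that fixes every row killed by [X]. The delicate step is the
    passage from open orbits to spanning fields, since an element that moves a point by [t *: v] may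
    be much farther than [t] from the identity; an element of almost minimal size is therefore
    compared with its correction by the stabiliser. The determinant is bounded because, [M] being
    compact, each orbit of [G] meets a fixed ball. Nilpotency is read off traces of right
    multiplications twice, because a trace is linear: it can be represented by an element of the
    algebra, and it passes to the complexification, which nilpotency does not do formally. *)

(** * Identities in abelian groups, decided by reflection *)

Inductive zexpr := ZVar of nat | ZAdd of zexpr & zexpr | ZOpp of zexpr | ZZero.

Fixpoint zeval (V : zmodType) (env : seq V) (e : zexpr) : V :=
  match e with
  | ZVar i => env`_i
  | ZAdd a b => zeval env a + zeval env b
  | ZOpp a => - zeval env a
  | ZZero => 0
  end.

Fixpoint zcoef (e : zexpr) (i : nat) : int :=
  match e with
  | ZVar j => (i == j)%:Z
  | ZAdd a b => zcoef a i + zcoef b i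
  | ZOpp a => - zcoef a i
  | ZZero => 0
  end.

Lemma zevalE (V : zmodType) (env : seq V) e :
  zeval env e = \sum_(i < size env) env`_i *~ zcoef e i.
Proof.
elim: e => [j|a IHa b IHb|a IHa|] /=; rewrite ?IHa ?IHb.
- have [jlt|jge] := ltnP j (size env).
    rewrite (bigD1 (Ordinal jlt)) //= eqxx big1 ?addr0 // => i.
    by rewrite -val_eqE /= => /negPf ->.
  rewrite nth_default // big1 // => i _.
  by rewrite (ltn_eqF (leq_trans (ltn_ord i) jge)).
- by rewrite -big_split; apply: eq_bigr => i _; rewrite mulrzDr.
- by rewrite -sumrN; apply: eq_bigr => i _; rewrite mulrNz.
- by rewrite big1.
Qed.

Lemma zmod_reflect (V : zmodType) (env : seq V) a b :
  all (fun i => zcoef a i == zcoef b i) (iota 0 (size env)) ->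
  zeval env a = zeval env b.
Proof.
move=> /allP h; rewrite !zevalE; apply: eq_bigr => i _.
by rewrite (eqP (h i _)) // mem_iota add0n ltn_ord.
Qed.

(** Atoms are compared by unification, so that convertible spellings of a term count as one atom. *)
Ltac zindex t env :=
  lazymatch env with
  | @cons _ ?u ?env' =>
    match constr:(Set) with
    | _ => let _ := match constr:(Set) with _ => unify t u end in constr:(0%N)
    | _ => let i := zindex t env' in constr:(i.+1)
    end
  end.
Ltac zatoms t env :=
  match t with
  | @GRing.zero _ => env
  | ?a + ?b => let env := zatoms a env in zatoms b env
  | - ?a => zatoms a env
  | _ => match constr:(Set) with
         | _ => let _ := zindex t env in env
         | _ => constr:(t :: env)
         end
  end.
Ltac zreify t env :=
  match t with
  | @GRing.zero _ => constr:(ZZero)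
  | ?a + ?b => let x := zreify a env in let y := zreify b env in constr:(ZAdd x y)
  | - ?a => let x := zreify a env in constr:(ZOpp x)
  | _ => let i := zindex t env in constr:(ZVar i)
  end.
Ltac zmodule :=
  match goal with
  | |- @eq ?T ?a ?b =>
    let env := zatoms a (@nil T) in let env := zatoms b env in
    let x := zreify a env in let y := zreify b env in
    change (zeval env x = zeval env y); apply: zmod_reflect; vm_compute; reflexivity
  end.
(** Once the products are expanded, an identity of a noncommutative ring becomes one of an abelian
    group whose atoms are the monomials. *)
Ltac ncring :=
  rewrite ?(mulrDl, mulrDr, mulrBl, mulrBr, mulNr, mulrN, mulrA); zmodule.

Definition lie (R : pzRingType) (x y : R) : R := x * y - y * x.

(** * Lie algebras of nilpotent matrices *)

Section Lie.
Variables (R : pzRingType).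
Implicit Types x y z : R.

Lemma lieDl x y z : lie (x + y) z = lie x z + lie y z.
Proof. by rewrite /lie; ncring. Qed.

Lemma lieC x y : lie x y = - lie y x.
Proof. by rewrite /lie; zmodule. Qed.

Lemma lieDr x y z : lie x (y + z) = lie x y + lie x z.
Proof. by rewrite /lie; ncring. Qed.

Lemma lie0l x : lie 0 x = 0.
Proof. by rewrite /lie mul0r mulr0 subrr. Qed.

Lemma lie_jacobi x y z : lie x (lie y z) = lie (lie x y) z - lie (lie x z) y.
Proof. by rewrite /lie; ncring. Qed.

(* Left and right multiplications commute, so that the iterates are combinations
   of the [a ^+ i * v * b ^+ j]. *)
Lemma iter_mulrB_eq0 N (a b v : R) : a ^+ N * v = 0 -> v * b ^+ N = 0 ->
  iter (N + N) (fun u => u * b - a * u) v = 0.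
Proof.
move=> aN bN; suff h k : exists c : nat -> int,
    iter k (fun u => u * b - a * u) v =
    \sum_(i < k.+1) (a ^+ i * v * b ^+ (k - i)) *~ c i.
  have [c ->] := h (N + N)%N; apply: big1 => i _.
  have [iN|Ni] := leqP N i.
    by rewrite -(subnK iN) exprD -!mulrA [_ * (v * _)]mulrA aN mul0r mulr0 mul0rz.
  have -> : (N + N - i = N + (N - i))%N by rewrite addnBA // ltnW.
  by rewrite exprD -!mulrA [v * _]mulrA bN mul0r mulr0 mul0rz.
elim: k => [|k [c IH]].
  by exists (fun=> 1); rewrite big_ord1 /= expr0 mul1r mulr1.
exists (fun i => (if (i <= k)%N then c i else 0) - (if (0 < i)%N then c i.-1 else 0)).
rewrite iterS IH mulr_suml mulr_sumr.
under [RHS]eq_bigr do rewrite mulrzBr.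
rewrite sumrB; congr (_ - _).
  rewrite [RHS]big_ord_recr /= ltnn mulr0z addr0; apply: eq_bigr => i _.
  have ik : (i <= k)%N by rewrite -ltnS ltn_ord.
  by rewrite ik mulrzAl -mulrA -exprSr -subSn // mulrzAl.
rewrite [RHS]big_ord_recl /= mulr0z add0r; apply: eq_bigr => i _.
by rewrite /bump leq0n add1n subSS mulrzAr !mulrA -exprS.
Qed.

Lemma lie_iter_eq0 N x v : x ^+ N = 0 -> iter (N + N) (fun v => lie v x) v = 0.
Proof. by move=> xN; apply: iter_mulrB_eq0; rewrite xN (mul0r, mulr0). Qed.

End Lie.

Section A.
Variables (F : fieldType).
Lemma lieZl n a (x z : 'M[F]_n) : lie (a *: x) z = a *: lie x z.
Proof. by rewrite scalerBr scalemxAl [X in _ - X]scalemxAr. Qed.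

Lemma lieZr n a (x z : 'M[F]_n) : lie x (a *: z) = a *: lie x z.
Proof. by rewrite lieC lieZl -scalerN -lieC. Qed.

Definition lie_closed n (g : {vspace 'M[F]_n}) :=
  forall x y, x \in g -> y \in g -> lie x y \in g.

Definition matrix_nilpotent n (x : 'M[F]_n) := exists N, x ^+ N = 0.

(* Stated for an abstract action so that the induction can use the adjoint
   action on subalgebras. *)
Lemma engel_step n (K : {vspace 'M[F]_n}) (vT : vectType F)
    (act : 'M[F]_n -> vT -> vT) (A B : {vspace vT}) (K' : {vspace 'M[F]_n}) y N :
  lie_closed K ->
  (forall x a v w, act x (a *: v + w) = a *: act x v + act x w) ->
  (forall a x y v, act (a *: x + y) v = a *: act x v + act y v) ->
  (forall x y v, act (lie x y) v = act y (act x v) - act x (act y v)) ->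
  (forall x v, x \in K -> v \in A -> act x v \in A) ->
  (forall x v, x \in K -> v \in B -> act x v \in B) ->
  (K' <= K)%VS -> y \in K -> (forall x, x \in K' -> lie x y \in K') ->
  (forall v, iter N (act y) v = 0) ->
  (exists2 b, b \in B & b \notin A /\ forall x, x \in K' -> act x b \in A) ->
  exists2 b, b \in B & b \notin A /\ forall x, x \in (K' + <[y]>)%VS -> act x b \in A.
Proof.
move=> lieK linV linK homK stA stB sK' Ky K'y nily.
have act0 x : act x 0 = 0.
  by have := linV x (-1) 0 0; rewrite scaler0 addr0 scaleN1r addNr.
case=> b bB [bA K'b].
(* The last iterate of [b] under [y] outside [A]. As [y] normalises [K'], every iterate is still
   sent into [A] by [K']. *)
have [k _ [ckB ckA K'c yc]] : exists2 k, (k <= N)%N &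
    let c := iter k (act y) b in
    [/\ c \in B, c \notin A, forall x, x \in K' -> act x c \in A & act y c \in A].
  have : exists k, iter k (act y) b \in A by exists N; rewrite nily mem0v.
  move=> ex; case: (ex_minnP ex) => -[|k]; first by rewrite /= (negPf bA).
  move=> kA kmin; exists k.
    by rewrite -ltnS ltnW // ltnS kmin // nily mem0v.
  have cA : iter k (act y) b \notin A.
    by apply/negP => /kmin; rewrite ltnn.
  split=> //.
  - by elim: (k) => [|j IH] //=; apply: stB.
  - elim: (k) => [|j IH] //= x xK'.
    have -> : act x (act y (iter j (act y) b)) =
       act y (act x (iter j (act y) b)) - act (lie x y) (iter j (act y) b).
      by rewrite homK; zmodule.
    by rewrite memvB //; [apply: stA => //; apply: IH|apply/IH/K'y].
exists (iter k (act y) b) => //; split=> // x /memv_addP[u uK' [_ /vlineP[a ->] ->]].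
by rewrite addrC linK memvD // ?memvZ // K'c.
Qed.

(** Engel's theorem for the action on [B] modulo [A], with a pair of stable subspaces in place of a
    quotient. A proper subalgebra [K'] acts on [K] modulo [K'] by nilpotent maps; the induction
    yields an element of [K] outside [K'] that normalises [K'], and [engel_step] enlarges [K'] by it
    while keeping a killed vector. *)
Lemma engel n (K : {vspace 'M[F]_n}) (vT : vectType F)
    (act : 'M[F]_n -> vT -> vT) (A B : {vspace vT}) :
  lie_closed K ->
  (forall x, x \in K -> matrix_nilpotent x) ->
  (forall x a v w, act x (a *: v + w) = a *: act x v + act x w) ->
  (forall a x y v, act (a *: x + y) v = a *: act x v + act y v) ->
  (forall x y v, act (lie x y) v = act y (act x v) - act x (act y v)) ->
  (forall x, x \in K -> exists N, forall v, iter N (act x) v = 0) ->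
  (forall x v, x \in K -> v \in A -> act x v \in A) ->
  (forall x v, x \in K -> v \in B -> act x v \in B) ->
  ~~ (B <= A)%VS ->
  exists2 b, b \in B & b \notin A /\ forall x, x \in K -> act x b \in A.
Proof.
move: {2}(\dim K) (leqnn (\dim K)) => d.
elim: d K vT act A B => [|d IH] K vT act A B dK lieK nilM linV linK homK nilK stA stB nBA.
  have [b bB bA] := subvPn nBA.
  exists b => //; split => // x; move: dK; rewrite leqn0 dimv_eq0 => /eqP ->.
  rewrite memv0 => /eqP ->.
  have := linK (-1) 0 0 b; rewrite scaler0 addr0 scaleN1r addNr => ->.
  exact: mem0v.
suff grow (k : nat) : (k <= \dim K)%N -> exists K' : {vspace 'M[F]_n},
    [/\ (K' <= K)%VS, lie_closed K', (k <= \dim K')%N &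
      exists2 b, b \in B & b \notin A /\ forall x, x \in K' -> act x b \in A].
  have [K' [sK' _ dK' [b bB [bA Kb]]]] := grow _ (leqnn (\dim K)).
  exists b => //; split=> // x xK; apply: Kb.
  by have /eqP -> : (K' == K)%VS by rewrite eqEdim sK'.
elim: k => [|k IHk] kK.
  have [b bB bA] := subvPn nBA.
  exists 0%VS; split; rewrite ?sub0v //.
    by move=> x y; rewrite !memv0 => /eqP -> _; rewrite /lie mul0r mulr0 subrr.
  exists b => //; split => // x; rewrite memv0 => /eqP ->.
  have := linK (-1) 0 0 b; rewrite scaler0 addr0 scaleN1r addNr => ->.
  exact: mem0v.
have [K' [sK' lieK' dK' exb]] := IHk (ltnW kK).
have [le|gt] := leqP k.+1 (\dim K'); first by exists K'.
have dK'd : (\dim K' <= d)%N by rewrite -ltnS; apply: leq_trans gt (leq_trans kK dK).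
have nKK' : ~~ (K <= K')%VS.
  by apply/negP => /dimvS h; move: (leq_trans kK h); rewrite leqNgt gt.
have inK x : x \in K' -> x \in K by apply: subvP sK' _.
(* The induction hypothesis for the bracket action of [K'] on [K] modulo [K']. *)
have [|||||||y yK [yK' K'y]] := IH K' ('M[F]_n : vectType F) (fun (x v : 'M[F]_n) => lie v x) K' K dK'd lieK' _ _ _ _ _ _ _ nKK'.
- by move=> x /inK; apply: nilM.
- by move=> x a v w; rewrite lieDl lieZl.
- by move=> a x y v; rewrite lieDr lieZr.
- by move=> x y v; rewrite /lie; ncring.
- move=> x /inK/nilM[N xN]; exists (N + N)%N => v; exact: lie_iter_eq0.
- by move=> x v xK' vK'; apply: lieK'.
- by move=> x v xK' vK'; apply: lieK => //; apply: inK.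
have K'y' x : x \in K' -> lie x y \in K' by move=> ?; rewrite lieC memvN K'y.
have [N Ny] := nilK _ yK.
exists (K' + <[y]>)%VS; split.
- by rewrite subv_add sK' -memvE.
- move=> _ _ /memv_addP[u uK' [_ /vlineP[a ->] ->]] /memv_addP[w wK' [_ /vlineP[c ->] ->]].
  apply: (subvP (addvSl _ _)).
  rewrite lieDl !lieDr !(lieZl, lieZr) [lie y y]subrr !scaler0 addr0.
  apply: memvD; [apply: memvD|apply: memvZ]; [exact: lieK'|apply: memvZ; exact: K'y'|exact: K'y].
- have lt : (\dim K' < \dim (K' + <[y]>))%N.
    rewrite ltnNge; apply/negP => h; move/negP: yK'; apply.
    have /eqP -> : (K' == K' + <[y]>)%VS by rewrite eqEdim addvSl.
    by apply: (subvP (addvSr _ _)); apply: memv_line.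
  exact: leq_ltn_trans dK' lt.
- exact: (@engel_step n K vT act A B K' y N lieK linV linK homK stA stB sK' yK K'y' Ny exb).
Qed.

End A.

(** * Traces of powers, nilpotency and unipotent determinants *)

Section NilpotentTrace.
Variable F : numFieldType.

(** A nilpotent matrix has rank less than its size, so a rank factorisation [C *m B] gives the
    smaller nilpotent matrix [B *m C] of the same trace. *)
Lemma mxtrace_nilpotent n (A : 'M[F]_n) : matrix_nilpotent A -> \tr A = 0.
Proof.
elim/ltn_ind: n A => n IH A [N AN].
case: (posnP n) => n0; first by subst n; rewrite [A]flatmx0 mxtrace0.
have rn : (\rank A < n)%N.
  rewrite ltn_neqAle rank_leq_row andbT; apply/negP => /eqP rA.
  have uA : A \in unitmx by rewrite -row_full_unit /row_full rA.
  have : A ^+ N \in unitmx by elim: (N) => [|k]; rewrite ?expr0 ?unitmx1 // exprS unitmx_mul uA.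
  rewrite AN -row_full_unit /row_full mxrank0 => /eqP h.
  by rewrite -h in n0.
move: (\rank A) (row_base A) (col_base A) (mulmx_base A) rn => r B C AE rn.
rewrite -AE mxtrace_mulC; apply: (IH _ rn); exists N.+1.
have h k : (B *m C) ^+ k.+1 = B *m (A ^+ k *m C).
  elim: k => [|k IHk]; first by rewrite expr1 expr0 mul1mx.
  by rewrite exprS IHk [in RHS]exprS -[_ * _ in LHS]/(_ *m _) -[A * _]/(_ *m _) -{2}AE !mulmxA.
by rewrite h AN mul0mx mulmx0.
Qed.

(** In a rank factorisation [C *m B] of an idempotent, [B *m C] is the identity. *)
Lemma mxtrace_idempotent n (A : 'M[F]_n) : A *m A = A -> \tr A = (\rank A)%:R.
Proof.
move=> AA; have /row_freeP[r hr] := row_base_free A.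
have /row_fullP[l hl] := col_base_full A.
move: (\rank A) (row_base A) (col_base A) (mulmx_base A) r l hr hl => k B C AE r l hr hl.
rewrite -AE mxtrace_mulC.
suff -> : B *m C = 1%:M by rewrite mxtrace1.
move/(congr1 (fun M => l *m M *m r)): AA.
by rewrite /= -AE !mulmxA hl !mul1mx -!mulmxA hr !mulmx1.
Qed.

Lemma mxtrace_horner n (A : 'M[F]_n.+1) p :
  \tr (horner_mx A p) = \sum_(k < size p) p`_k * \tr (A ^+ k).
Proof.
rewrite -{1}[p]coefK poly_def !linear_sum; apply: eq_bigr => k _ /=.
by rewrite linearZ /= rmorphXn /= horner_mx_X mxtraceZ.
Qed.

(** Split the characteristic polynomial as a power of ['X] times [u] with [u] nonzero at 0. A Bezout
    relation gives [q] such that [q(A)] projects on the part where [A] is invertible; its rank is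
    its trace, which vanishes. The exponent 1 is left out because [zero_direction_nilpotent] has to
    deduce the trace of the matrix itself from its nilpotency. *)
Lemma nilpotent_mxtrace n (A : 'M[F]_n) :
  (forall k, (1 < k)%N -> \tr (A ^+ k) = 0) -> matrix_nilpotent A.
Proof.
case: n A => [|n] A; first by move=> _; exists 0%N; apply/matrixP => -[].
move=> trA; set chi := char_poly A.
have [r [u u0 chiE]] := multiplicity_XsubC chi 0.
rewrite subr0 in chiE.
have chi0 : chi != 0 by rewrite monic_neq0 // char_poly_monic.
rewrite chi0 /= in u0.
(* At least [r] so that [chi] divides ['X^(maxn r 2) * u], and at least 2 because nothing is assumed
   on the trace of [A] itself. *)
have cop : coprimep ('X^(maxn r 2)) u.
  by rewrite coprimep_expl // coprimep_sym coprimepX.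
have [[a b] /= ab] := Bezout_eq1_coprimepP _ _ cop.
set q := a * 'X^(maxn r 2).
have hchi p : chi %| p -> horner_mx A p = 0.
  by move=> /dvdpP[p' ->]; rewrite rmorphM /= Cayley_Hamilton mulr0.
have qE : horner_mx A q *m horner_mx A q = horner_mx A q.
  have := rmorphM (horner_mx A) q q; rewrite -[X in _ = X]/(_ *m _) => <-.
  rewrite {1}[q * q](_ : _ = q - a * b * ('X^(maxn r 2) * u)); last first.
    have -> : a * b * ('X^(maxn r 2) * u) = q * (b * u) by rewrite /q mulrACA !mulrA.
    by rewrite (_ : b * u = 1 - q) ?mulrBr ?mulr1 ?subKr // -ab addrC addKr.
  rewrite rmorphB /= [X in _ - X]hchi ?subr0 // dvdp_mull // mulrC chiE.
  by rewrite dvdp_mul // dvdp_exp2l // leq_maxl.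
have trq : \tr (horner_mx A q) = 0.
  rewrite mxtrace_horner; apply: big1 => k _.
  have [k2|k2] := ltnP 1 k; first by rewrite trA ?mulr0.
  by rewrite coefMXn (leq_trans (n := 2)) ?leq_maxr // mul0r.
have q0 : horner_mx A q = 0.
  apply/eqP; rewrite -mxrank_eq0 -(pnatr_eq0 F).
  by rewrite -mxtrace_idempotent // trq.
exists r; have -> : A ^+ r = horner_mx A ('X^r * 1).
  by rewrite mulr1 rmorphXn /= horner_mx_X.
rewrite -ab mulrDr rmorphD rmorphM /= q0 mulr0 add0r.
by rewrite mulrCA mulrC [_ * u]mulrC -chiE hchi // dvdp_mulr.
Qed.

Lemma unit_poly_const (p q : {poly F}) : p * q = 1 -> p = (p.[0])%:P.
Proof.
move=> pq; have p0 : p != 0 by apply: contra_eq_neq pq => ->; rewrite mul0r eq_sym oner_neq0.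
have : p %| 1 by rewrite -pq dvdp_mulr.
by rewrite dvdp1 => /eqP sp; rewrite [p]size1_polyC ?sp // hornerC.
Qed.

(** Over polynomials, [1 + 'X A] is inverted by a finite geometric series, so its determinant is a
    unit, hence a constant, and its value at 0 is 1. *)
Lemma det_unipotent n (A : 'M[F]_n) : matrix_nilpotent A -> \det (1%:M + A) = 1.
Proof.
case=> N AN; pose P : 'M[{poly F}]_n := 1%:M + 'X *: map_mx polyC A.
have PN : ('X *: map_mx polyC A) ^+ N = 0.
  suff -> : ('X *: map_mx polyC A) ^+ N = 'X^N *: map_mx polyC (A ^+ N).
    by rewrite AN map_mx0 scaler0.
  elim: (N) => [|k IH]; first by rewrite !expr0 scale1r map_mx1.
  rewrite !exprS IH [map_mx _ (A * _)]map_mxM.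
  by rewrite -[LHS]/(_ *m _) -scalemxAl -scalemxAr scalerA.
pose Q : 'M_n := \sum_(i < N) (- ('X *: map_mx polyC A)) ^+ i.
have PQ : P * Q = 1.
  have := subrX1 (- ('X *: map_mx polyC A)) N.
  rewrite exprNn PN mulr0 sub0r => /esym/(congr1 -%R).
  by rewrite opprK -mulNr opprB opprK.
have dPQ : \det P * \det Q = 1 by rewrite -det_mulmx -[P *m Q]/(P * Q) PQ det1.
have dP a : \det (1%:M + a *: A) = (\det P).[a].
  rewrite -[RHS]/(horner_eval a (\det P)) -det_map_mx; congr (\det _).
  apply/matrixP => i j; rewrite !mxE /= /horner_eval !hornerE.
  by rewrite hornerMn !hornerE.
by rewrite -[A]scale1r dP (unit_poly_const dPQ) hornerC -dP scale0r addr0 det1.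
Qed.
End NilpotentTrace.

(** * Semisimple parts and Cartan's criterion *)

Section EigenComponents.
Variables (F : fieldType) (V : vectType F) (T : V -> V) (N : nat).
Hypothesis TL : forall a u v, T (a *: u + v) = a *: T u + T v.
Variables (S : {vspace V}) (TS : forall v, v \in S -> T v \in S).

Let D d v := T v - d *: v.

Let T0 : T 0 = 0.
Proof. by have := TL (-1) 0 0; rewrite scaler0 addr0 scaleN1r addNr. Qed.

Let TZ c u : T (c *: u) = c *: T u.
Proof. by rewrite -[c *: u]addr0 TL T0 addr0. Qed.

Let TB u w : T (u - w) = T u - T w.
Proof. by rewrite addrC -scaleN1r TL scaleN1r addrC. Qed.

Let T_sum I (r : seq I) P (v : I -> V) :
  T (\sum_(i <- r | P i) v i) = \sum_(i <- r | P i) T (v i).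
Proof.
elim: r => [|i r IH]; first by rewrite !big_nil T0.
by rewrite !big_cons; case: ifP => // _; rewrite -{1}[v i]scale1r TL scale1r IH.
Qed.

Let DS d v : v \in S -> D d v \in S.
Proof. by move=> vS; rewrite memvB ?memvZ ?TS. Qed.

Let D_comm d e v : D d (D e v) = D e (D d v).
Proof.
rewrite /D !TB !TZ !scalerBr !scalerA [e * d]mulrC. zmodule.
Qed.

Let D_iter_comm k d e v : iter k (D d) (D e v) = D e (iter k (D d) v).
Proof. by elim: k => //= k ->; rewrite D_comm. Qed.

Let D_iter2 k m d e v : iter k (D d) (iter m (D e) v) = iter m (D e) (iter k (D d) v).
Proof. by elim: m => //= m <-; rewrite D_iter_comm. Qed.

Let D_iter_sum k d I (r : seq I) P (v : I -> V) :
  iter k (D d) (\sum_(i <- r | P i) v i) = \sum_(i <- r | P i) iter k (D d) (v i).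
Proof.
elim: k => //= k ->; rewrite /D T_sum scaler_sumr -sumrB.
by apply: eq_bigr.
Qed.

Let D_iter0 k d : iter k (D d) 0 = 0.
Proof. by elim: k => //= k ->; rewrite /D T0 scaler0 subr0. Qed.

(** Where a power of [T - e] vanishes, [T - d] is invertible for [d != e]; the induction on that
    power rests on [(d - e) v = D e v - D d v]. *)
Let shift1 d e v k : d != e -> iter k (D e) v = 0 -> D d v \in S -> v \in S.
Proof.
move=> de; elim: k v => [v /= -> _|k IH v]; first exact: mem0v.
rewrite iterSr => Dv dS; have eS : D e v \in S.
  by apply: IH => //; rewrite D_comm DS.
have : (d - e) *: v \in S.
  have -> : (d - e) *: v = D e v - D d v by rewrite /D scalerBl; zmodule.
  exact: memvB.
move=> h; have de0 : d - e != 0 by rewrite subr_eq0.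
by rewrite -(scalerK de0 v) memvZ.
Qed.

Let shift d e v k m : d != e -> iter k (D e) v = 0 -> iter m (D d) v \in S -> v \in S.
Proof.
move=> de Dv; elim: m => //= m IH h; apply: IH; apply: (shift1 (k := k) de) h.
by rewrite D_iter2 Dv D_iter0.
Qed.

Let comp (ps : seq (F * V)) d :
  (forall p, p \in ps -> iter N (D p.1) p.2 = 0) ->
  \sum_(p <- ps) p.2 \in S -> \sum_(p <- ps | p.1 == d) p.2 \in S.
Proof.
move=> nil vS; set u := \sum_(p <- ps | _) _.
have Du : iter N (D d) u = 0.
  rewrite D_iter_sum big_seq_cond big1 // => p /andP[pps /eqP <-]; exact: nil.
(* The operators [(T - e)^N] for the other eigenvalues kill every component but [u]; [shift] then
   removes them from [u] one at a time. *)
pose op ds v := foldr (fun e w => iter N (D e) w) v ds.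
have op_sum ds I (r : seq I) P (v : I -> V) :
    op ds (\sum_(i <- r | P i) v i) = \sum_(i <- r | P i) op ds (v i).
  by elim: ds => //= e ds ->; rewrite D_iter_sum.
have opS ds v : v \in S -> op ds v \in S.
  move=> vS'; elim: ds => //= e ds; elim: (N) => //= k IH /IH; exact: DS.
have op_comm e ds v : op ds (iter N (D e) v) = iter N (D e) (op ds v).
  by elim: ds => //= f ds ->; rewrite D_iter2.
have op0 ds : op ds 0 = 0 by elim: ds => //= e ds ->; rewrite D_iter0.
have opk e ds v : e \in ds -> iter N (D e) v = 0 -> op ds v = 0.
  elim: ds => //= f ds IH; rewrite inE => /orP[/eqP <- Dv|/IH h /h ->].
    by rewrite -op_comm Dv op0.
  by rewrite D_iter0.
pose ds := [seq p.1 | p <- ps & p.1 != d].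
have opuS : op ds u \in S.
  have := opS ds _ vS; rewrite (op_sum ds _ ps xpredT) (bigID (fun p => p.1 == d)) /=.
  rewrite -op_sum -/u [X in _ + X](_ : _ = 0) ?addr0 //.
  rewrite big_seq_cond big1 // => p /andP[pps pd]; apply: (opk p.1); last exact: nil.
  by apply: map_f; rewrite mem_filter pd.
have : d \notin ds by apply/mapP => -[p]; rewrite mem_filter => /andP[/eqP pd _] /esym.
elim: (ds) opuS => //= e es IH h; rewrite inE negb_or => /andP[de]; apply: IH.
apply: (shift (d := e) (e := d) (k := N)) h; first by rewrite eq_sym.
by rewrite -op_comm Du op0.
Qed.

(** The partial sum over each eigenvalue already lies in [S], so these sums may be recombined with
    any coefficients. *)
Lemma memv_eigen_components (ps : seq (F * V)) (f : F -> F) :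
  (forall p, p \in ps -> iter N (fun v => T v - p.1 *: v) p.2 = 0) ->
  \sum_(p <- ps) p.2 \in S -> \sum_(p <- ps) f p.1 *: p.2 \in S.
Proof.
move=> nil vS.
suff -> : \sum_(p <- ps) f p.1 *: p.2 =
    \sum_(d <- undup (map fst ps)) f d *: \sum_(p <- ps | p.1 == d) p.2.
  by apply: memv_suml => d _; apply/memvZ/comp.
transitivity (\sum_(p <- ps) \sum_(d <- undup (map fst ps) | p.1 == d) f d *: p.2).
  apply: eq_big_seq => p pps; have pu : p.1 \in undup (map fst ps) by rewrite mem_undup map_f.
  rewrite big_mkcond (bigD1_seq p.1) ?undup_uniq //= eqxx big1 ?addr0 // => d.
  by rewrite eq_sym => /negPf ->.
rewrite (exchange_big_dep xpredT) //=; apply: eq_bigr => d _.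
by rewrite scaler_sumr.
Qed.
End EigenComponents.

(** Evaluated at a matrix with eigenvalues in [s], and for [N] large, the summands become its
    spectral projections. *)
Lemma partial_fractions (F : fieldType) (N : nat) (s : seq F) : uniq s -> s != [::] ->
  exists c : F -> {poly F},
    \sum_(z <- s) c z * \prod_(w <- s | w != z) ('X - w%:P) ^+ N = 1.
Proof.
elim: s => // a s IH /= /andP[as_ us] _.
have [s0|s0] := eqVneq s [::].
  by exists (fun=> 1); rewrite s0 big_seq1 big_cons eqxx /= big_nil mulr1.
have [c cE] := IH us s0.
have cop : coprimep (('X - a%:P) ^+ N) (\prod_(w <- s) ('X - w%:P) ^+ N).
  rewrite coprimep_expl // coprimep_sym coprimep_XsubC rootE horner_prod.
  apply/negP; rewrite prodf_seq_eq0 => /hasP[w ws /=].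
  rewrite horner_exp hornerXsubC expf_eq0 subr_eq0 => /andP[_ /eqP aw].
  by rewrite aw ws in as_.
have [[u v] /= uv] := Bezout_eq1_coprimepP _ _ cop.
exists (fun z => if z == a then v else u * c z).
rewrite big_cons eqxx big_cons eqxx /= -[RHS]uv [RHS]addrC; congr (_ + _).
  rewrite big_seq_cond [in RHS]big_seq; congr (_ * _); apply: eq_bigl => w.
  by case: (boolP (w \in s)) => //= ws; apply: contraNneq as_ => <-.
rewrite -[RHS]mulr1 -[X in _ = _ * X]cE mulr_sumr; apply: eq_big_seq => z zs.
have za : z != a by apply: contraNneq as_ => <-.
by rewrite (negPf za) big_cons eq_sym za mulrACA.
Qed.

Section ConjSemisimple.
Variable C : numClosedFieldType.

(* [y] is the complex conjugate of the semisimple part of [x]. *)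
Lemma conj_semisimple n (x : 'M[C]_n.+1) : exists y : 'M[C]_n.+1,
  (forall S : {vspace 'M[C]_n.+1},
     (forall v, v \in S -> lie v x \in S) -> forall v, v \in S -> lie v y \in S) /\
  (\tr (x * y) = 0 -> matrix_nilpotent x).
Proof.
have [r] := closed_field_poly_normal (char_poly x).
rewrite (monicP (char_poly_monic x)) scale1r => chiE.
(* The exponent [N] is at least the multiplicity of every root. *)
pose s := undup r; pose N := size r.
have s0 : s != [::].
  rewrite /s; case: (r) chiE => [|a r'] chiE; last first.
    by rewrite -size_eq0 -lt0n -has_predT; apply/hasP; exists a; rewrite // mem_undup mem_head.
  by have := size_char_poly x; rewrite chiE big_nil size_poly1.
have [c cE] := partial_fractions N (undup_uniq r) s0.
pose E := \prod_(w <- s) ('X - w%:P) ^+ N.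
have chiEE : char_poly x %| E.
  rewrite chiE /E prodrXl /N.
  have: {subset r <= s} by move=> z; rewrite mem_undup.
  elim: (r) => [|a r' IH] sub; first by rewrite big_nil dvd1p.
  rewrite big_cons exprS dvdp_mul ?IH // => [|z zr]; last by rewrite sub // inE zr orbT.
  by rewrite (bigD1_seq a) ?undup_uniq ?sub ?mem_head //= dvdp_mulr.
have E0 p : E %| p -> horner_mx x p = 0.
  move=> /(dvdp_trans chiEE)/dvdpP[q ->].
  by rewrite rmorphM /= Cayley_Hamilton mulr0.
pose e z := c z * \prod_(w <- s | w != z) ('X - w%:P) ^+ N.
pose P z := horner_mx x (e z).
have EE z : z \in s -> E = ('X - z%:P) ^+ N * \prod_(w <- s | w != z) ('X - w%:P) ^+ N.
  by move=> zs; rewrite /E (bigD1_seq z) ?undup_uniq.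
have P1 : \sum_(z <- s) P z = 1 by rewrite -rmorph_sum cE rmorph1.
have xz z : x - z%:M = horner_mx x ('X - z%:P).
  by rewrite rmorphB /= horner_mx_X horner_mx_C.
have xP z : z \in s -> (x - z%:M) ^+ N * P z = 0.
  move=> zs; rewrite xz /P -rmorphXn -rmorphM /= E0 // (EE z zs) /e mulrCA.
  by rewrite dvdp_mull.
have PP z w : z \in s -> w \in s -> z != w -> P z * P w = 0.
  move=> zs ws zw; rewrite /P -rmorphM /= E0 // (EE z zs) /e mulrACA dvdp_mull //.
  rewrite [X in _ %| X]mulrC dvdp_mul // big_mkcond (bigD1_seq z) ?undup_uniq //=.
  by rewrite zw dvdp_mulr.
have Pidem z : z \in s -> P z *m P z = P z.
  move=> zs; rewrite -[RHS](_ : P z * \sum_(w <- s) P w = _); last by rewrite P1 mulr1.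
  rewrite mulr_sumr (bigD1_seq z) ?undup_uniq //=.
  rewrite big_seq_cond big1 ?addr0 // => w /andP[ws wz].
  by rewrite PP // eq_sym.
have trP z : z \in s -> \tr (P z) = (\rank (P z))%:R.
  by move=> zs; apply/mxtrace_idempotent/Pidem.
have Px z : comm_mx x (P z) by apply: comm_mx_horner.
have Pxz z : (x - z%:M) * P z = P z * (x - z%:M).
  by rewrite mulrBl mulrBr; congr (_ - _); [exact: Px|apply/esym/scalar_mxC].
pose y := \sum_(z <- s) z^* *: P z.
exists y; split.
  move=> S xS v vS.
  (* [P z * v * P w] is a generalised eigenvector of [lie _ x] for [w - z], and conjugating these
     eigenvalues turns [v] into [lie v y]. *)
  pose ps := [seq (w - z, P z * v * P w) | z <- s, w <- s].
  have vE : \sum_(p <- ps) p.2 = v.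
    rewrite big_allpairs_dep /= -[RHS]mul1r -P1 mulr_suml; apply: eq_bigr => z _.
    by rewrite -mulr_sumr P1 mulr1.
  have := @memv_eigen_components _ ('M[C]_n.+1 : vectType C)
    (fun u : 'M[C]_n.+1 => lie u x) (N + N) _ S xS ps Num.conj.
  rewrite vE big_allpairs_dep /=.
  have -> : \sum_(i <- s) \sum_(j <- s) (j - i)^* *: (P i * v * P j) = lie v y.
    have -> : lie v y = \sum_(i <- s) \sum_(j <- s) j^* *: (P i * v * P j) -
                       \sum_(i <- s) \sum_(j <- s) i^* *: (P i * v * P j).
      congr (_ - _).
        rewrite -[v in LHS]mul1r -P1 mulr_suml mulr_suml; apply: eq_bigr => i _.
        by rewrite mulr_sumr; apply: eq_bigr => j _; rewrite scalemxAr.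
      rewrite -[v in LHS]mulr1 -P1 mulr_suml; apply: eq_bigr => i _.
      by rewrite !mulr_sumr; apply: eq_bigr => j _; rewrite -mulrA scalemxAl.
    rewrite -sumrB; apply: eq_bigr => i _; rewrite -sumrB; apply: eq_bigr => j _.
    by rewrite rmorphB scalerBl.
  apply=> //; first by move=> a u w; rewrite lieDl lieZl.
  move=> p /allpairsP[[z w] /= [zs ws ->]] /=.
  rewrite (eq_iter (f' := fun u => u * (x - w%:M) - (x - z%:M) * u)); last first.
    move=> u; rewrite /lie mulrBl mulrBr scalerBl.
    rewrite -[w *: u]mul_mx_scalar -[z *: u]mul_scalar_mx.
    by rewrite -[u *m _]/(u * _) -[_ *m u]/(_ * u); zmodule.
  apply: iter_mulrB_eq0; first by rewrite !mulrA xP // !mul0r.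
  have h : P w * (x - w%:M) ^+ N = 0 by rewrite (commrX N (esym (Pxz w))) xP.
  by rewrite -!mulrA h !mulr0.
(* The trace is the sum of the nonnegative numbers [|z|^2] times the rank of [P z]; if it is 0, the
   projections at nonzero eigenvalues vanish. *)
rewrite /y mulr_sumr raddf_sum /= => tr0.
have trxP z : z \in s -> \tr (x * P z) = z * (\rank (P z))%:R.
  move=> zs; rewrite -{1}[x](subrK z%:M) mulrDl mxtraceD mxtrace_nilpotent ?add0r.
    by rewrite -[_ * P z]/(_ *m P z) mul_scalar_mx mxtraceZ trP.
  exists N; rewrite exprMn_comm; last exact: Pxz.
  have N0 : (0 < N)%N.
    by rewrite lt0n size_eq0; apply: contraNneq s0; rewrite /s => ->.
  by rewrite -[X in _ * _ ^+ X](prednK N0) exprS mulrA xP ?mul0r.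
have : \sum_(z <- s) z^* * (z * (\rank (P z))%:R) == 0.
  apply/eqP; rewrite -[RHS]tr0; apply: eq_big_seq => z zs.
  by rewrite -[x * _]scalemxAr mxtraceZ trxP.
rewrite psumr_eq0 => [/allP Pz|z _]; last first.
  by rewrite mulrA [z^* * z]mulrC mulr_ge0 ?mul_conjC_ge0.
exists N; rewrite -[_ ^+ _]mulr1 -P1 mulr_sumr big_seq big1 // => z zs.
have := Pz z zs; rewrite /= mulrA [z^* * z]mulrC mulf_eq0 mul_conjC_eq0 pnatr_eq0.
rewrite mxrank_eq0 => /orP[/eqP z0|/eqP ->]; last by rewrite mulr0.
by have := xP z zs; rewrite z0 -scalemx1 scale0r subr0 => ->.
Qed.
End ConjSemisimple.

(** Turns a linear predicate in [Prop] into a subspace: a subspace inside [P] that misses an element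
    of [P] can be enlarged by a line. *)
Lemma vspace_of_linear (F : fieldType) (V : vectType F) (P : V -> Prop) :
  P 0 -> (forall a u v, P u -> P v -> P (a *: u + v)) ->
  exists U : {vspace V}, forall x, x \in U <-> P x.
Proof.
move=> P0 PL.
suff h d (U : {vspace V}) : (forall x, x \in U -> P x) -> (\dim {:V} - \dim U <= d)%N ->
    exists U : {vspace V}, forall x, x \in U <-> P x.
  by apply: (h (\dim {:V}) 0%VS); [move=> x; rewrite memv0 => /eqP ->|rewrite leq_subr].
elim: d U => [|d IH] U UP dU.
  exists U => x; split; first exact: UP.
  have /eqP -> : (U == fullv)%VS by rewrite eqEdim subvf -subn_eq0 -leqn0.
  by rewrite memvf.
have [[x [Px xU]]|no] := EM (exists x, P x /\ x \notin U).
  apply: (IH (U + <[x]>)%VS).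
    by move=> _ /memv_addP[u /UP Pu [_ /vlineP[c ->] ->]]; rewrite addrC; apply: PL.
  have lt : (\dim U < \dim (U + <[x]>))%N.
    rewrite ltnNge; apply/negP => h; move/negP: xU; apply.
    have /eqP -> : (U == U + <[x]>)%VS by rewrite eqEdim addvSl.
    by apply: (subvP (addvSr _ _)); apply: memv_line.
  rewrite -ltnS; apply: leq_trans dU; apply: ltn_sub2l => //.
  by apply: leq_trans lt _; apply/dimvS/subvf.
exists U => x; split; first exact: UP.
by move=> Px; case: (boolP (x \in U)) => // xU; case: no; exists x.
Qed.

(** * Brackets of subspaces, ideals and irreducible modules *)

Section Brackets.
Variable F : fieldType.

Definition bracket n (U V : {vspace 'M[F]_n}) : {vspace 'M[F]_n} :=
  <<in_tuple [seq lie u v | u <- vbasis U, v <- vbasis V]>>%VS.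

Lemma lie_suml n I (r : seq I) P (u : I -> 'M[F]_n) v :
  lie (\sum_(i <- r | P i) u i) v = \sum_(i <- r | P i) lie (u i) v.
Proof. by rewrite /lie mulr_suml mulr_sumr sumrB. Qed.

Lemma lie_sumr n I (r : seq I) P (u : I -> 'M[F]_n) v :
  lie v (\sum_(i <- r | P i) u i) = \sum_(i <- r | P i) lie v (u i).
Proof. by rewrite /lie mulr_suml mulr_sumr sumrB. Qed.

Lemma memv_bracket n (U V : {vspace 'M[F]_n}) u v :
  u \in U -> v \in V -> lie u v \in bracket U V.
Proof.
move=> uU vV; rewrite (coord_vbasis uU) (coord_vbasis vV) lie_suml.
apply: memv_suml => i _; rewrite lie_sumr; apply: memv_suml => j _.
rewrite lieZl lieZr; do 2!apply: memvZ.
by apply: memv_span; apply: allpairs_f; rewrite mem_nth // size_tuple.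
Qed.

Lemma bracket_sub n (U V W : {vspace 'M[F]_n}) :
  (forall u v, u \in U -> v \in V -> lie u v \in W) -> (bracket U V <= W)%VS.
Proof.
move=> h; apply/span_subvP => _ /allpairsP[[u v] /= [uU vV ->]].
by apply: h; apply: vbasis_mem.
Qed.

Lemma bracket_eq0 n (U V : {vspace 'M[F]_n}) (f : 'M[F]_n -> F) :
  (forall a x y, f (a *: x + y) = a * f x + f y) ->
  (forall u v, u \in U -> v \in V -> f (lie u v) = 0) ->
  forall x, x \in bracket U V -> f x = 0.
Proof.
move=> fL h x xUV.
have f0 : f 0 = 0 by have := fL (-1) 0 0; rewrite scaler0 addr0 mulN1r addNr.
rewrite (coord_span (xUV : x \in <<_>>%VS)).
elim/big_ind: _ => // [u v fu fv|i _]; first by rewrite -[u]scale1r fL fu fv mulr0 addr0.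
rewrite -[_ *: _]addr0 fL f0 addr0 (_ : f _ = 0) ?mulr0 //.
have : (in_tuple [seq lie u v | u <- vbasis U, v <- vbasis V])`_i \in
   [seq lie u v | u <- vbasis U, v <- vbasis V] by rewrite mem_nth.
by case/allpairsP => [[u v] /= [uU vV ->]]; apply: h; apply: vbasis_mem.
Qed.

Lemma mxtrace_lie n (x y z : 'M[F]_n) : \tr (lie x y * z) = \tr (x * lie y z).
Proof.
rewrite /lie mulrBl mulrBr [LHS]raddfB [RHS]raddfB /=; congr (_ - _).
  by rewrite mulrA.
by rewrite -mulrA [LHS]mxtrace_mulC -[_ *m y]/(_ * y) -mulrA.
Qed.

Definition ideal n (g a : {vspace 'M[F]_n}) :=
  (a <= g)%VS /\ forall x y, x \in g -> y \in a -> lie x y \in a.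

(** The zero module counts as irreducible. *)
Definition irreducible n (g : {vspace 'M[F]_n}) :=
  forall U : {vspace 'rV[F]_n}, (forall x u, x \in g -> u \in U -> u *m x \in U) ->
  U = 0%VS \/ U = fullv.

Lemma ideal_bracket n (g a b : {vspace 'M[F]_n}) :
  ideal g a -> ideal g b -> ideal g (bracket a b).
Proof.
move=> [ag ia] [bg ib]; split.
  by apply: bracket_sub => u v ua vb; apply/(subvP bg)/ib => //; apply: (subvP ag).
move=> x y xg /coord_span ->; rewrite lie_sumr; apply: memv_suml => i _.
rewrite lieZr memvZ //.
have : (in_tuple [seq lie u v | u <- vbasis a, v <- vbasis b])`_i \in
   [seq lie u v | u <- vbasis a, v <- vbasis b] by rewrite mem_nth.
case/allpairsP => [[u v] /= [/vbasis_mem ua /vbasis_mem vb ->]].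
by rewrite lie_jacobi -[- lie (lie x v) u]lieC memvD // memv_bracket // ?ia ?ib.
Qed.

Definition annihilated n (a : {vspace 'M[F]_n}) : {vspace 'rV[F]_n} :=
  (\bigcap_(i < \dim a) lker (linfun (mulmxr (vbasis a)`_i)))%VS.

Lemma annihilatedP n (a : {vspace 'M[F]_n}) u :
  reflect (forall y, y \in a -> u *m y = 0) (u \in annihilated a).
Proof.
apply: (iffP idP) => [h y ya|h].
  rewrite (coord_vbasis ya) mulmx_sumr big1 // => i _.
  rewrite -scalemxAr; move/subv_bigcapP: h => /(_ i isT).
  by rewrite -memvE memv_ker lfunE /= => /eqP ->; rewrite scaler0.
rewrite memvE; apply/subv_bigcapP => i _; rewrite -memvE memv_ker lfunE /=.
by apply/eqP/h; rewrite vbasis_mem // mem_nth // size_tuple.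
Qed.

(** The rows killed by an ideal form a stable subspace, which by irreducibility is everything as
    soon as it is not zero. *)
Lemma irreducible_annihilated n (g a : {vspace 'M[F]_n}) u :
  irreducible g -> ideal g a -> u != 0 -> u \in annihilated a -> a = 0%VS.
Proof.
move=> irr [_ ia] u0 uA; case: (irr (annihilated a)).
- move=> x v xg /annihilatedP va; apply/annihilatedP => y ya.
  rewrite -mulmxA (_ : x *m y = lie x y + y *m x); last by rewrite subrK.
  by rewrite mulmxDr mulmxA (va y) // (va (lie x y)) ?ia // mul0mx addr0.
- by move=> A0; move: uA; rewrite A0 memv0 (negPf u0).
move=> Af; apply/eqP; rewrite -subv0; apply/subvP => y ya; rewrite memv0.
apply/eqP/row_matrixP => i; rewrite row0 rowE.
by apply/(annihilatedP a) => //; rewrite Af memvf.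
Qed.

(** Engel's theorem modulo 0 gives a nonzero row killed by the ideal. *)
Lemma irreducible_nilpotent_ideal n (g a : {vspace 'M[F]_n}) :
  irreducible g -> ideal g a -> (forall x, x \in a -> matrix_nilpotent x) -> a = 0%VS.
Proof.
move=> irr ia nil; have [ag ai] := ia.
have lc : lie_closed a by move=> x y xa; apply/ai/(subvP ag).
have [le0|] := boolP ((fullv : {vspace 'rV[F]_n}) <= 0)%VS.
  apply/eqP; rewrite -subv0; apply/subvP => y ya; rewrite memv0.
  apply/eqP/row_matrixP => i; rewrite row0.
  by apply/eqP; rewrite -memv0; apply: (subvP le0); apply: memvf.
move=> nle; have [|||||||u _ [u0 ua]] := @engel F n a 'rV[F]_n (fun x u => u *m x) 0%VS fullv lc nil.
- by move=> x c v w; rewrite mulmxDl scalemxAl.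
- by move=> c x y v; rewrite mulmxDr scalemxAr.
- by move=> x y v; rewrite /lie mulmxBr !mulmxA.
- move=> x /nil[N xN]; exists N => v.
  have -> : iter N (mulmx^~ x) v = v *m x ^+ N.
    elim: N {xN} => [|N IH]; first by rewrite expr0 mulmx1.
    by rewrite iterS IH exprSr mulmxA.
  by rewrite xN mulmx0.
- by move=> x v _; rewrite !memv0 => /eqP ->; rewrite mul0mx.
- by move=> x v _ _; rewrite memvf.
- by [].
apply: (irreducible_annihilated irr ia (u := u)); first by rewrite -memv0.
by apply/annihilatedP => y /ua; rewrite memv0 => /eqP.
Qed.

Lemma schur n (g : {vspace 'M[F]_n}) z :
  irreducible g -> (forall x, x \in g -> x *m z = z *m x) -> z != 0 -> z \in unitmx.
Proof.
move=> irr zg z0; case: (irr (annihilated <[z]>)).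
- move=> x u xg /annihilatedP uz; apply/annihilatedP => _ /vlineP[c ->].
  by rewrite -scalemxAr -mulmxA zg // mulmxA uz ?memv_line // mul0mx scaler0.
- move=> A0; rewrite -row_free_unit -kermx_eq0; apply/eqP/row_matrixP => i; rewrite row0.
  apply/eqP; rewrite -memv0 -A0; apply/annihilatedP => _ /vlineP[c ->].
  by rewrite -scalemxAr -row_mul mulmx_ker row0 scaler0.
move=> Af; case/eqP: z0; apply/row_matrixP => i; rewrite row0 rowE.
by apply: (annihilatedP <[z]> _ _) => //; rewrite ?Af ?memvf ?memv_line.
Qed.

End Brackets.

(** * Cartan's criterion, the Casimir element and the vanishing of first cohomology *)

Section Cartan.
Variable C : numClosedFieldType.

Lemma mxtrace_mulr_linear n (y : 'M[C]_n) a (u v : 'M[C]_n) :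
  \tr ((a *: u + v) * y) = a * \tr (u * y) + \tr (v * y).
Proof. by rewrite mulrDl mxtraceD -[a *: u * y]/(_ *m _) -scalemxAl mxtraceZ. Qed.

(** For the [y] of [conj_semisimple], bracketing with [y] preserves [a], so that [tr ([u, v] y) = tr
    (u [v, y])] vanishes on [a]. As [x] is a sum of brackets, [tr (x y) = 0]. *)
Lemma cartan_criterion n (a : {vspace 'M[C]_n}) :
  lie_closed a -> (a <= bracket a a)%VS ->
  (forall x y, x \in a -> y \in a -> \tr (x * y) = 0) ->
  forall x, x \in a -> matrix_nilpotent x.
Proof.
case: n a => [|n] a lc sa tra x xa.
  by exists 0%N; apply/matrixP => -[].
have [y [ya nil]] := conj_semisimple x; apply: nil.
have {}ya : forall v, v \in a -> lie v y \in a.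
  by apply: ya => v va; apply: lc.
apply: (bracket_eq0 (f := fun x => \tr (x * y))) (subvP sa _ xa).
  by move=> *; rewrite mxtrace_mulr_linear.
by move=> u v ua va; rewrite mxtrace_lie tra // ya.
Qed.

(** The ideal [[g, a]] consists of nilpotent matrices: the elements [v] of [a] commute with each [z]
    in it, so that [tr ([u, v] z^k) = tr (u [v, z^k]) = 0]. *)
Lemma irreducible_abelian_ideal n (g a : {vspace 'M[C]_n}) :
  irreducible g -> ideal g a -> (forall x y, x \in a -> y \in a -> lie x y = 0) ->
  forall x y, x \in g -> y \in a -> lie x y = 0.
Proof.
move=> irr ia ab x y xg ya; have [ag ai] := ia.
have ig : ideal g g -> ideal g (bracket g a) by move=> ig; apply: ideal_bracket.
have sba : (bracket g a <= a)%VS by apply: bracket_sub => u v; apply: ai.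
have ib : ideal g (bracket g a).
  split; first exact: subv_trans sba ag.
  by move=> u v ug /(subvP sba) va; apply: memv_bracket.
have b0 : bracket g a = 0%VS.
  apply: (irreducible_nilpotent_ideal irr ib) => z zb.
  have za := subvP sba _ zb.
  apply: nilpotent_mxtrace => -[|k] // _; rewrite exprS.
  apply: (bracket_eq0 (f := fun x => \tr (x * z ^+ k)) (U := g) (V := a)) zb.
    by move=> *; rewrite mxtrace_mulr_linear.
  move=> u v ug va; rewrite mxtrace_lie.
  have cvz : GRing.comm v z.
    by apply/eqP; rewrite -subr_eq0; apply/eqP/ab.
  by rewrite /lie (commrX k cvz) subrr mulr0 mxtrace0.
by apply/eqP; rewrite -memv0 -b0 memv_bracket.
Qed.

Lemma minimal_ideal n (g : {vspace 'M[C]_n}) : lie_closed g -> g != 0%VS ->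
  exists a, [/\ ideal g a, a != 0%VS &
    forall a', ideal g a' -> (a' <= a)%VS -> a' = 0%VS \/ a' = a].
Proof.
move=> lg g0.
suff h d : forall a, ideal g a -> a != 0%VS -> (\dim a <= d)%N ->
  exists a, [/\ ideal g a, a != 0%VS &
    forall a', ideal g a' -> (a' <= a)%VS -> a' = 0%VS \/ a' = a].
  by apply: (h (\dim g) g) => //; split=> // x y; apply: lg.
elim: d => [|d IH] a ia a0 da.
  by move: a0; rewrite -dimv_eq0 -leqn0 da.
have [[a' [ia' a'0 lt]]|no] := EM (exists a', [/\ ideal g a', a' != 0%VS & (\dim a' <= d)%N]).
  exact: (IH a').
exists a; split=> // a' ia' sa; have [->|a'0] := eqVneq a' 0%VS; [by left|right].
apply/eqP; rewrite eqEdim sa leqNgt; apply/negP => lt; apply: no.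
by exists a'; split=> //; rewrite -ltnS; apply: leq_trans lt da.
Qed.

Section Casimir.
Variables (n : nat) (g a : {vspace 'M[C]_n}).
Hypothesis ia : ideal g a.
Hypothesis nondeg : forall x, x \in a -> (forall y, y \in a -> \tr (x * y) = 0) -> x = 0.

Let d := \dim a.
Let X (i : 'I_d) : 'M[C]_n := (vbasis a)`_i.
Let Gram : 'M[C]_d := \matrix_(i, j) \tr (X i * X j).
(** The basis dual to [X] for the trace form. *)
Definition casimir_dual (i : 'I_d) : 'M[C]_n := \sum_j invmx Gram i j *: X j.
Let Y := casimir_dual.

Let Xa i : X i \in a.
Proof. by rewrite vbasis_mem // mem_nth // size_tuple. Qed.

Let Ya i : Y i \in a.
Proof. by apply: memv_suml => j _; rewrite memvZ. Qed.

Let trC (x y : 'M[C]_n) : \tr (x * y) = \tr (y * x).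
Proof. exact: mxtrace_mulC. Qed.

Let tr_suml I (r : seq I) (c : I -> C) (u : I -> 'M[C]_n) (y : 'M[C]_n) :
  \tr ((\sum_(i <- r) c i *: u i) * y) = \sum_(i <- r) c i * \tr (u i * y).
Proof.
elim: r => [|i r IH]; first by rewrite !big_nil mul0r mxtrace0.
by rewrite !big_cons mxtrace_mulr_linear IH.
Qed.

Let coordX y : y \in a -> y = \sum_i coord (vbasis a) i y *: X i.
Proof. exact: coord_vbasis. Qed.

Let GramU : Gram \in unitmx.
Proof.
rewrite -row_free_unit -kermx_eq0; apply/eqP/row_matrixP => k; rewrite row0.
set v := row k _; have vG : v *m Gram = 0 by rewrite -row_mul mulmx_ker row0.
have x0 : \sum_i v 0 i *: X i = 0.
  apply: nondeg; first by apply: memv_suml => j _; rewrite memvZ.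
  move=> y /coordX ->; rewrite trC tr_suml big1 // => j _.
  rewrite trC tr_suml; move/rowP/(_ j): vG; rewrite [LHS]mxE [RHS]mxE => vG.
  rewrite (eq_bigr (fun i => v 0 i * Gram i j)); first by rewrite vG mulr0.
  by move=> i _; rewrite [Gram _ _]mxE.
apply/rowP => j; rewrite [RHS]mxE.
by have /freeP := basis_free (vbasisP a); apply.
Qed.

Let trXY i j : \tr (X i * Y j) = (i == j)%:R.
Proof.
rewrite trC [LHS](tr_suml _ (fun k => invmx Gram j k) X); have := mulVmx GramU => /matrixP/(_ j i).
rewrite [LHS]mxE [RHS]mxE eq_sym => <-; apply: eq_bigr => k _.
by rewrite [Gram k i]mxE.
Qed.

Let expandX y : y \in a -> y = \sum_i \tr (y * Y i) *: X i.
Proof.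
move=> ya; rewrite {1}(coordX ya); apply: eq_bigr => i _; congr (_ *: _).
rewrite [in RHS](coordX ya) tr_suml (bigD1 i) //= trXY eqxx mulr1 big1 ?addr0 // => j ji.
by rewrite trXY (negPf ji) mulr0.
Qed.

Let expandY y : y \in a -> y = \sum_i \tr (y * X i) *: Y i.
Proof.
move=> ya; apply/eqP; rewrite -subr_eq0; apply/eqP/nondeg.
  by rewrite memvB //; apply: memv_suml => j _; rewrite memvZ.
move=> z /expandX ->; rewrite trC tr_suml big1 // => j _.
rewrite mulrBr (raddfB (@mxtrace C n)) [X in _ - X](_ : _ = \tr (X j * y)) ?subrr ?mulr0 //.
have YX k : \tr (Y k * X j) = (j == k)%:R by rewrite trC trXY.
rewrite [LHS]trC [LHS](tr_suml _ _ Y) (bigD1 j) //= YX eqxx mulr1 trC big1 ?addr0 //.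
by move=> k kj; rewrite YX eq_sym (negPf kj) mulr0.
Qed.

(** Invariance under [g] of the sum of the tensors of [X i] with [Y i]. The bilinear map [f] stands
    for the tensor product, so that one computation serves [casimir_comm] and [casimir_cocycle]. *)
Let dual_invariant (V : lmodType C) (f : 'M[C]_n -> 'M[C]_n -> V) x : x \in g ->
  (forall c u v w, f (c *: u + v) w = c *: f u w + f v w) ->
  (forall c u v w, f w (c *: u + v) = c *: f w u + f w v) ->
  \sum_i (f (lie (X i) x) (Y i) + f (X i) (lie (Y i) x)) = 0.
Proof.
move=> xg fl fr.
have iaR u : u \in a -> lie u x \in a by move=> ua; rewrite lieC memvN; apply: ia.2.
have f0l w : f 0 w = 0 by have := fl (-1) 0 0 w; rewrite scaler0 addr0 scaleN1r addNr.
have f0r w : f w 0 = 0 by have := fr (-1) 0 0 w; rewrite scaler0 addr0 scaleN1r addNr.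
have fsl (c : 'I_d -> C) u w : f (\sum_i c i *: u i) w = \sum_i c i *: f (u i) w.
  by elim/big_rec2: _ => // i y1 y2 _ <-; rewrite fl.
have fsr (c : 'I_d -> C) u w : f w (\sum_i c i *: u i) = \sum_i c i *: f w (u i).
  by elim/big_rec2: _ => // i y1 y2 _ <-; rewrite fr.
rewrite big_split /=.
rewrite (eq_bigr (fun i => \sum_j \tr (lie (X i) x * Y j) *: f (X j) (Y i))); last first.
  by move=> i _; rewrite {1}[lie (X i) x]expandX ?iaR // fsl.
rewrite [X in _ + X](eq_bigr (fun j => \sum_i \tr (lie (Y j) x * X i) *: f (X j) (Y i))); last first.
  by move=> i _; rewrite {1}[lie (Y i) x]expandY ?iaR // fsr.
rewrite exchange_big -big_split big1 //= => j _; rewrite -big_split big1 //= => i _.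
rewrite -scalerDl (_ : _ + _ = 0) ?scale0r //.
by rewrite mxtrace_lie [lie x _]lieC mulrN (raddfN (@mxtrace C n)) [X in _ + X]trC addNr.
Qed.

Definition casimir : 'M[C]_n := \sum_i X i * Y i.

Lemma casimir_comm x : x \in g -> casimir *m x = x *m casimir.
Proof.
move=> xg; apply/eqP; rewrite -subr_eq0 -[_ - _]/(lie casimir x) lie_suml; apply/eqP.
rewrite -[RHS](dual_invariant (f := fun u v => u * v) xg).
- by apply: eq_bigr => i _; rewrite /lie; ncring.
- by move=> c u v w; rewrite mulrDl -[c *: u * w]/(_ *m _) -scalemxAl.
- by move=> c u v w; rewrite mulrDr -[w * (c *: u)]/(_ *m _) -scalemxAr.
Qed.

(** In characteristic 0 this is what makes the Casimir element nonzero. *)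
Lemma mxtrace_casimir : \tr casimir = d%:R.
Proof.
rewrite raddf_sum /= (eq_bigr (fun=> 1)) => [|i _]; last by rewrite trXY eqxx.
by rewrite sumr_const card_ord.
Qed.

(** The row [e] is the sum of the [b (X i) *m Y i]; the cocycle identity turns the claim into
    [dual_invariant] for [f u v = b u *m v]. *)
Lemma casimir_cocycle (b : 'M[C]_n -> 'rV[C]_n) :
  (forall c u v, b (c *: u + v) = c *: b u + b v) ->
  (forall x y, x \in g -> y \in g -> b (lie x y) = b x *m y - b y *m x) ->
  exists e, forall x, x \in g -> b x *m casimir = e *m x.
Proof.
move=> bL bC; exists (\sum_i b (X i) *m Y i) => x xg.
have ag := ia.1.
rewrite /casimir mulmx_sumr mulmx_suml; apply/eqP; rewrite eq_sym -subr_eq0 -sumrB; apply/eqP.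
rewrite -[RHS](dual_invariant (f := fun u v => b u *m v) xg).
- apply: eq_bigr => i _; rewrite bC // ?(subvP ag) // /lie mulmxBl mulmxBr.
  by rewrite -![_ * _]/(_ *m _) !mulmxA; zmodule.
- by move=> c u v w; rewrite bL mulmxDl scalemxAl.
- by move=> c u v w; rewrite mulmxDr scalemxAr.
Qed.

End Casimir.

(** It suffices to find a nonzero [z] that commutes with [g] and makes [b x *m z] of the form
    [e *m x], as [z] is invertible by Schur's lemma. A minimal ideal [a] provides it. If [a] is
    abelian it is central, and any nonzero element of it will do. Otherwise [a] is its own bracket,
    Cartan's criterion makes the trace form nondegenerate on it, and [z] is its Casimir element. *)
Lemma irreducible_cocycle n (g : {vspace 'M[C]_n}) (b : 'M[C]_n -> 'rV[C]_n) :
  lie_closed g -> irreducible g ->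
  (forall c u v, b (c *: u + v) = c *: b u + b v) ->
  (forall x y, x \in g -> y \in g -> b (lie x y) = b x *m y - b y *m x) ->
  exists w, forall x, x \in g -> b x = w *m x.
Proof.
move=> lg irr bL bC; have [g0|g0] := eqVneq g 0%VS.
  exists 0 => x; rewrite g0 memv0 => /eqP ->.
  by have := bL (-1) 0 0; rewrite scaler0 addr0 scaleN1r addNr mul0mx.
have [a [ia a0 amin]] := minimal_ideal lg g0.
have [ag ai] := ia.
have la : lie_closed a by move=> x y xa; apply/ai/(subvP ag).
have sba : (bracket a a <= a)%VS by apply: bracket_sub => u v ua va; apply: la.
have invert z e : (forall x, x \in g -> z *m x = x *m z) -> z != 0 ->
    (forall x, x \in g -> b x *m z = e *m x) -> exists w, forall x, x \in g -> b x = w *m x.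
  move=> zc z0 be; have zU : z \in unitmx by apply: (schur irr) z0 => x /zc.
  exists (e *m invmx z) => x xg; rewrite -[LHS](mulmxK zU) be // -!mulmxA; congr (_ *m _).
  by rewrite -[RHS](mulmxK zU) -(mulmxA (invmx z)) -zc // mulmxA mulVmx // mul1mx.
have [ab0|aba] := amin _ (ideal_bracket ia ia) sba.
  have cen := @irreducible_abelian_ideal n g a irr ia _.
  have za := memv_pick a; have z0 : vpick a != 0 by rewrite vpick0.
  have cz x : x \in g -> lie x (vpick a) = 0.
    move=> xg; apply: cen => // u v ua va; apply/eqP.
    by rewrite -memv0 -ab0 memv_bracket.
  apply: (invert (vpick a) (b (vpick a))) => // x xg.
    by apply/eqP; rewrite eq_sym -subr_eq0; apply/eqP/cz.
  apply/eqP; rewrite -subr_eq0 -bC // ?(subvP ag) // cz //.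
  by have := bL (-1) 0 0; rewrite scaler0 addr0 scaleN1r addNr => ->.
(* The radical of the trace form on [a] is an ideal, hence 0 or [a] by minimality. *)
have [||rad radP] := @vspace_of_linear _ ('M[C]_n : vectType C)
  (fun x : 'M[C]_n => x \in a /\ forall y, y \in a -> \tr (x * y) = 0).
- by split=> [|y ya]; rewrite ?mem0v // mul0r mxtrace0.
- move=> c u v [ua ut] [va vt]; split=> [|y ya]; first by rewrite memvD ?memvZ.
  by rewrite mxtrace_mulr_linear ut // vt // mulr0 addr0.
have rada : (rad <= a)%VS by apply/subvP => x /radP[].
have irad : ideal g rad.
  split; first exact: subv_trans rada ag.
  move=> x y xg /radP[ya yt]; apply/radP; split=> [|z za]; first exact: ai.
  have trN u : \tr (- u) = - \tr u :> C by exact: raddfN.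
  by rewrite lieC mulNr trN mxtrace_lie yt ?oppr0 // ai.
have [rad0|rada'] := amin _ irad rada; last first.
  case/eqP: a0; apply: (irreducible_nilpotent_ideal irr ia).
  apply: cartan_criterion => //; first by rewrite aba.
  by move=> x y; rewrite -{1}rada' => /radP[_]; apply.
have nondeg x : x \in a -> (forall y, y \in a -> \tr (x * y) = 0) -> x = 0.
  by move=> xa xt; apply/eqP; rewrite -memv0 -rad0; apply/radP.
have [e be] := casimir_cocycle ia nondeg bL bC.
apply: (invert (casimir a) e) => //; first exact: casimir_comm.
apply/eqP => /(congr1 (@mxtrace C n)); rewrite mxtrace_casimir // mxtrace0 => /eqP.
by rewrite pnatr_eq0 dimv_eq0 (negPf a0).
Qed.
End Cartan.

(** * Derived series and subquotients *)

Section Derived.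
Variable F : fieldType.

Definition derived_lie n (U : {vspace 'M[F]_n}) := bracket U U.

Definition solvable_lie n (U : {vspace 'M[F]_n}) := exists k, iter k (@derived_lie n) U = 0%VS.

Lemma derived_lieS n (U V : {vspace 'M[F]_n}) :
  (U <= V)%VS -> (derived_lie U <= derived_lie V)%VS.
Proof.
by move=> /subvP UV; apply: bracket_sub => u v /UV uV /UV vV; apply: memv_bracket.
Qed.

Lemma iter_derived_lieS n k (U V : {vspace 'M[F]_n}) :
  (U <= V)%VS -> (iter k (@derived_lie n) U <= iter k (@derived_lie n) V)%VS.
Proof. by move=> UV; elim: k => //= k; apply: derived_lieS. Qed.

Lemma derived_lie_closed n (U : {vspace 'M[F]_n}) : lie_closed U -> (derived_lie U <= U)%VS.
Proof. by move=> h; apply: bracket_sub => u v; apply: h. Qed.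

Lemma lie_closed_derived n (U : {vspace 'M[F]_n}) : lie_closed U -> lie_closed (derived_lie U).
Proof.
move=> h u v /(subvP (derived_lie_closed h)) uU /(subvP (derived_lie_closed h)) vU.
exact: memv_bracket.
Qed.

Lemma iter_derived_lie_closed n k (U : {vspace 'M[F]_n}) : lie_closed U ->
  lie_closed (iter k (@derived_lie n) U) /\ (iter k (@derived_lie n) U <= U)%VS.
Proof.
move=> h; elim: k => [|k [IH1 IH2]] //=; split; first exact: lie_closed_derived.
exact: subv_trans (derived_lie_closed IH1) IH2.
Qed.

Lemma solvable_lie_img n m (f : 'Hom('M[F]_n, 'M[F]_m)) (U : {vspace 'M[F]_n}) :
  lie_closed U ->
  (forall x y, x \in U -> y \in U -> f (lie x y) = lie (f x) (f y)) ->
  solvable_lie U -> solvable_lie (f @: U)%VS.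
Proof.
move=> lU hf [k kU]; exists k; apply/eqP; rewrite -subv0.
have -> : 0%VS = (f @: iter k (@derived_lie n) U)%VS by rewrite kU limg0.
elim: k {kU} => //= k IH; apply: subv_trans (derived_lieS IH) _.
have [lk sk] := iter_derived_lie_closed k lU.
apply: bracket_sub => _ _ /memv_imgP[u uU ->] /memv_imgP[v vU ->].
by rewrite -hf ?(subvP sk) // memv_img // memv_bracket.
Qed.

Lemma ideal_derived n k (g : {vspace 'M[F]_n}) : lie_closed g ->
  ideal g (iter k (@derived_lie n) g).
Proof.
move=> lg; elim: k => [|k IH] /=; first by split=> // x y; apply: lg.
exact: ideal_bracket.
Qed.

(* [s] is a basis of a complement of [N] in [S], and [q] the projection along [N]. *)
Lemma subquotient n (N S : {vspace 'rV[F]_n}) : (N <= S)%VS ->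
  exists m (s : 'M[F]_(m, n)) (q : 'M[F]_(n, m)),
  [/\ forall u, u *m s \in S, s *m q = 1%:M, forall v, v \in N -> v *m q = 0 &
      forall v, v \in S -> v - v *m q *m s \in N].
Proof.
move=> NS; pose T := (S :\: N)%VS.
have TN : (T :&: N = 0)%VS by rewrite capv_diff.
have TS : (T <= S)%VS by rewrite -[X in (_ <= X)%VS](addv_diff_cap S N) addvSl.
have STN v : v \in S -> v \in (T + N)%VS.
  by move=> vS; rewrite addv_diff (addv_idPl NS).
pose s := \matrix_(i < \dim T) (vbasis T)`_i.
pose f v := \row_(j < \dim T) coord (vbasis T) j (daddv_pi T N v).
pose q := \matrix_(i < n) f (delta_mx 0 i).
have vq v : v *m q = f v.
  apply/rowP => j; rewrite [LHS]mxE [RHS]mxE {2}[v]row_sum_delta !linear_sum /=.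
  by apply: eq_bigr => i _; rewrite !linearZ /= !mxE.
have fs v : f v *m s = daddv_pi T N v.
  rewrite [RHS](coord_vbasis (memv_pi T N v)) mulmx_sum_row; apply: eq_bigr => i _.
  by rewrite mxE rowK.
have us u : u *m s \in T.
  rewrite mulmx_sum_row; apply: memv_suml => i _; rewrite rowK memvZ // vbasis_mem //.
  by rewrite mem_nth // size_tuple.
exists (\dim T), s, q; split.
- by move=> u; apply: (subvP TS).
- apply/row_matrixP => i; rewrite row_mul vq rowK row1; apply/rowP => j.
  rewrite mxE daddv_pi_id //; last by rewrite vbasis_mem // mem_nth // size_tuple.
  by rewrite coord_free ?(basis_free (vbasisP T)) // !mxE eqxx eq_sym.
- move=> v vN; rewrite vq; apply/rowP => j; rewrite !mxE.
  have -> : daddv_pi T N v = 0.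
    have NT : (N :&: T = 0)%VS by rewrite capvC.
    have := daddv_pi_add TN (STN v (subvP NS v vN)).
    by rewrite (daddv_pi_id NT vN) => /(canRL (addrK _)); rewrite subrr.
  by rewrite linear0.
move=> v vS; rewrite vq fs -{1}(daddv_pi_add TN (STN v vS)).
by rewrite [X in X - _]addrC addrK memv_pi.
Qed.

Lemma row0_unitmx n (w : 'rV[F]_n.+1) : w != 0 ->
  exists2 Q : 'M[F]_n.+1, Q \in unitmx & exists c, c != 0 /\ w = c *: row 0 Q.
Proof.
move=> w0; exists (row_ebase w); first exact: row_ebase_unit.
exists (col_ebase w 0 0); split.
  by have := col_ebase_unit w; rewrite unitmxE det_mx11 unitfE.
have r1 : \rank w = 1%N by rewrite rank_rV w0.
rewrite -{1}(mulmx_ebase w) r1 [col_ebase w]mx11_scalar mul_scalar_mx.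
rewrite -scalemxAl [_%:M 0 0]mxE eqxx mulr1n; congr (_ *: _); apply/rowP => j; rewrite !mxE.
rewrite (bigD1 0) //= big1 ?addr0; first by rewrite !mxE mul1r.
move=> i i0; rewrite !mxE (_ : (_ == _ :> nat) = false) ?mul0r //.
by apply/negbTE; rewrite eq_sym; exact: i0.
Qed.

End Derived.

(** * Left-symmetric products *)

Lemma maximal_vspace (F : fieldType) (V : vectType F) (P : {vspace V} -> Prop) U0 :
  P U0 -> exists2 U, P U & forall U', P U' -> (U <= U')%VS -> U' = U.
Proof.
move: {2}(\dim {:V} - \dim U0)%N (leqnn (\dim {:V} - \dim U0)) => d.
elim: d U0 => [|d IH] U0 dU PU.
  exists U0 => // U' _ sU; apply/eqP; rewrite eq_sym eqEdim sU.
  rewrite (leq_trans (dimvS (subvf U'))) // -subn_eq0 -leqn0 //.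
have [[U' [PU' sU nU]]|no] := EM (exists U', [/\ P U', (U0 <= U')%VS & U' <> U0]).
  apply: (IH U') => //; rewrite -ltnS; apply: leq_trans dU; apply: ltn_sub2l.
    rewrite (leq_trans _ (dimvS (subvf U'))) // ltnNge; apply/negP => h.
    by apply/nU/eqP; rewrite eq_sym eqEdim sU.
  by rewrite ltnNge; apply/negP => h; apply/nU/eqP; rewrite eq_sym eqEdim sU.
exists U0 => // U' PU' sU; apply: contrapT => nU; apply: no; by exists U'.
Qed.

(* A left-symmetric product [b . a = a *m L b] on row vectors. *)
Section LeftSymmetric.
Variables (C : numClosedFieldType) (n : nat) (L : 'Hom('rV[C]_n, 'M[C]_n)).
Hypothesis lsa : forall a b, lie (L a) (L b) = L (a *m L b - b *m L a).

Definition right_mult (b : 'rV[C]_n) : 'M[C]_n := \matrix_i (b *m L (delta_mx 0 i)).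

Lemma mul_right_mult b w : w *m right_mult b = b *m L w.
Proof.
rewrite {2}[w]row_sum_delta linear_sum mulmx_sumr mulmx_sum_row.
by apply: eq_bigr => i _; rewrite rowK linearZ /= scalemxAr.
Qed.

Hypothesis nilR : forall b, matrix_nilpotent (right_mult b).

(** Affine fields are used because [L] need not be injective: the translation part [a] makes the
    matrix Lie algebra faithful. *)
Definition affine_field (a : 'rV[C]_n) : 'M[C]_(1 + n) := block_mx 0 a 0 (L a).

Fact affine_field_linear : linear affine_field.
Proof.
move=> c a b; rewrite /affine_field linearP scale_block_mx add_block_mx.
by rewrite !scaler0 !addr0.
Qed.
HB.instance Definition _ := GRing.isLinear.Build C _ _ *:%R affine_field affine_field_linear.

Lemma affine_field_lie a b :
  lie (affine_field a) (affine_field b) = affine_field (a *m L b - b *m L a).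
Proof.
rewrite /lie -![_ * _]/(_ *m _) /affine_field !mulmx_block opp_block_mx add_block_mx.
by rewrite !mul0mx !mulmx0 !addr0 !add0r !oppr0 -lsa.
Qed.

Let X := linfun affine_field.
Let XE a : X a = affine_field a. Proof. by rewrite lfunE. Qed.

Let lie_closed_X (S : {vspace 'rV[C]_n}) :
  (forall a b, a \in S -> b \in S -> a *m L b - b *m L a \in S) -> lie_closed (X @: S)%VS.
Proof.
move=> h _ _ /memv_imgP[a aS ->] /memv_imgP[b bS ->].
by rewrite !XE affine_field_lie -XE memv_img // h.
Qed.

(** Induction on the dimension. Let [N] be a maximal proper left ideal of [S], and [k] the elements
    that act trivially on the irreducible module [S / N]. If [k] is not inside [N], then
    [S = k + N], and the brackets of [k] fall in [N], which is solvable. Otherwise an element modulo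
    [N] is determined by its action on [S / N], and this dependence is a cocycle. As it is a
    coboundary, some right multiplication is the identity of [S / N], against nilpotency. *)
Lemma lsa_solvable (S : {vspace 'rV[C]_n}) :
  (forall a b, a \in S -> b \in S -> a *m L b \in S) -> solvable_lie (X @: S)%VS.
Proof.
move: {2}(\dim S) (leqnn (\dim S)) => d; elim: d S => [|d IH] S dS clS.
  exists 0%N => /=; move: dS; rewrite leqn0 dimv_eq0 => /eqP ->; exact: limg0.
have [->|S0] := eqVneq S 0%VS; first by exists 0%N; rewrite /= limg0.
pose P (N : {vspace 'rV[C]_n}) :=
  [/\ (N <= S)%VS, ~~ (S <= N)%VS & forall a v, a \in S -> v \in N -> v *m L a \in N].
have P0 : P 0%VS.
  split; rewrite ?sub0v // ?subv0 // => a v _; rewrite !memv0 => /eqP ->.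
  by rewrite mul0mx.
have [N [NS SN stN] Nmax] := maximal_vspace P0.
have inS v : v \in N -> v \in S by apply: subvP.
have dN : (\dim N <= d)%N.
  rewrite -ltnS; apply: leq_trans dS; rewrite ltnNge; apply/negP => h.
  by case/negP: SN; have /eqP -> : N == S by rewrite eqEdim NS.
have [r rN] := IH N dN (fun a b aN bN => stN b a (inS _ bN) aN).
have [m [s [q [sS sq Nq qN]]]] := subquotient NS.
have [||k kP] := @vspace_of_linear _ ('rV[C]_n : vectType C)
    (fun a => a \in S /\ forall v, v \in S -> v *m L a \in N).
- by split=> [|v _]; rewrite ?mem0v // linear0 mulmx0 mem0v.
- move=> c a b [aS aN] [bS bN]; split=> [|v vS]; first by rewrite memvD ?memvZ.
  by rewrite linearP /= mulmxDr -scalemxAr memvD ?memvZ ?aN ?bN.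
have kS : (k <= S)%VS by apply/subvP => a /kP[].
have brS a b : a \in S -> b \in S -> a *m L b - b *m L a \in S.
  by move=> aS bS; rewrite memvB ?clS.
have ik a y : a \in S -> y \in k -> a *m L y - y *m L a \in k.
  move=> aS /kP[yS yN]; apply/kP; split=> [|v vS]; first exact: brS.
  rewrite -lsa /lie mulmxBr -[L a * _]/(_ *m _) -[L y * _]/(_ *m _) !mulmxA.
  by rewrite memvB ?yN ?clS // stN // yN.
have [kN|kN] := boolP (k <= N)%VS; last first.
  have SkN : (S <= k + N)%VS.
    apply: contraNT kN => nS; rewrite -(Nmax (k + N)%VS) ?addvSl ?addvSr //.
    split; rewrite ?subv_add ?kS //.
    move=> a _ aS /memv_addP[y yk [v vN ->]]; rewrite mulmxDl.
    have -> : y *m L a = - (a *m L y - y *m L a) + a *m L y by zmodule.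
    have yN : a *m L y \in N by case/kP: yk => _; apply.
    by rewrite -addrA memv_add ?memvN ?ik // memvD // stN.
  have lS := lie_closed_X brS.
  have lN : lie_closed (X @: N)%VS.
    by apply: lie_closed_X => a b aN bN; rewrite memvB ?stN ?inS.
  have Dk : (derived_lie (X @: k) <= X @: N)%VS.
    apply: bracket_sub => _ _ /memv_imgP[a ak ->] /memv_imgP[b bk ->].
    case/kP: ak (ak) => aS aN ak; case/kP: bk => bS bN.
    by rewrite !XE affine_field_lie -XE memv_img // memvB ?aN ?bN.
  have DS j : (iter j (@derived_lie _ _) (X @: S) <=
               X @: k + iter j (@derived_lie _ _) (X @: N))%VS.
    elim: j => [|j IHj] /=; first by rewrite -limgD limgS.
    apply: subv_trans (derived_lieS IHj) _.
    have [_ sj] := iter_derived_lie_closed j lN.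
    have kk x y : x \in (X @: S)%VS -> y \in (X @: k)%VS -> lie x y \in (X @: k)%VS.
      move=> /memv_imgP[a aS ->] /memv_imgP[b bk ->].
      by rewrite !XE affine_field_lie -XE memv_img // ik.
    have XkS : (X @: k <= X @: S)%VS by apply: limgS.
    have XNS : (X @: N <= X @: S)%VS by apply: limgS.
    apply: bracket_sub => _ _ /memv_addP[x xk [u uN ->]] /memv_addP[y yk [v vN ->]].
    have vS := subvP XNS _ (subvP sj _ vN); have uS := subvP XNS _ (subvP sj _ uN).
    rewrite lieDl !lieDr addrA; apply: memv_add; last exact: memv_bracket.
    have xS := subvP XkS _ xk; apply: memvD; last exact: kk.
    by apply: memvD; [exact: kk | rewrite lieC memvN kk].
  (* [r] steps lead from [S] into [k], one more into [N], and [r] more to 0. *)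
  exists (r + r.+1)%N; apply/eqP; rewrite -subv0 iterD -rN; apply: iter_derived_lieS.
  rewrite iterS; apply: subv_trans Dk; apply: derived_lieS.
  by apply: subv_trans (DS r) _; rewrite rN addv0.
exfalso.
pose rho a := s *m L a *m q.
have vq v a : v \in S -> a \in S -> v *m L a *m q = v *m q *m rho a.
  move=> vS aS; have vE : v = (v - v *m q *m s) + v *m q *m s by rewrite subrK.
  have h0 : (v - v *m q *m s) *m L a *m q = 0 by apply/Nq/stN => //; apply: qN.
  by rewrite {1}vE mulmxDl [LHS]mulmxDl h0 add0r /rho !mulmxA.
pose f : 'Hom('rV[C]_n, 'M[C]_m) := linfun (mulmxr q \o (mulmx s \o L)).
have fE a : f a = rho a by rewrite lfunE.
pose g := (f @: S)%VS.
have rhoM a b : a \in S -> b \in S -> rho a *m rho b = s *m (L a *m L b) *m q.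
  move=> aS bS; apply/row_matrixP => i; rewrite !row_mul.
  have si : row i s \in S by rewrite rowE sS.
  by rewrite -vq ?clS // !mulmxA.
have frho : {in S &, forall a b, f (a *m L b - b *m L a) = lie (f a) (f b)}.
  move=> a b aS bS; rewrite !fE /rho -lsa /lie mulmxBr mulmxBl.
  by rewrite -!rhoM.
have lg : lie_closed g.
  move=> _ _ /memv_imgP[a aS ->] /memv_imgP[b bS ->].
  by rewrite -frho // memv_img // brS.
have irr : irreducible g.
  move=> U stU.
  have [||U' U'P] := @vspace_of_linear _ ('rV[C]_n : vectType C)
    (fun v => v \in S /\ v *m q \in U).
  - by rewrite mul0mx !mem0v.
  - move=> c u v [uS uU] [vS vU]; split; first by rewrite memvD ?memvZ.
    by rewrite mulmxDl -scalemxAl memvD ?memvZ.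
  have NU' : (N <= U')%VS by apply/subvP => v vN; apply/U'P; rewrite inS // Nq // mem0v.
  have [SU'|SU'] := boolP (S <= U')%VS.
    right; apply/vspaceP => u; rewrite memvf.
    have /U'P[_] := subvP SU' _ (sS u).
    by rewrite -mulmxA sq mulmx1.
  left; have U'N : U' = N.
    apply: Nmax => //; split=> //; first by apply/subvP => v /U'P[].
    move=> a v aS /U'P[vS vU]; apply/U'P; split; first exact: clS.
    by rewrite vq // stU // -fE memv_img.
  apply/eqP; rewrite -subv0; apply/subvP => u uU; rewrite memv0.
  have usq : u *m s *m q = u by rewrite -mulmxA sq mulmx1.
  by rewrite -usq Nq // -U'N; apply/U'P; rewrite usq.
(* [b] recovers [a] modulo [N] from its action [f a]; the pseudo-inverse makes it linear on all
   matrices. *)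
pose h := (f \o projv S)%VF.
pose b x := projv S ((h^-1)%VF x) *m q.
have bf a : a \in S -> b (f a) = a *m q.
  move=> aS; set a' := projv S ((h^-1)%VF (f a)).
  have a'S : a' \in S by apply: memv_proj.
  have fa' : f a' = f a.
    have : f a \in limg h.
      by apply/memv_imgP; exists a; rewrite ?memvf // comp_lfunE projv_id.
    by move=> /limg_lfunVK; rewrite comp_lfunE.
  have : a - a' \in k.
    apply/kP; split=> [|v vS]; first by rewrite memvB.
    have : v *m L (a - a') *m q = 0.
      by rewrite vq ?memvB // -fE linearB /= fa' subrr mulmx0.
    move=> h0; have := qN (v *m L (a - a')); rewrite h0 mul0mx subr0; apply.
    by rewrite clS // memvB.
  move=> /(subvP kN)/Nq; rewrite mulmxBl => /eqP; rewrite subr_eq0 => /eqP ->.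
  by [].
have bL c u v : b (c *: u + v) = c *: b u + b v.
  by rewrite /b !linearP /= mulmxDl scalemxAl.
have bC x y : x \in g -> y \in g -> b (lie x y) = b x *m y - b y *m x.
  move=> /memv_imgP[u uS ->] /memv_imgP[v vS ->].
  by rewrite -frho // !bf ?brS // mulmxBl !vq // !fE.
have [w wP] := irreducible_cocycle lg irr bL bC.
(* Lifting [w] to [w *m s] in [S], the coboundary formula says that right multiplication by it is
   the identity modulo [N]. *)
have wN a : a \in S -> a - a *m right_mult (w *m s) \in N.
  move=> aS; rewrite mul_right_mult.
  have wq : w *m s *m q = w by rewrite -mulmxA sq mulmx1.
  have wL : w *m s *m L a \in S by rewrite clS.
  have := qN (a - w *m s *m L a) (memvB aS wL).
  rewrite mulmxBl vq // wq -fE -wP ?memv_img // bf // subrr mul0mx subr0.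
  by [].
have [j Rj] := nilR (w *m s).
case/negP: SN; apply/subvP => a aS.
have : a - a *m right_mult (w *m s) ^+ j \in N.
  elim: (j) => [|i IHi]; first by rewrite expr0 mulmx1 subrr mem0v.
  have RS : a *m right_mult (w *m s) ^+ i \in S.
    elim: (i) => [|l IHl]; first by rewrite expr0 mulmx1.
    by rewrite exprSr mulmxA mul_right_mult clS.
  have := memvD IHi (wN _ RS).
  by rewrite addrA subrK exprSr mulmxA.
by rewrite Rj mulmx0 subr0.
Qed.
End LeftSymmetric.

(** * Lie's theorem *)

Section LieTheorem.
Variables (C : numClosedFieldType).

Lemma central_scalar n (g : {vspace 'M[C]_n}) z :
  irreducible g -> (forall x, x \in g -> x *m z = z *m x) -> exists c, z = c%:M.
Proof.
case: n g z => [|n] g z irr zg; first by exists 0; apply/matrixP => -[].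
have [c c_root] : exists c, root (char_poly z) c.
  by apply/closed_rootP; rewrite size_char_poly.
exists c; apply/eqP; rewrite -subr_eq0; apply/negPn/negP => z0.
have : z - c%:M \in unitmx.
  apply: (schur irr) z0 => x /zg xz; rewrite mulmxBr mulmxBl xz; congr (_ - _).
  exact: scalar_mxC.
rewrite -row_free_unit -kermx_eq0; apply/negP.
by move: c_root; rewrite -eigenvalue_root_char.
Qed.

(** The last nonzero term of the derived series is an abelian ideal, hence central and scalar. If it
    were not [g] itself, it would consist of sums of brackets, whose traces vanish, and would be
    0. *)
Lemma irreducible_solvable_scalar n (g : {vspace 'M[C]_n}) :
  lie_closed g -> irreducible g -> solvable_lie g ->
  forall x, x \in g -> exists c, x = c%:M.
Proof.
move=> lg irr sg.
have [k /eqP k0 kmin] := ex_minnP (ex_intro (fun k => iter k (@derived_lie _ _) g == 0%VS)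
  (projT1 (cid sg)) (introT eqP (projT2 (cid sg)))).
case: k k0 kmin => [|k] k0 kmin x xg.
  by exists 0; rewrite -scalemx1 scale0r; apply/eqP; rewrite -memv0 -k0.
pose a := iter k (@derived_lie _ _) g.
have ia : ideal g a by apply: ideal_derived.
have ab y z : y \in a -> z \in a -> lie y z = 0.
  by move=> ya za; apply/eqP; rewrite -memv0 -k0 memv_bracket.
have cen z : z \in a -> exists c, z = c%:M.
  move=> za; apply: (central_scalar irr) => y yg; apply/eqP.
  by rewrite -subr_eq0; apply/eqP/(irreducible_abelian_ideal irr ia ab).
case: k k0 kmin @a ia ab cen => [|k] k0 kmin a ia ab cen; first exact: cen.
have : a = 0%VS.
  apply/eqP; rewrite -subv0; apply/subvP => z za; rewrite memv0.
  have [c zc] := cen z za.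
  have : \tr (z * 1) = 0.
    apply: (bracket_eq0 (f := fun x => \tr (x * 1)) _ _ za).
      by move=> *; rewrite mxtrace_mulr_linear.
    by move=> u v _ _; rewrite mxtrace_lie /lie mulr1 mul1r subrr mulr0 mxtrace0.
  rewrite mulr1 zc mxtrace_scalar => /eqP; rewrite mulrn_eq0 => /orP[/eqP n0|/eqP ->].
    by subst n; apply/eqP/matrixP => -[].
  by rewrite -scalemx1 scale0r.
by move=> /eqP/kmin; rewrite ltnn.
Qed.

(** Restricted to a minimal nonzero stable subspace, [g] becomes irreducible and solvable, so that
    it acts there by scalars. *)
Lemma lie_eigenvector n (g : {vspace 'M[C]_n.+1}) :
  lie_closed g -> solvable_lie g ->
  exists2 w : 'rV[C]_n.+1, w != 0 & forall x, x \in g -> exists c, w *m x = c *: w.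
Proof.
move=> lg sg.
pose P (U : {vspace 'rV[C]_n.+1}) :=
  U != 0%VS /\ forall x u, x \in g -> u \in U -> u *m x \in U.
have [U [U0 stU] Umin] : exists2 U, P U & forall U', P U' -> (U' <= U)%VS -> U' = U.
  have : P fullv.
    split=> [|*]; last exact: memvf.
    apply/eqP => f0; have := memvf (const_mx 1 : 'rV[C]_n.+1).
    by rewrite f0 memv0 => /eqP/rowP/(_ 0)/eqP; rewrite !mxE oner_eq0.
  move: {2}(\dim _) (leqnn (\dim (fullv : {vspace 'rV[C]_n.+1}))) => d.
  elim: d fullv => [|d IH] U dU PU.
    by case: PU; rewrite -dimv_eq0 -leqn0 dU.
  have [[U' [PU' sU nU]]|no] := EM (exists U', [/\ P U', (U' <= U)%VS & U' <> U]).
    apply: (IH U') => //; rewrite -ltnS; apply: leq_trans dU.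
    by rewrite ltnNge; apply/negP => h; apply/nU/eqP; rewrite eqEdim sU.
  exists U => // U' PU' sU; apply: contrapT => nU; apply: no; by exists U'.
have [m [s [q [sU sq _ qN]]]] := subquotient (sub0v U).
have vqs v : v \in U -> v *m q *m s = v.
  by move=> /qN; rewrite memv0 subr_eq0 => /eqP.
pose f : 'Hom('M[C]_n.+1, 'M[C]_m) := linfun (mulmxr q \o mulmx s).
have fE x : f x = s *m x *m q by rewrite lfunE.
have fM x y : x \in g -> y \in g -> f x *m f y = s *m (x *m y) *m q.
  move=> xg yg; rewrite !fE; apply/row_matrixP => i; rewrite !row_mul !mulmxA vqs //.
  by rewrite stU // rowE sU.
have fl x y : x \in g -> y \in g -> f (lie x y) = lie (f x) (f y).
  by move=> xg yg; rewrite /lie -![f _ * _]/(_ *m _) !fM // linearB /= !fE.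
have lf : lie_closed (f @: g)%VS.
  move=> _ _ /memv_imgP[x xg ->] /memv_imgP[y yg ->].
  by rewrite -fl // memv_img // lg.
have irr : irreducible (f @: g)%VS.
  move=> W stW.
  have [||U' U'P] := @vspace_of_linear _ ('rV[C]_n.+1 : vectType C)
    (fun v => v \in U /\ v *m q \in W).
  - by rewrite mul0mx !mem0v.
  - move=> c u v [uS uU] [vS vU]; split; first by rewrite memvD ?memvZ.
    by rewrite mulmxDl -scalemxAl memvD ?memvZ.
  have usq (u : 'rV_m) : u *m s *m q = u by rewrite -mulmxA sq mulmx1.
  have U'U : (U' <= U)%VS by apply/subvP => v /U'P[].
  have [U'0|U'0] := eqVneq U' 0%VS.
    left; apply/eqP; rewrite -subv0; apply/subvP => u uW; rewrite memv0.
    have : u *m s \in U' by apply/U'P; rewrite usq.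
    by rewrite U'0 memv0 -{2}(usq u) => /eqP ->; rewrite mul0mx.
  right; apply/vspaceP => u; rewrite memvf.
  have U'E : U' = U.
    apply: Umin => //; split=> // x v xg /U'P[vU vW]; apply/U'P; split; first exact: stU.
    have -> : v *m x *m q = v *m q *m f x by rewrite fE !mulmxA vqs.
    by rewrite stW // memv_img.
  have : u *m s \in U' by rewrite U'E.
  by move=> /U'P[_]; rewrite usq.
have sf := solvable_lie_img lg fl sg.
exists (vpick U); first by rewrite vpick0.
move=> x xg; have [c fc] := irreducible_solvable_scalar lf irr sf (memv_img f xg).
exists c; have wU := memv_pick U.
rewrite -(vqs _ (stU _ _ xg wU)) -{1}(vqs _ wU).
have -> : vpick U *m q *m s *m x *m q = vpick U *m q *m f x by rewrite fE !mulmxA.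
by rewrite fc mul_mx_scalar -scalemxAl vqs.
Qed.

Definition conj_drsubmx n (Q x : 'M[C]_(1 + n)) : 'M[C]_n := drsubmx (Q *m x *m invmx Q).

Fact conj_drsubmx_linear n (Q : 'M[C]_(1 + n)) : linear (conj_drsubmx Q).
Proof.
move=> c x y; rewrite /conj_drsubmx mulmxDr mulmxDl -scalemxAr -scalemxAl.
by apply/matrixP => i j; rewrite !mxE.
Qed.
HB.instance Definition _ n (Q : 'M[C]_(1 + n)) :=
  GRing.isLinear.Build C _ _ *:%R (conj_drsubmx Q) (conj_drsubmx_linear Q).

(** Rows are acted on from the right, so an eigenvector as first basis row empties the rest of row
    0; the induction treats the lower right block. *)
Theorem lie_triangularizable n (g : {vspace 'M[C]_n}) :
  lie_closed g -> solvable_lie g ->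
  exists2 P, P \in unitmx & forall x, x \in g -> is_trig_mx (P *m x *m invmx P).
Proof.
elim: n g => [|n IH] g lg sg.
  by exists 1%:M; rewrite ?unitmx1 // => x _; apply/is_trig_mxP => -[].
have [w w0 wP] := lie_eigenvector lg sg.
have [Q QU [c [c0 wQ]]] : exists2 Q : 'M[C]_(1 + n), Q \in unitmx &
    exists c, c != 0 /\ w = c *: row 0 Q by exact: row0_unitmx.
have Q0 x : x \in g -> exists d, row 0 Q *m x = d *: row 0 Q.
  move=> /wP[d]; rewrite wQ -scalemxAl scalerA mulrC -scalerA => h.
  by exists d; apply: (scalerI c0).
have ur0 x : x \in g -> ursubmx (Q *m x *m invmx Q) = 0.
  move=> /Q0[d Qd].
  have r0 : row 0 (Q *m x *m invmx Q) = d *: row 0 1%:M.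
    by rewrite !row_mul Qd -scalemxAl -row_mul mulmxV.
  apply/matrixP => i j; rewrite (ord1 i) [RHS]mxE.
  have := congr1 (fun M : 'rV_(1 + n) => M 0 (rshift 1 j)) r0.
  rewrite !mxE /= mulr0 => h.
  by rewrite (_ : lshift n 0 = 0) //; apply: val_inj.
pose f : 'Hom('M[C]_(1 + n), 'M[C]_n) :=
  linfun (conj_drsubmx Q).
have fE x : f x = drsubmx (Q *m x *m invmx Q) by exact: lfunE.
have QM x y : Q *m (x *m y) *m invmx Q = (Q *m x *m invmx Q) *m (Q *m y *m invmx Q).
  by rewrite !mulmxA mulmxKV.
have fl x y : x \in g -> y \in g -> f (lie x y) = lie (f x) (f y).
  have h u v : u \in g -> v \in g -> f (u *m v) = f u *m f v.
    move=> ug vg; rewrite !fE QM -{1}[Q *m u *m _]submxK -{1}[Q *m v *m _]submxK.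
    by rewrite mulmx_block block_mxKdr (ur0 v vg) mulmx0 add0r.
  by move=> xg yg; rewrite /lie linearB /= !h.
have lf : lie_closed (f @: g)%VS.
  move=> _ _ /memv_imgP[x xg ->] /memv_imgP[y yg ->].
  by rewrite -fl // memv_img // lg.
have [P PU Ptrig] := IH _ lf (solvable_lie_img lg fl sg).
pose P1 : 'M[C]_(1 + n) := block_mx 1%:M 0 0 P.
have P1V : P1 *m block_mx 1%:M 0 0 (invmx P) = 1%:M.
  by rewrite mulmx_block !mul0mx !mulmx0 !addr0 !add0r mulmx1 mulmxV // -scalar_mx_block.
have [P1U P1i] := mulmx1_unit P1V.
have P1E : invmx P1 = block_mx 1%:M 0 0 (invmx P).
  by rewrite -[LHS]mulmx1 -P1V mulmxA mulVmx // mul1mx.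
exists (P1 *m Q); first by rewrite unitmx_mul P1U.
move=> x xg; have -> : invmx (P1 *m Q) = invmx Q *m invmx P1.
  apply: (@row_full_inj _ _ _ _ (P1 *m Q)); first by rewrite row_full_unit unitmx_mul P1U.
  by rewrite mulmxV ?unitmx_mul ?P1U // mulmxA mulmxK // mulmxV.
have -> : P1 *m Q *m x *m (invmx Q *m invmx P1) = P1 *m (Q *m x *m invmx Q) *m invmx P1.
  by rewrite !mulmxA.
rewrite P1E /P1 -[Q *m x *m _](@submxK _ 1 n 1 n) (ur0 x xg) !mulmx_block !mul0mx !mulmx0 !mul1mx !mulmx1.
rewrite !addr0 !add0r (@is_trig_block_mx _ 1 n 1 n) // mul0mx eqxx /=; apply/andP; split.
  by apply/is_trig_mxP => i j; rewrite !ord1 ltnn.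
by have := Ptrig _ (memv_img f xg); rewrite fE.
Qed.
End LieTheorem.

(** * From traces to nilpotency, and complexification *)

Section TraceNilpotent.
Variables (F : numClosedFieldType) (n : nat) (L : 'Hom('rV[F]_n, 'M[F]_n)).
Hypothesis lsa : forall a b, lie (L a) (L b) = L (a *m L b - b *m L a).
Hypothesis trR : forall b, \tr (right_mult L b) = 0.

(** Write R for [right_mult L]. In the trace of a power of [R b] times the identity [RE] for
    [R (a *m R b)], the two terms with [L a] cancel. Hence the trace of [R b ^+ k.+1] is that of the
    right multiplication by [b *m R b ^+ k]. *)
Lemma right_mult_nilpotent b : matrix_nilpotent (right_mult L b).
Proof.
have RE a : right_mult L (a *m right_mult L b) =
    right_mult L b * L a + right_mult L a * right_mult L b - L a * right_mult L b.
  apply/row_matrixP => i; rewrite ![row i _]rowE mulmxBr mulmxDr.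
  rewrite -![_ * _]/(_ *m _) !mulmxA !mul_right_mult.
  have := congr1 (mulmx b) (lsa (delta_mx 0 i) a).
  rewrite /lie mulmxBr linearB /= mulmxBr -![_ * _]/(_ *m _) !mulmxA => h.
  by rewrite [X in X *m _](_ : _ = b *m L a) // -[LHS](subrK (b *m L (delta_mx 0 i) *m L a)) -opprB h; zmodule.
have trC (x y : 'M[F]_n) : \tr (x * y) = \tr (y * x) by exact: mxtrace_mulC.
have shift j k : \tr (right_mult L b ^+ j * right_mult L (b *m right_mult L b ^+ k)) =
    \tr (right_mult L b ^+ (k + j).+1).
  elim: k j => [|k IH] j; first by rewrite expr0 mulmx1 -exprSr.
  rewrite exprSr mulmxA RE mulrBr mulrDr !mulrA.
  have TB (x y : 'M[F]_n) : \tr (x - y) = \tr x - \tr y by exact: raddfB.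
  rewrite TB mxtraceD [\tr (_ * L _ * _)]trC !mulrA -exprS -exprSr addrAC subrr add0r.
  by rewrite trC mulrA -exprS IH addnS.
apply: nilpotent_mxtrace => -[|k] // _.
by have := shift 0%N k; rewrite addn0 expr0 mul1r trR.
Qed.
End TraceNilpotent.

Lemma row_linear_ind (F : pzRingType) n (P : 'rV[F]_n -> Prop) :
  P 0 -> (forall c u v, P u -> P v -> P (c *: u + v)) ->
  (forall i, P (delta_mx 0 i)) -> forall u, P u.
Proof.
move=> P0 PL Pd u; rewrite [u]row_sum_delta.
by elim/big_rec: _ => // i v _ Pv; apply: PL.
Qed.

Section RealTriangularization.
Variables (R : rcfType) (n : nat) (L : 'rV[R]_n -> 'M[R]_n).
Hypothesis linL : forall c a b, L (c *: a + b) = c *: L a + L b.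
Hypothesis lsa : forall a b, lie (L a) (L b) = L (a *m L b - b *m L a).
Hypothesis trR : forall b, \tr (\matrix_i (b *m L (delta_mx 0 i))) = 0.

Definition complex_left_mult (a : 'rV[R[i]]_n) : 'M[R[i]]_n :=
  \sum_i a 0 i *: map_mx (real_complex R) (L (delta_mx 0 i)).

Fact complex_left_mult_linear : linear complex_left_mult.
Proof.
move=> c a b; rewrite /complex_left_mult scaler_sumr -big_split; apply: eq_bigr => i _ /=.
by rewrite !mxE scalerDl scalerA.
Qed.
HB.instance Definition _ :=
  GRing.isLinear.Build _ _ _ *:%R complex_left_mult complex_left_mult_linear.

Let LE a : L a = \sum_i a 0 i *: L (delta_mx 0 i).
Proof.
have L0 : L 0 = 0 by have := linL (-1) 0 0; rewrite scaler0 addr0 scaleN1r addNr.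
rewrite {1}[a]row_sum_delta; elim/big_rec2: _ => [|i y1 y2 _ <-]; first exact: L0.
by rewrite linL.
Qed.

Let LC_real a : complex_left_mult (map_mx (real_complex R) a) = map_mx (real_complex R) (L a).
Proof.
rewrite LE raddf_sum /=; apply: eq_bigr => i _.
by rewrite !mxE map_mxZ.
Qed.

(** The section assumes vanishing traces because they are linear in [b] and extend to complex rows;
    [right_mult_nilpotent] then supplies the nilpotency that [lsa_solvable] asks for. *)
Theorem real_triangularizable : exists2 P : 'M[R[i]]_n, P \in unitmx &
  forall a, is_trig_mx (P *m map_mx (real_complex R) (L a) *m invmx P).
Proof.
pose LC : 'Hom('rV[R[i]]_n, 'M[R[i]]_n) := linfun complex_left_mult.
have LCE a : LC a = complex_left_mult a by exact: lfunE.
have LC0 : LC 0 = 0 by exact: linear0.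
have LCP c u v : LC (c *: u + v) = c *: LC u + LC v by exact: linearP.
have delta_real k : (delta_mx 0 k : 'rV[R[i]]_n) = map_mx (real_complex R) (delta_mx 0 k).
  by rewrite map_delta_mx.
have lsaC a b : lie (LC a) (LC b) = LC (a *m LC b - b *m LC a).
  have base i j : lie (LC (delta_mx 0 i)) (LC (delta_mx 0 j)) =
      LC (delta_mx 0 i *m LC (delta_mx 0 j) - delta_mx 0 j *m LC (delta_mx 0 i)).
    rewrite !delta_real !LCE !LC_real -!map_mxM -map_mxB LC_real -lsa.
    by rewrite /lie -![map_mx _ _ * _]/(_ *m _) -!map_mxM -map_mxB.
  elim/row_linear_ind: a b => [|c u v Pu Pv|i] b.
  - by rewrite LC0 mul0mx mulmx0 subr0 LC0 lie0l.
  - rewrite !LCP lieDl lieZl Pu Pv.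
    rewrite mulmxDl mulmxDr -scalemxAl -scalemxAr -LCP; congr (LC _).
    by rewrite scalerBr; zmodule.
  elim/row_linear_ind: b => [|c u v Pu Pv|j]; last exact: base.
  - by rewrite LC0 mul0mx mulmx0 subr0 LC0 lieC lie0l oppr0.
  rewrite !LCP lieDr lieZr Pu Pv.
  rewrite mulmxDl mulmxDr -scalemxAl -scalemxAr -LCP; congr (LC _).
  by rewrite scalerBr; zmodule.
have trC b : \tr (right_mult LC b) = 0.
  elim/row_linear_ind: b => [|c u v Pu Pv|i].
  - by rewrite (_ : right_mult LC 0 = 0) ?mxtrace0 //; apply/row_matrixP => i; rewrite rowK mul0mx row0.
  - have -> : right_mult LC (c *: u + v) = c *: right_mult LC u + right_mult LC v.
      apply/row_matrixP => i; rewrite rowK mulmxDl -scalemxAl.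
      by rewrite [RHS]linearP /= !rowK.
    by rewrite mxtraceD mxtraceZ Pu Pv mulr0 addr0.
  transitivity (real_complex R (\tr (\matrix_k (delta_mx 0 i *m L (delta_mx 0 k))))); last by rewrite trR rmorph0.
  rewrite -trace_map_mx; congr (\tr _); apply/row_matrixP => k.
  by rewrite rowK !delta_real LCE LC_real -map_mxM -map_row rowK.
have [||P PU Ptrig] := @lie_triangularizable _ n (LC @: fullv)%VS.
- move=> _ _ /memv_imgP[a _ ->] /memv_imgP[b _ ->].
  by rewrite lsaC memv_img ?memvf.
- have nilR b : matrix_nilpotent (right_mult LC b) by apply: right_mult_nilpotent.
  (* Solvability is known for the affine fields; taking the linear part [f] is a morphism from them
     onto the image of [LC]. *)
  have sX := lsa_solvable lsaC nilR (S := fullv) (fun a b _ _ => memvf _).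
  pose X := linfun (affine_field LC).
  pose f := linfun (conj_drsubmx (1%:M : 'M[R[i]]_(1 + n))).
  have fX a : f (X a) = LC a.
    rewrite [X a]lfunE [LHS]lfunE /= /conj_drsubmx invmx1 mul1mx mulmx1.
    exact: block_mxKdr.
  have -> : (LC @: fullv)%VS = (f @: (X @: fullv))%VS.
    apply/vspaceP => x; apply/memv_imgP/memv_imgP => -[].
      by move=> a _ ->; exists (X a); rewrite ?fX // memv_img ?memvf.
    by move=> _ /memv_imgP[a _ ->] ->; exists a; rewrite ?fX ?memvf.
  apply: solvable_lie_img sX.
    move=> _ _ /memv_imgP[a _ ->] /memv_imgP[b _ ->].
    by rewrite ![X _]lfunE /= affine_field_lie // -[affine_field _ _]lfunE memv_img ?memvf.
  move=> _ _ /memv_imgP[a _ ->] /memv_imgP[b _ ->].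
  rewrite !fX lsaC ![X _]lfunE /= affine_field_lie //.
  by rewrite -[affine_field _ _](lfunE (affine_field LC)) fX.
exists P => // a; rewrite -LC_real -LCE.
by apply: Ptrig; rewrite memv_img ?memvf.
Qed.
End RealTriangularization.

(** * Transitive Lie algebras of affine fields *)

(** By Cayley-Hamilton, ['X * char_poly A] evaluated at [A] is 0. The factor ['X] removes the
    constant term, so its trace is [c] times the value of [char_poly A] at 1, which is not an
    eigenvalue. *)
Lemma constant_power_sums (F : numFieldType) n (A : 'M[F]_n) c :
  (forall k, \tr (A ^+ k.+1) = c) -> 1%:M - A \in unitmx -> c = 0.
Proof.
case: n A => [|n] A trA uA; first by rewrite -(trA 0%N) [A ^+ 1]flatmx0 mxtrace0.
have : \tr (horner_mx A ('X * char_poly A)) = 0.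
  by rewrite rmorphM /= Cayley_Hamilton mulr0 mxtrace0.
rewrite mxtrace_horner (eq_bigr (fun k : 'I_(_) => ('X * char_poly A)`_k * 1 ^+ k * c)).
  rewrite -mulr_suml -horner_coef hornerM hornerX mul1r => /eqP.
  rewrite mulf_eq0 => /orP[rt|/eqP //].
  have : eigenvalue A 1 by rewrite eigenvalue_root_char.
  rewrite /eigenvalue /eigenspace kermx_eq0 row_free_unit.
  by rewrite -opprB -scaleN1r unitmxZ ?unitrN1 ?uA.
move=> [[|k] /= _] _; first by rewrite coefXM !mul0r.
by rewrite trA expr1n mulr1.
Qed.

(* A pair [(A, b)] stands for the affine vector field [x |-> b + x *m A]. *)
Definition affine_lie_algebra (F : fieldType) n (h : 'M[F]_n -> 'rV[F]_n -> Prop) :=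
  [/\ h 0 0,
      (forall c A b A' b', h A b -> h A' b' -> h (c *: A + A') (c *: b + b')) &
      (forall A b A' b', h A b -> h A' b' -> h (lie A A') (b *m A' - b' *m A))].

Definition transitive_fields (F : fieldType) n (h : 'M[F]_n -> 'rV[F]_n -> Prop) :=
  forall x v, exists A b, h A b /\ b + x *m A = v.

(** Equivalently, the fields of [h] that vanish at [x] also vanish at [x + a]. *)
Definition zero_direction (F : fieldType) n (h : 'M[F]_n -> 'rV[F]_n -> Prop) (x a : 'rV[F]_n) :=
  forall A b, h A b -> b + x *m A = 0 -> a *m A = 0.

Section TraceTrick.
Variables (F : numFieldType) (n : nat) (h : 'M[F]_n -> 'rV[F]_n -> Prop).
Hypothesis hh : affine_lie_algebra h.
Hypothesis hT : transitive_fields h.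
Variable x : 'rV[F]_n.

Lemma field_frame : exists Y : 'I_n -> 'M[F]_n * 'rV[F]_n,
  forall i, h (Y i).1 (Y i).2 /\ (Y i).2 + x *m (Y i).1 = delta_mx 0 i.
Proof.
have /choice[Y hY] : forall i : 'I_n, exists Y : 'M[F]_n * 'rV[F]_n,
    h Y.1 Y.2 /\ Y.2 + x *m Y.1 = delta_mx 0 i.
  by move=> i; have [A [b hb]] := hT x (delta_mx 0 i); exists (A, b).
by exists Y.
Qed.

(** On the space [D] of zero directions, the matrices [R u] behave as the right multiplications of a
    left-symmetric algebra, and their trace [s] gives a symmetric form [s (u *m R v)]. As [s]
    vanishes on its radical, the form represents [s] by some [e] in [D], and all the powers of [R e]
    have trace [s e]. Transitivity at [x - e] makes [1 - R e] invertible, so that [s e = 0], [R e]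
    is nilpotent and [s] vanishes on [D]. Hence the powers of every [R a] have trace 0. *)
Lemma zero_direction_nilpotent a : zero_direction h x a ->
  exists2 R : 'M[F]_n, matrix_nilpotent R &
    forall A b, h A b -> a *m A = (b + x *m A) *m R.
Proof.
have [h0 hlin hlie] := hh.
have [Y hY] := field_frame.
pose L (w : 'rV[F]_n) := \sum_i w 0 i *: (Y i).1.
pose bY (w : 'rV[F]_n) := \sum_i w 0 i *: (Y i).2.
have hL w : h (L w) (bY w).
  rewrite /L /bY; elim/big_rec2: _ => // i A b _; apply: hlin; exact: (hY i).1.
have evL w : bY w + x *m L w = w.
  rewrite mulmx_sumr -big_split [RHS]row_sum_delta; apply: eq_bigr => i _ /=.
  by rewrite -scalemxAr -scalerDr (hY i).2.
pose D := zero_direction h x.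
pose R b := \matrix_i (b *m (Y i).1) : 'M[F]_n.
have wR b w : w *m R b = b *m L w.
  rewrite mulmx_sumr mulmx_sum_row; apply: eq_bigr => i _.
  by rewrite rowK scalemxAr.
have RP c u v : R (c *: u + v) = c *: R u + R v.
  by apply/row_matrixP => i; rewrite rowK mulmxDl -scalemxAl linearP /= !rowK.
(* For a zero direction [u], the row [u *m A] depends only on the value of the field at [x], so the
   field may be replaced by a combination of the frame. *)
have evR u A b : D u -> h A b -> u *m A = (b + x *m A) *m R u.
  move=> Da hA; apply/eqP; rewrite wR -subr_eq0 -mulmxBr; apply/eqP.
  have := hlin (-1) _ _ _ _ (hL (b + x *m A)) hA; rewrite !scaleN1r => hd.
  have e0 : - (bY (b + x *m A)) + b + x *m (- L (b + x *m A) + A) = 0.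
    by rewrite mulmxDr mulmxN addrACA -opprD evL addNr.
  by have := Da _ _ hd e0; rewrite addrC.
have D0 : D 0 by move=> A b _ _; rewrite mul0mx.
have DL c u v : D u -> D v -> D (c *: u + v).
  move=> Du Dv A b hA e; rewrite mulmxDl -scalemxAl.
  by rewrite (Du A b) // (Dv A b) // scaler0 addr0.
have [Fs FsP] := @vspace_of_linear _ ('rV[F]_n : vectType F) D D0 DL.
have clD u v : D u -> D v -> D (v *m L u).
  move=> Du Dv A b hA e; have := evR v _ _ Dv (hlie _ _ _ _ (hL u) hA).
  have -> : bY u *m A - b *m L u + x *m lie (L u) A =
      (bY u + x *m L u) *m A - (b + x *m A) *m L u.
    by rewrite /lie mulmxBr !mulmxDl -![_ * _]/(_ *m _) !mulmxA; zmodule.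
  rewrite evL e mul0mx subr0 (Du A b) // mul0mx /lie mulmxBr.
  rewrite -![_ * _]/(_ *m _) !mulmxA (Dv A b) // mul0mx subr0.
  by [].
have clR u v : D u -> D v -> D (u *m R v) by move=> Du Dv; rewrite wR; apply: clD.
(* The identity used in [right_mult_nilpotent], now available for zero directions only. *)
have RE u v : D u -> D v -> R (u *m R v) = R v * L u + R u * R v - L u * R v.
  move=> Du Dv; apply/row_matrixP => i; rewrite ![row i _]rowE mulmxBr mulmxDr.
  rewrite -![_ * _]/(_ *m _) !mulmxA !wR.
  set w := delta_mx 0 i; have := evR v _ _ Dv (hlie _ _ _ _ (hL u) (hL w)).
  have -> : bY u *m L w - bY w *m L u + x *m lie (L u) (L w) =
      (bY u + x *m L u) *m L w - (bY w + x *m L w) *m L u.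
    by rewrite /lie mulmxBr !mulmxDl -![_ * _]/(_ *m _) !mulmxA; zmodule.
  rewrite !evL /lie mulmxBr mulmxBl -![_ * _]/(_ *m _) !mulmxA !wR => e.
  by rewrite -[LHS](subrK (v *m L w *m L u)) e; zmodule.
have trC (u v : 'M[F]_n) : \tr (u * v) = \tr (v * u) by exact: mxtrace_mulC.
have TB (u v : 'M[F]_n) : \tr (u - v) = \tr u - \tr v by exact: raddfB.
have shift b j k : D b -> \tr (R b ^+ j * R (b *m R b ^+ k)) = \tr (R b ^+ (k + j).+1).
  move=> Db; elim: k j => [|k IH] j; first by rewrite expr0 mulmx1 -exprSr.
  have Dk : D (b *m R b ^+ k).
    elim: (k) => [|l IHl]; first by rewrite expr0 mulmx1.
    by rewrite exprSr mulmxA; apply: clR.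
  rewrite exprSr mulmxA RE // mulrBr mulrDr !mulrA.
  rewrite TB mxtraceD [\tr (_ * L _ * _)]trC !mulrA -exprS -exprSr addrAC subrr add0r.
  by rewrite trC mulrA -exprS IH addnS.
pose s b := \tr (R b).
have sk b k : D b -> s (b *m R b ^+ k) = \tr (R b ^+ k.+1).
  by move=> Db; have := shift b 0%N k Db; rewrite addn0 expr0 mul1r.
have sP c u v : s (c *: u + v) = c * s u + s v.
  by rewrite /s RP mxtraceD mxtraceZ.
have sym u v : D u -> D v -> s (u *m R v) = s (v *m R u).
  move=> Du Dv; rewrite /s !RE // !TB !mxtraceD !(trC (L _)) .
  by rewrite addrAC subrr add0r [RHS]addrAC subrr add0r trC.
(* The value of a field at [x + c] is its value at [x] times [1 + R c], and the fields are
   transitive at [x + c]. *)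
have unitR c : D c -> 1%:M + R c \in unitmx.
  move=> Dc; rewrite -row_full_unit; apply/row_fullP.
  have /choice[W hW] : forall i : 'I_n, exists w : 'rV[F]_n, w *m (1%:M + R c) = delta_mx 0 i.
    move=> i; have [A [b [hA e]]] := hT (x + c) (delta_mx 0 i).
    by exists (b + x *m A); rewrite mulmxDr mulmx1 -evR // -e mulmxDl addrA.
  exists (\matrix_i W i); apply/row_matrixP => i.
  by rewrite row_mul rowK hW rowE mulmx1.
have s0 : s 0 = 0 by have := sP (-1) 0 0; rewrite scaler0 addr0 mulN1r addNr.
have R0 : R 0 = 0 by have := RP (-1) 0 0; rewrite scaler0 addr0 scaleN1r addNr.
have ssum k (c : 'I_k -> F) f v :
    s ((\sum_i c i *: f i) *m R v) = \sum_i c i * s (f i *m R v).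
  elim/big_rec2: _ => [|i y1 y2 _ <-]; first by rewrite mul0mx s0.
  by rewrite mulmxDl -scalemxAl sP.
have ssum1 k (c : 'I_k -> F) f : s (\sum_i c i *: f i) = \sum_i c i * s (f i).
  by elim/big_rec2: _ => [|i y1 y2 _ <-]; rewrite ?s0 // sP.
have ssumR k (c : 'I_k -> F) f v :
    s (v *m R (\sum_i c i *: f i)) = \sum_i c i * s (v *m R (f i)).
  elim/big_rec2: _ => [|i y1 y2 _ <-]; first by rewrite R0 mulmx0 s0.
  by rewrite RP mulmxDr -scalemxAr sP.
(* For [b] in the radical of the form, the powers of [R b] from the second on have trace 0, which
   suffices for nilpotency. *)
have nilb b : D b -> (forall u, D u -> s (u *m R b) = 0) -> s b = 0.
  move=> Db sb; apply: mxtrace_nilpotent; apply: nilpotent_mxtrace => -[|[|k]] // _.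
  rewrite -sk // exprSr mulmxA sb //.
  by elim: (k) => [|l IHl]; rewrite ?expr0 ?mulmx1 // exprSr mulmxA; apply: clR.
(* By [nilb], [sigma] vanishes on the kernel of the Gram matrix [B], so it is a combination of the
   rows of [B]. *)
have [e De se] : exists2 e, D e & forall u, D u -> s (u *m R e) = s u.
  pose f i := (vbasis Fs)`_i; pose d := \dim Fs.
  have Df (i : 'I_d) : D (f i) by apply/FsP; rewrite vbasis_mem // mem_nth // size_tuple.
  pose B := \matrix_(j < d, i < d) s (f i *m R (f j)).
  pose sigma := \row_(i < d) s (f i).
  have : (sigma <= B)%MS.
    rewrite submxE; apply/eqP/rowP => j; rewrite [RHS]mxE.
    pose b := \sum_(i < d) cokermx B i j *: f i.
    have Db : D b by apply/FsP; apply: memv_suml => i _; rewrite memvZ //; apply/FsP.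
    have sb : s b = 0.
      apply: nilb => // u /FsP/coord_vbasis ->; rewrite ssum big1 // => k _.
      have := mulmx_coker B => /matrixP/(_ k j); rewrite [LHS]mxE [RHS]mxE => e0.
      rewrite sym // [X in _ * X](_ : _ = 0) ?mulr0 // ssum -[RHS]e0.
      by apply: eq_bigr => i _; rewrite [B _ _]mxE mulrC.
    rewrite [LHS]mxE -[RHS]sb ssum1; apply: eq_bigr => i _.
    by rewrite [sigma _ _]mxE mulrC.
  move=> /submxP[u uE]; exists (\sum_(i < d) u 0 i *: f i).
    by apply/FsP; apply: memv_suml => i _; rewrite memvZ //; apply/FsP.
  move=> v /FsP/coord_vbasis ->; rewrite ssum ssum1; apply: eq_bigr => i _; congr (_ * _).
  rewrite ssumR; have := congr1 (fun M : 'rV_d => M 0 i) uE; rewrite [LHS]mxE => ->.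
  by rewrite mxE; apply: eq_bigr => j _; rewrite [B _ _]mxE.
have DeR k : D (e *m R e ^+ k).
  by elim: k => [|l IHl]; rewrite ?expr0 ?mulmx1 // exprSr mulmxA; apply: clR.
have trk k : \tr (R e ^+ k.+1) = s e.
  rewrite -sk //; elim: k => [|k IH]; first by rewrite expr0 mulmx1.
  by rewrite exprSr mulmxA se.
have se0 : s e = 0.
  apply: (constant_power_sums trk).
  have De' : D (- e) by have := DL (-1) e 0 De D0; rewrite scaleN1r addr0.
  have := unitR _ De'; have := RP (-1) e 0.
  by rewrite !scaleN1r !addr0 R0 addr0 => ->.
have sD u : D u -> s u = 0.
  move=> Du; have [N RN] : matrix_nilpotent (R e).
    by apply: nilpotent_mxtrace => -[|k] // _; rewrite trk.
  have : s (u *m R e ^+ N) = s u.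
    elim: (N) => [|k IH]; first by rewrite expr0 mulmx1.
    rewrite exprSr mulmxA se //.
    by elim: (k) => [|l IHl]; rewrite ?expr0 ?mulmx1 // exprSr mulmxA; apply: clR.
  by rewrite RN mulmx0 s0.
move=> Da; exists (R a); last by move=> A b; apply: evR.
apply: nilpotent_mxtrace => -[|k] // _; rewrite -sk // sD //.
by elim: (k) => [|l IHl]; rewrite ?expr0 ?mulmx1 // exprSr mulmxA; apply: clR.
Qed.

(** Passing from [x] to [x + a] multiplies the frame by a unipotent matrix. *)
Lemma det_translate_zero_direction (X : 'I_n -> 'M[F]_n * 'rV[F]_n) a :
  (forall i, h (X i).1 (X i).2) -> zero_direction h x a ->
  \det (\matrix_i ((X i).2 + (x + a) *m (X i).1)) = \det (\matrix_i ((X i).2 + x *m (X i).1)).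
Proof.
move=> hX /zero_direction_nilpotent[R nilR RE].
have -> : \matrix_i ((X i).2 + (x + a) *m (X i).1) =
    (\matrix_i ((X i).2 + x *m (X i).1)) *m (1%:M + R).
  apply/row_matrixP => i; rewrite row_mul !rowK mulmxDr mulmx1 -RE // mulmxDl.
  by rewrite addrA.
by rewrite det_mulmx det_unipotent // mulr1.
Qed.
End TraceTrick.

(** Removing the constant term and dividing by ['X] keeps the polynomial bounded; by induction the
    quotient is constant, and a bounded affine function is constant. *)
Lemma bounded_poly_const (R : realFieldType) (p : {poly R}) (C : R) :
  (forall t, `|p.[t]| <= C) -> forall t, p.[t] = p.[0].
Proof.
elim/poly_ind: p C => [|p c IH] C bC t; first by rewrite !horner0.
have C0 : 0 <= C by apply: le_trans (bC 0).
have cC : `|c| <= C by have := bC 0; rewrite !hornerE.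
have pb u : `|p.[u]| <= (C + C) + \sum_(i < size p) `|p`_i|.
  have S0 : 0 <= \sum_(i < size p) `|p`_i| by apply: sumr_ge0.
  have [u1|u1] := lerP `|u| 1.
    rewrite horner_coef; apply: le_trans (ler_norm_sum _ _ _) _.
    apply: le_trans (_ : \sum_(i < size p) `|p`_i| <= _); last by rewrite lerDr addr_ge0.
    apply: ler_sum => i _; rewrite normrM normrX ler_piMr // exprn_ile1 //.
  have : `|p.[u]| * `|u| <= C + C.
    have := bC u; rewrite !hornerE => bu; rewrite -normrM.
    by rewrite -[p.[u] * u](addrK c); apply: le_trans (ler_normB _ _) _; apply: lerD.
  move=> h; apply: le_trans (_ : C + C <= _); last by rewrite lerDl.
  by apply: le_trans h; rewrite ler_peMr // ltW.
have pc := IH _ pb; rewrite !hornerE pc ?mulr0 ?add0r.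
have [->|p0] := eqVneq p.[0] 0; first by rewrite mul0r add0r.
have := bC ((C + C + 1) / p.[0]); rewrite hornerMXaddC pc mulrCA divff // mulr1.
move=> h; have : C + C + 1 <= C + C.
  rewrite -[X in X <= _](addrK c); apply: le_trans (ler_norm _) _.
  by apply: le_trans (ler_normB _ _) _; apply: lerD.
by rewrite -subr_ge0 opprD addNKr oppr_ge0 ler10.
Qed.

Section SimplyTransitive.
Variables (F : realFieldType) (n : nat) (h : 'M[F]_n -> 'rV[F]_n -> Prop).
Hypothesis hh : affine_lie_algebra h.
Hypothesis hT : transitive_fields h.

Definition frame_matrix (X : 'I_n -> 'M[F]_n * 'rV[F]_n) x :=
  \matrix_i ((X i).2 + x *m (X i).1).

Hypothesis bounded : forall X, (forall i, h (X i).1 (X i).2) ->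
  exists C, forall x, `|\det (frame_matrix X x)| <= C.

Lemma det_frame_const X x : (forall i, h (X i).1 (X i).2) ->
  \det (frame_matrix X x) = \det (frame_matrix X 0).
Proof.
move=> hX; have [C bC] := bounded hX.
pose M1 := \matrix_i (x *m (X i).1).
pose p := \det (map_mx polyC (frame_matrix X 0) + 'X *: map_mx polyC M1).
have pE t : p.[t] = \det (frame_matrix X (t *: x)).
  have -> : frame_matrix X (t *: x) = frame_matrix X 0 + t *: M1.
    apply/row_matrixP => i; rewrite [RHS]linearD linearZ /= !rowK mul0mx addr0.
    by rewrite scalemxAl.
  rewrite /p -[LHS]/(horner_eval t _) -det_map_mx; congr (\det _).
  move: (frame_matrix X 0) M1 {p} => M0 M1.
  by apply/matrixP => i j; rewrite !mxE /= /horner_eval !hornerE.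
have := @bounded_poly_const _ p C _ 1; rewrite !pE scale1r scale0r; apply.
by move=> t; rewrite pE.
Qed.

(** [L w] is the linear part of a field with value [w] at 0. Such a field is unique: a difference
    [Z] of two of them that is nonzero at [x] would be, up to a scalar, part of a frame at [x] whose
    determinant vanishes at 0, against [det_frame_const]. *)
Theorem simply_transitive_product : exists L : 'rV[F]_n -> 'M[F]_n,
  [/\ forall c a b, L (c *: a + b) = c *: L a + L b,
      forall A b, h A b <-> A = L b,
      forall a b, lie (L a) (L b) = L (a *m L b - b *m L a) &
      forall b, matrix_nilpotent (\matrix_i (b *m L (delta_mx 0 i)))].
Proof.
have [h0 hlin hlie] := hh.
have [Y hY] := field_frame hT 0.
pose L (w : 'rV[F]_n) := \sum_i w 0 i *: (Y i).1.
have hL w : h (L w) w.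
  rewrite [X in h _ X]row_sum_delta /L.
  elim/big_rec2: _ => // i A b _; apply: hlin.
  by have [hi] := hY i; rewrite mul0mx addr0 => <-.
have LP c a b : L (c *: a + b) = c *: L a + L b.
  rewrite /L scaler_sumr -big_split; apply: eq_bigr => i _ /=.
  by rewrite !mxE scalerDl scalerA.
have LE A b : h A b -> A = L b.
  move=> hA; apply/eqP; rewrite -subr_eq0; apply/eqP.
  have hZ : h (A - L b) 0.
    by have := hlin (-1) _ _ _ _ (hL b) hA; rewrite !scaleN1r addNr addrC.
  move: (A - L b) hZ => Z hZ {A b hA}.
  have vZ (x : 'rV[F]_n) : x *m Z = 0.
    apply/eqP/negPn/negP => xZ.
    have [Q QU [i [c [c0 vQ]]]] : exists2 Q : 'M[F]_n, Q \in unitmx &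
        exists i c, c != 0 /\ x *m Z = c *: row i Q.
      clear -xZ; case: n x Z xZ => [|m] x Z xZ; first by rewrite [_ *m _]thinmx0 eqxx in xZ.
      by have [Q QU ?] := row0_unitmx xZ; exists Q => //; exists 0.
    have /choice[X hX] : forall j : 'I_n, exists X : 'M[F]_n * 'rV[F]_n,
        h X.1 X.2 /\ X.2 + x *m X.1 = row j Q.
      by move=> j; have [A [b hb]] := hT x (row j Q); exists (A, b).
    pose X' j := if j == i then (c^-1 *: Z, 0) else X j.
    have hX' j : h (X' j).1 (X' j).2.
      rewrite /X'; case: eqP => [_|_] /=; last exact: (hX j).1.
      by have := hlin c^-1 _ _ _ _ hZ h0; rewrite scaler0 !addr0.
    have := det_frame_const x hX'; have -> : frame_matrix X' x = Q.
      apply/row_matrixP => j; rewrite rowK /X'; case: eqP => [->|_] /=; last exact: (hX j).2.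
      by rewrite add0r -scalemxAr vQ scalerA mulVf // scale1r.
    move=> dQ; move: QU; rewrite unitmxE dQ (expand_det_row _ i) big1 ?unitr0 // => j _.
    by rewrite [frame_matrix _ _ _ _]mxE /X' eqxx /= mul0mx addr0 mxE mul0r.
  by apply/row_matrixP => i; rewrite row0 rowE.
have lsaL a b : lie (L a) (L b) = L (a *m L b - b *m L a).
  exact: LE (hlie _ _ _ _ (hL a) (hL b)).
exists L; split=> //; first by move=> A b; split=> [|->]; [exact: LE|exact: hL].
have L0 : L 0 = 0 by have := LP (-1) 0 0; rewrite scaler0 addr0 scaleN1r addNr.
(* The only field that vanishes at 0 is the zero field, so every [a] is a zero direction at 0. *)
move=> a; have [|R nilR RE] := zero_direction_nilpotent hh hT (x := 0) (a := a).
  by move=> A b /LE ->; rewrite mul0mx addr0 => ->; rewrite L0 mulmx0.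
rewrite (_ : \matrix_i _ = R) //; apply/row_matrixP => i.
by rewrite rowK (RE _ _ (hL _)) mul0mx addr0 rowE.
Qed.
End SimplyTransitive.

From mathcomp Require Import all_classical all_reals all_analysis ring lra perm.
Import numFieldNormedType.Exports.
Local Open Scope classical_set_scope.
Local Open Scope ring_scope.

(** * Closed matrix groups and their tangent spaces *)

Section MatrixNorm.
Variable R : realType.
Implicit Types k m n d : nat.

Lemma ler_coord_norm m n (A : 'M[R]_(m, n)) i j : `|A i j| <= `|A|.
Proof.
by rewrite [leRHS]/Num.norm /= mx_normrE (le_bigmax _ (fun ij => `|A ij.1 ij.2|) (i, j)).
Qed.

Lemma ler_norm_coord m n (A : 'M[R]_(m, n)) c :
  0 <= c -> (forall i j, `|A i j| <= c) -> `|A| <= c.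
Proof. by move=> c0 Ac; rewrite [leLHS]/Num.norm /= mx_normrE; apply: bigmax_le => //= -[i j] _ /=. Qed.

Lemma norm_row_mx0 n (v : 'rV[R]_n) : `|row_mx (0 : 'rV_1) v| = `|v|.
Proof.
apply/eqP; rewrite eq_le; apply/andP; split.
  apply: ler_norm_coord => // i j; case: (split_ordP j) => k ->.
    by rewrite row_mxEl mxE normr0.
  by rewrite row_mxEr ler_coord_norm.
apply: ler_norm_coord => // i j.
by have := ler_coord_norm (row_mx (0 : 'rV_1) v) i (rshift 1 j); rewrite row_mxEr.
Qed.

Lemma norm_mxvec m n (A : 'M[R]_(m, n)) : `|mxvec A| = `|A|.
Proof.
apply/eqP; rewrite eq_le; apply/andP; split.
  apply: ler_norm_coord => // i k; rewrite (ord1 i).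
  by case/mxvec_indexP: k => a b; rewrite mxvecE; apply: ler_coord_norm.
by apply: ler_norm_coord => // i j; rewrite -mxvecE; apply: ler_coord_norm.
Qed.

Lemma norm_mulmx m n k (A : 'M[R]_(m, n)) (B : 'M[R]_(n, k)) :
  `|A *m B| <= n%:R * (`|A| * `|B|).
Proof.
apply: ler_norm_coord => [|i j]; first by rewrite !mulr_ge0.
rewrite mxE (le_trans (ler_norm_sum _ _ _)) //.
have -> : n%:R * (`|A| * `|B|) = \sum_(l < n) `|A| * `|B|.
  by rewrite sumr_const card_ord mulr_natl.
by rewrite ler_sum // => l _; rewrite normrM ler_pM // ler_coord_norm.
Qed.

(** Bolzano-Weierstrass, with recurrent closeness in place of a subsequence. *)
Lemma bounded_rowseq_cluster n (u : nat -> 'rV[R]_n) C :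
  (forall k, `|u k| <= C) ->
  exists X, forall e, 0 < e -> forall K, exists2 k, (K <= k)%N & `|u k - X| < e.
Proof.
move=> uC; pose A := [set v : 'rV[R]_n | `|v| <= C].
have cA : compact A.
  apply: bounded_closed_compact.
    by exists C; split; [exact: num_real|move=> M CM v /= /le_trans -> //; apply: ltW].
  have -> : A = Num.norm @^-1` [set x | x <= C] by [].
  by apply: closed_comp => [v _|]; [exact: norm_continuous|exact: closed_le].
have [|X [_ cX]] := cA (u @ \oo) _ _; first by exists 0%N => // k _; exact: uC.
exists X => e e0 K.
have FK : (u @ \oo) (u @` [set k | (K <= k)%N]).
  by exists K => // k /= Kk; exists k.
have := cX _ _ FK (nbhsx_ballx X e e0).
rewrite mx_norm_ball => -[_ [[k Kk <-]] /= h].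
by exists k => //; rewrite distrC.
Qed.

Lemma bounded_mxseq_cluster m n (u : nat -> 'M[R]_(m, n)) C :
  (forall k, `|u k| <= C) ->
  exists X, forall e, 0 < e -> forall K, exists2 k, (K <= k)%N & `|u k - X| < e.
Proof.
move=> uC; have [|X hX] := @bounded_rowseq_cluster _ (mxvec \o u) C.
  by move=> k /=; rewrite norm_mxvec.
exists (vec_mx X) => e e0 K; have [k Kk hk] := hX e e0 K; exists k => //.
by rewrite -norm_mxvec raddfB /= vec_mxK.
Qed.

Lemma bounded_linear_row n (V : normedModType R) (f : 'rV[R]_n -> V) : linear f ->
  exists2 C, 0 <= C & forall u, `|f u| <= C * `|u|.
Proof.
move=> fL; pose fl : {linear 'rV[R]_n -> V} := HB.pack f (GRing.isLinear.Build _ _ _ _ _ fL).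
rewrite -[f]/(fl : _ -> _); move: fl => {fL}f.
exists (\sum_i `|f (delta_mx 0 i)|) => [|u]; first exact: sumr_ge0.
rewrite {1}(row_sum_delta u) linear_sum mulr_suml.
rewrite (le_trans (ler_norm_sum _ _ _)) // ler_sum // => i _.
by rewrite linearZ normrZ mulrC ler_wpM2l // ler_coord_norm.
Qed.

End MatrixNorm.

Section OpNorm.
Variables (R : realType) (m : nat).
Implicit Types (A B X Y Z g : 'M[R]_m) (v : 'rV[R]_m).

(* The factor [m] makes the sup norm submultiplicative. *)
Definition opnorm A : R := m%:R * `|A|.

Lemma opnormE A : opnorm A = m%:R * `|A|. Proof. by []. Qed.

Lemma opnorm_ge0 A : 0 <= opnorm A. Proof. exact: mulr_ge0. Qed.
Lemma opnorm0 : opnorm 0 = 0. Proof. by rewrite /opnorm normr0 mulr0. Qed.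
Lemma opnormN A : opnorm (- A) = opnorm A. Proof. by rewrite /opnorm normrN. Qed.
Lemma opnormZ c A : opnorm (c *: A) = `|c| * opnorm A.
Proof. by rewrite /opnorm normrZ mulrCA. Qed.
Lemma opnormD A B : opnorm (A + B) <= opnorm A + opnorm B.
Proof. by rewrite /opnorm -mulrDr ler_wpM2l // ler_normD. Qed.
Lemma opnormB A B : opnorm (A - B) <= opnorm A + opnorm B.
Proof. by rewrite (le_trans (opnormD _ _)) ?opnormN. Qed.
Lemma opnormM A B : opnorm (A * B) <= opnorm A * opnorm B.
Proof.
rewrite /opnorm mulrACA -mulrA ler_wpM2l // (le_trans (norm_mulmx _ _)) //.
Qed.
Lemma norm_mulmx_opnorm v A : `|v *m A| <= `|v| * opnorm A.
Proof. by rewrite mulrCA; exact: norm_mulmx. Qed.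

Lemma opnorm_eq0 A : opnorm A = 0 -> A = 0.
Proof.
move=> /eqP; rewrite mulf_eq0 pnatr_eq0 normr_eq0 => /orP[/eqP m0|/eqP //].
by apply/matrixP => i; have := ltn_ord i; rewrite {2}m0.
Qed.

(** The error is of second order in [k%:R * opnorm Y], uniformly in [k], which lets powers of small
    elements stand in for one-parameter groups. *)
Lemma opnorm_powers Y k : k%:R * opnorm Y <= 1 ->
  opnorm ((1 + Y) ^+ k - 1 - k%:R *: Y) <= (k%:R * opnorm Y) ^+ 2.
Proof.
elim: k => [|k IH] kY; first by rewrite expr0 subrr scale0r subr0 opnorm0 sqr_ge0.
have a0 := opnorm_ge0 Y; have k0 : 0 <= k%:R :> R by [].
move: kY; rewrite -natr1 => kY.
have kY' : k%:R * opnorm Y <= 1 by nra.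
have {}IH := IH kY'.
set E := _ - _ in IH.
have -> : (1 + Y) ^+ k.+1 - 1 - (k%:R + 1) *: Y = E + k%:R *: (Y * Y) + E * Y.
  rewrite exprSr /E scalerDl scale1r !mulrBl !mulrDr mul1r mulr1.
  rewrite -[k%:R *: Y * Y]/(_ *m _) -scalemxAl -[Y *m Y]/(Y * Y).
  zmodule.
apply: le_trans (opnormD _ _) _.
have := opnormM E Y; have := opnormM Y Y; have := opnormD E (k%:R *: (Y * Y)).
rewrite opnormZ ger0_norm //; have := opnorm_ge0 E.
set e := opnorm E in IH *; set a := opnorm Y in IH kY kY' a0 *.
set c : R := k%:R in IH kY kY' k0 *.
move=> e0 h1 h2 h3.
have : c * opnorm (Y * Y) <= c * (a * a) by rewrite ler_wpM2l.
have : e * a <= (c * a) ^+ 2 * a by rewrite ler_wpM2r.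
have : c * a * (c * a * a) <= c * a * a by apply: ler_piMl => //; rewrite !mulr_ge0.
by nra.
Qed.

Lemma unitmx_near1 g : opnorm (g - 1) < 1 -> g \in unitmx.
Proof.
move=> g1; rewrite -row_free_unit -kermx_eq0; apply/negPn/negP => /eqP/eqP.
move=> /matrix0Pn[i [j kij]].
pose v := row i (kermx g).
have v0 : v != 0 by apply/matrix0Pn; exists 0, j; rewrite mxE.
have vg : v *m g = 0 by apply/sub_kermxP; exact: row_sub.
have : `|v| <= `|v| * opnorm (g - 1).
  rewrite -[leLHS]normrN; have <- : v *m (g - 1) = - v by rewrite mulmxBr vg mulmx1 sub0r.
  exact: norm_mulmx_opnorm.
have : 0 < `|v| by rewrite normr_gt0.
by nra.
Qed.

End OpNorm.
(* Without this, comparing two norms unfolds them down to finite suprema. *)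
Global Opaque opnorm.

(** Closed in the group of invertible matrices: only invertible limits are required to belong to
    [H]. *)
Definition closed_matrix_group (R : realType) m (H : set 'M[R]_m) : Prop :=
  [/\ H 1, forall g g', H g -> H g' -> H (g * g'),
      forall g, H g -> g \in unitmx /\ H (invmx g) &
      forall g, g \in unitmx ->
        (forall e, 0 < e -> exists2 g', H g' & opnorm (g' - g) < e) -> H g].

(** A one-sided tangent cone at 1: no curve in [H] is required, only an element close to [1 + t X]
    for each small [t]. *)
Definition tangent (R : realType) m (H : set 'M[R]_m) (X : 'M[R]_m) : Prop :=
  forall e, 0 < e ->
    \forall t \near 0^'+, exists2 g, H g & opnorm (g - 1 - t *: X) <= e * t.

Section Tangent.
Variables (R : realType) (m : nat) (H : set 'M[R]_m).
Hypothesis HH : closed_matrix_group H.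
Local Notation h := (tangent H).
Implicit Types (X Y g : 'M[R]_m).

Let H1 : H 1. Proof. by case: HH. Qed.
Let HM g g' : H g -> H g' -> H (g * g'). Proof. by case: HH => _ + _ _; apply. Qed.
Let HX g k : H g -> H (g ^+ k).
Proof. by move=> Hg; elim: k => [|k IH]; rewrite ?expr0 // exprS; apply: HM. Qed.
Let HU g : H g -> g \in unitmx. Proof. by case: HH => _ _ + _ => /(_ g)/[apply][[]]. Qed.
Let HV g : H g -> H (invmx g). Proof. by case: HH => _ _ + _ => /(_ g)/[apply][[]]. Qed.

(** The constant and the quadratic error are absorbed by taking [t] small against [e]. *)
Lemma tangent_le X C : 0 <= C ->
  (forall e, 0 < e -> \forall t \near 0^'+,
     exists2 g, H g & opnorm (g - 1 - t *: X) <= C * (e * t + t * t)) -> h X.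
Proof.
move=> C0 hX e e0; pose e' := e / (2 * (C + 1)).
have e'0 : 0 < e' by rewrite divr_gt0 // mulr_gt0 //; lra.
near=> t.
have t0 : 0 < t by near: t; exact: nbhs_right_gt.
have te : t < e' by near: t; exact: nbhs_right_lt.
have [g Hg hg] : exists2 g, H g & opnorm (g - 1 - t *: X) <= C * (e' * t + t * t).
  by near: t; apply: hX.
exists g => //; apply: le_trans hg _.
have ee : e = e' * (2 * (C + 1)) by rewrite divfK // gt_eqF // mulr_gt0 //; lra.
have h1 : C * (t * t) <= C * (e' * t) by rewrite ler_wpM2l // ler_wpM2r ?ltW.
have h2 : 0 <= e' * t by rewrite mulr_ge0 ?ltW.
rewrite ee; nra.
Unshelve. all: by end_near. Qed.

(* It suffices to approximate along arbitrarily small parameters, by taking powers. *)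
Lemma tangent_frequently X :
  (forall e d, 0 < e -> 0 < d ->
     exists g s, [/\ H g, 0 < s, s < d & opnorm (g - 1 - s *: X) <= e * s]) -> h X.
Proof.
move=> hX; pose C := opnorm X + 1.
have X0 := opnorm_ge0 X.
have C1 : 1 <= C by rewrite /C; lra.
have C0 : 0 <= C by lra.
apply: (@tangent_le X (C * C + 2)) => [|e e0]; first nra.
near=> t.
have t0 : 0 < t by near: t; exact: nbhs_right_gt.
have tC : t < C^-1 by near: t; apply: nbhs_right_lt; rewrite invr_gt0; lra.
have {}tC : t * C < 1 by rewrite -ltr_pdivlMr; lra.
pose e' := Num.min e 1.
have e'0 : 0 < e' by rewrite lt_min e0 ltr01.
have e'1 : e' <= 1 by rewrite ge_min lexx orbT.
have e'e : e' <= e by rewrite ge_min lexx.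
(* With [s * C] below [t * t], rounding [t] down to a multiple of [s] costs only a second order
   error. *)
have [|g [s [Hg s0 st gs]]] := hX e' (t * t / C) e'0.
  by rewrite divr_gt0 ?mulr_gt0 //; lra.
have {}st : s * C < t * t by rewrite -ltr_pdivlMr; lra.
have sN : s != 0 by rewrite gt_eqF.
have ts0 : 0 <= t / s by rewrite divr_ge0 ?ltW.
have [k k1 k2] : exists2 k : nat, k%:R <= t / s & t / s < k%:R + 1 :> R.
  by exists (Num.truncn (t / s)); rewrite ?truncn_le // natr1 truncnS_gt.
have {}k1 : k%:R * s <= t by rewrite -ler_pdivlMr.
have {}k2 : t < (k%:R + 1) * s by rewrite -ltr_pdivrMr.
have k0 : 0 <= k%:R :> R by [].
exists (g ^+ k); first exact: HX.
set c : R := k%:R in k0 k1 k2 *.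
have [Y YE] : exists Y, Y = g - 1 by exists (g - 1).
have gY : g = 1 + Y by rewrite YE addrC subrK.
have Y0 := opnorm_ge0 Y.
have YC : opnorm Y <= s * C.
  have -> : Y = (g - 1 - s *: X) + s *: X by rewrite subrK.
  apply: le_trans (opnormD _ _) _; rewrite opnormZ gtr0_norm // /C; nra.
have cY : c * opnorm Y <= t * C.
  by apply: (@le_trans _ _ (c * s * C)); rewrite -?mulrA ?ler_wpM2l // mulrA ler_wpM2r //; lra.
have pw := @opnorm_powers _ _ Y k; rewrite -/c in pw.
have {}pw := pw (le_trans cY (ltW tC)).
have -> : g ^+ k - 1 - t *: X = ((1 + Y) ^+ k - 1 - c *: Y) +
   (c *: (Y - s *: X) + (c * s - t) *: X).
  rewrite gY scalerBr scalerA scalerBl; zmodule.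
apply: le_trans (opnormD _ _) _.
rewrite -YE in gs; have := opnormD (c *: (Y - s *: X)) ((c * s - t) *: X).
rewrite !opnormZ (ger0_norm k0) ler0_norm; last lra.
have h1 : c * opnorm (Y - s *: X) <= c * (e' * s) by rewrite ler_wpM2l.
have h2 : c * (e' * s) <= e' * t by rewrite mulrCA ler_wpM2l // ltW.
have h3 : e' * t <= e * t by rewrite ler_wpM2r // ltW.
have h4 : - (c * s - t) * opnorm X <= s * opnorm X by rewrite ler_wpM2r //; lra.
have h5 : (c * opnorm Y) ^+ 2 <= (t * C) ^+ 2.
  by rewrite ler_sqr // nnegrE ?mulr_ge0 // ?(ltW t0).
have h6 : s * opnorm X <= s * C by rewrite ler_wpM2l ?(ltW s0) // lerDl.
have h7 : (t * C) ^+ 2 = C * C * (t * t) by ring.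
have h9 : 0 <= e * t by rewrite mulr_ge0 ?(ltW e0) ?(ltW t0).
have h8 : 0 <= C * C * (e * t) by rewrite mulr_ge0 // mulr_ge0.
have h10 : 0 <= t * t by rewrite mulr_ge0 ?(ltW t0).
move=> h11; rewrite h7 in h5; move: h1 h2 h3 h4 h5 h6 h8 h9 h10 h11 pw st.
lra.
Unshelve. all: by end_near. Qed.

End Tangent.

Section Tangent.
Variables (R : realType) (m : nat) (H : set 'M[R]_m).
Hypothesis HH : closed_matrix_group H.
Local Notation h := (tangent H).
Implicit Types (X Y g : 'M[R]_m).

Let H1 : H 1. Proof. by case: HH. Qed.
Let HM g g' : H g -> H g' -> H (g * g'). Proof. by case: HH => _ + _ _; apply. Qed.
Let HU g : H g -> g \in unitmx. Proof. by case: HH => _ _ + _ => /(_ g)/[apply][[]]. Qed.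
Let HV g : H g -> H (invmx g). Proof. by case: HH => _ _ + _ => /(_ g)/[apply][[]]. Qed.

Lemma opnorm_invmx g : g \in unitmx -> opnorm (g - 1) <= 2^-1 ->
  opnorm (invmx g - 1) <= 2 * opnorm (g - 1) /\
  opnorm (invmx g - 1 + (g - 1)) <= 2 * (opnorm (g - 1) * opnorm (g - 1)).
Proof.
move=> gU g2; have a0 := opnorm_ge0 (g - 1); have b0 := opnorm_ge0 (invmx g - 1).
have VK : invmx g * g = 1 by exact: mulVmx.
have e1 : invmx g - 1 = - (g - 1) - (invmx g - 1) * (g - 1).
  rewrite mulrBl !mulrBr VK !mulr1 mul1r; zmodule.
have h1 : opnorm (invmx g - 1) <= 2 * opnorm (g - 1).
  have := opnormB (- (g - 1)) ((invmx g - 1) * (g - 1)); rewrite -e1 opnormN.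
  have := opnormM (invmx g - 1) (g - 1); nra.
split=> //; have -> : invmx g - 1 + (g - 1) = - ((invmx g - 1) * (g - 1)).
  rewrite {1}e1; zmodule.
by rewrite opnormN (le_trans (opnormM _ _)) // mulrA ler_wpM2r.
Qed.

Lemma tangent_ex X e d : h X -> 0 < e -> 0 < d ->
  exists g s, [/\ H g, 0 < s, s < d & opnorm (g - 1 - s *: X) <= e * s].
Proof.
move=> hX e0 d0; have {}hX := hX _ e0.
suff [s [s0 sd [g Hg gs]]] : exists s, [/\ 0 < s, s < d & 
    exists2 g, H g & opnorm (g - 1 - s *: X) <= e * s] by exists g, s.
apply: (@filter_ex _ (0 : R)^'+).
near=> s; split; [near: s; exact: nbhs_right_gt|near: s; exact: nbhs_right_lt|by near: s].
Unshelve. all: by end_near. Qed.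

Lemma tangent0 : h 0.
Proof.
move=> e e0; near=> t; exists 1 => //.
by rewrite subrr scaler0 subr0 opnorm0 mulr_ge0 ?ltW //; near: t; exact: nbhs_right_gt.
Unshelve. all: by end_near. Qed.

Lemma tangent_opp X : h X -> h (- X).
Proof.
move=> hX; have N0 := opnorm_ge0 X.
apply: (@tangent_le _ _ _ _ (1 + 2 * (opnorm X + 1) ^+ 2)) => [|e e0].
  by rewrite addr_ge0 // mulr_ge0 // sqr_ge0.
pose e' := Num.min e 1; have e'0 : 0 < e' by rewrite lt_min e0 ltr01.
have e'1 : e' <= 1 by rewrite ge_min lexx orbT.
have e'e : e' <= e by rewrite ge_min lexx.
near=> t.
have t0 : 0 < t by near: t; exact: nbhs_right_gt.
have tC : t < (2 * (opnorm X + 1))^-1.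
  by near: t; apply: nbhs_right_lt; rewrite invr_gt0; lra.
have {}tC : t * (2 * (opnorm X + 1)) < 1 by rewrite -ltr_pdivlMr //; lra.
have [g Hg gt] : exists2 g, H g & opnorm (g - 1 - t *: X) <= e' * t.
  by near: t; apply: hX.
exists (invmx g); first exact: HV.
have ga : opnorm (g - 1) <= t * (opnorm X + 1).
  rewrite -[g - 1](subrK (t *: X)); apply: le_trans (opnormD _ _) _.
  by rewrite opnormZ gtr0_norm //; nra.
have [|_ iv] := opnorm_invmx (HU Hg); first lra.
have -> : invmx g - 1 - t *: - X = (invmx g - 1 + (g - 1)) - (g - 1 - t *: X).
  rewrite scalerN; zmodule.
apply: le_trans (opnormB _ _) _; have g0 := opnorm_ge0 (g - 1).
have : opnorm (g - 1) * opnorm (g - 1) <= (t * (opnorm X + 1)) * (t * (opnorm X + 1)).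
  by rewrite ler_pM //.
have : e' * t <= e * t by rewrite ler_wpM2r // ltW.
have : 0 <= (opnorm X + 1) ^+ 2 * (e * t) by rewrite mulr_ge0 ?sqr_ge0 // mulr_ge0 ?ltW.
have : 0 <= t * t by rewrite mulr_ge0 ?ltW.
move: iv gt; set a := opnorm _; set b := opnorm _; move: (opnorm (g - 1)) => c.
have -> : t * (opnorm X + 1) * (t * (opnorm X + 1)) = (opnorm X + 1) ^+ 2 * (t * t) by ring.
lra.
Unshelve. all: by end_near. Qed.

Lemma tangentD X Y : h X -> h Y -> h (X + Y).
Proof.
move=> hX hY; have NX := opnorm_ge0 X; have NY := opnorm_ge0 Y.
apply: (@tangent_le _ _ _ _ (2 + (opnorm X + 1) * (opnorm Y + 1))) => [|e e0].
  by rewrite addr_ge0 ?mulr_ge0 ?addr_ge0.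
pose e' := Num.min e 1; have e'0 : 0 < e' by rewrite lt_min e0 ltr01.
have e'1 : e' <= 1 by rewrite ge_min lexx orbT.
have e'e : e' <= e by rewrite ge_min lexx.
near=> t.
have t0 : 0 < t by near: t; exact: nbhs_right_gt.
have [g Hg gt] : exists2 g, H g & opnorm (g - 1 - t *: X) <= e' * t.
  by near: t; apply: hX.
have [g' Hg' gt'] : exists2 g, H g & opnorm (g - 1 - t *: Y) <= e' * t.
  by near: t; apply: hY.
exists (g * g'); first exact: HM.
have ga : opnorm (g - 1) <= t * (opnorm X + 1).
  rewrite -[g - 1](subrK (t *: X)); apply: le_trans (opnormD _ _) _.
  by rewrite opnormZ gtr0_norm //; nra.
have ga' : opnorm (g' - 1) <= t * (opnorm Y + 1).
  rewrite -[g' - 1](subrK (t *: Y)); apply: le_trans (opnormD _ _) _.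
  by rewrite opnormZ gtr0_norm //; nra.
have -> : g * g' - 1 - t *: (X + Y) =
    (g - 1 - t *: X) + ((g' - 1 - t *: Y) + (g - 1) * (g' - 1)).
  rewrite mulrBr mulrBl !mulr1 mul1r scalerDr; zmodule.
apply: le_trans (opnormD _ _) _.
have h1 := opnormD (g' - 1 - t *: Y) ((g - 1) * (g' - 1)).
have h2 := opnormM (g - 1) (g' - 1).
have h3 : opnorm (g - 1) * opnorm (g' - 1) <=
    (t * (opnorm X + 1)) * (t * (opnorm Y + 1)) by rewrite ler_pM ?opnorm_ge0.
have h4 : e' * t <= e * t by rewrite ler_wpM2r // ltW.
have h5 : 0 <= (opnorm X + 1) * (opnorm Y + 1) * (e * t).
  by rewrite !mulr_ge0 ?addr_ge0 // ltW.
have h6 : 0 <= t * t by rewrite mulr_ge0 ?ltW.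
rewrite [X in _ <= X](_ : _ = (opnorm X + 1) * (opnorm Y + 1) * (t * t)) in h3; last by ring.
move: h1 h2 h3 h4 h5 h6 gt gt'; lra.
Unshelve. all: by end_near. Qed.

Lemma tangentZ c X : h X -> h (c *: X).
Proof.
suff pos d Y : 0 < d -> h Y -> h (d *: Y).
  move=> hX; have [c0|c0|->] := ltgtP c 0.
  - by rewrite -[c]opprK scaleNr; apply/tangent_opp/pos => //; rewrite oppr_gt0.
  - exact: pos.
  - by rewrite scale0r; exact: tangent0.
move=> d0 hY; apply: tangent_frequently => // e r e0 r0.
have [g [s [Hg s0 sr gs]]] := tangent_ex hY (divr_gt0 e0 d0) (mulr_gt0 r0 d0).
exists g, (s / d); rewrite divr_gt0 // ltr_pdivrMr // scalerA divfK ?gt_eqF //.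
by split=> //; rewrite mulrA mulrAC.
Qed.

Lemma tangent_closed X : (forall e, 0 < e -> exists2 Y, h Y & opnorm (Y - X) <= e) -> h X.
Proof.
move=> hX; apply: tangent_frequently => // e d e0 d0.
have e2 : 0 < e / 2 by lra.
have [Y hY YX] := hX _ e2; have [g [s [Hg s0 sd gs]]] := tangent_ex hY e2 d0.
exists g, s; split=> //.
have -> : g - 1 - s *: X = (g - 1 - s *: Y) + s *: (Y - X) by rewrite scalerBr; zmodule.
apply: le_trans (opnormD _ _) _; rewrite opnormZ gtr0_norm //.
have : s * opnorm (Y - X) <= s * (e / 2) by rewrite ler_wpM2l // ltW.
lra.
Qed.

Lemma tangentAd g X : H g -> h X -> h (g * X * invmx g).
Proof.
move=> Hg hX; pose C := opnorm g * opnorm (invmx g) + 1.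
have C0 : 0 < C by rewrite ltr_wpDl ?mulr_ge0 ?opnorm_ge0.
apply: tangent_frequently => // e d e0 d0.
have [g' [s [Hg' s0 sd gs]]] := tangent_ex hX (divr_gt0 e0 C0) d0.
exists (g * g' * invmx g), s; split=> //; first by do 2?apply: HM => //; exact: HV.
have -> : g * g' * invmx g - 1 - s *: (g * X * invmx g) = g * (g' - 1 - s *: X) * invmx g.
  rewrite !mulrBr !mulrBl mulr1.
  have -> : g * invmx g = 1 by apply: mulmxV; exact: HU.
  have -> : g * (s *: X) = s *: (g * X) by rewrite -[LHS]/(_ *m _) -scalemxAr.
  by have -> : s *: (g * X) * invmx g = s *: (g * X * invmx g) by rewrite -[LHS]/(_ *m _) -scalemxAl.
apply: le_trans (opnormM _ _) _.
have h1 := opnormM g (g' - 1 - s *: X).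
have a0 := opnorm_ge0 (g' - 1 - s *: X); have b0 := opnorm_ge0 g; have c0 := opnorm_ge0 (invmx g).
apply: (@le_trans _ _ (C * (e / C * s))); last by rewrite mulrA [C * _]mulrC divfK // gt_eqF.
apply: (@le_trans _ _ (C * opnorm (g' - 1 - s *: X))); last by rewrite ler_wpM2l // ltW.
rewrite /C; nra.
Qed.

(** The bracket is a limit of vectors [s^-1 (g Y g^-1 - Y)] with [g] close to [1 + s X], and the
    tangent vectors form a closed subspace stable under conjugation. *)
Lemma tangent_lie X Y : h X -> h Y -> h (lie X Y).
Proof.
move=> hX hY; apply: tangent_closed => e e0.
pose C := 2 * opnorm Y + 2 * (opnorm X + 1) * (opnorm (lie X Y) + 2 * opnorm Y) + 1.
have X0 := opnorm_ge0 X; have Y0 := opnorm_ge0 Y; have L0 := opnorm_ge0 (lie X Y).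
have C0 : 0 < C.
  have : 0 <= (opnorm X + 1) * (opnorm (lie X Y) + 2 * opnorm Y).
    by rewrite mulr_ge0 ?addr_ge0 // mulr_ge0.
  by rewrite /C; lra.
pose e' := Num.min (e / C) 1; have e'0 : 0 < e' by rewrite lt_min divr_gt0 // ltr01.
have e'1 : e' <= 1 by rewrite ge_min lexx orbT.
have e'e : e' <= e / C by rewrite ge_min lexx.
have d0 : 0 < e' / (2 * (opnorm X + 1)) by rewrite divr_gt0 // mulr_gt0 //; lra.
have [g [s [Hg s0 sd gs]]] := tangent_ex hX e'0 d0.
have {}sd : s * (2 * (opnorm X + 1)) < e' by rewrite -ltr_pdivlMr // mulr_gt0 //; lra.
exists (s^-1 *: (g * Y * invmx g - Y)).
  apply: tangentZ; apply: tangentD; first exact: tangentAd.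
  exact: tangent_opp.
have ga : opnorm (g - 1) <= s * (opnorm X + 1).
  rewrite -[g - 1](subrK (s *: X)); apply: le_trans (opnormD _ _) _.
  by rewrite opnormZ gtr0_norm //; nra.
have [|iv _] := opnorm_invmx (HU Hg); first lra.
pose D := s^-1 *: (g - 1) - X.
have De : opnorm D <= e'.
  have -> : D = s^-1 *: (g - 1 - s *: X).
    by rewrite /D [in RHS]scalerBr scalerA mulVf ?gt_eqF // scale1r.
  by rewrite opnormZ gtr0_norm ?invr_gt0 // mulrC ler_pdivrMr.
pose L := lie X Y + lie D Y.
have -> : s^-1 *: (g * Y * invmx g - Y) - lie X Y = lie D Y + L * (invmx g - 1).
  have VK : g * invmx g = 1 by apply: mulmxV; exact: HU.
  have -> : s^-1 *: (g * Y * invmx g - Y) = L * invmx g.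
    have -> : g * Y * invmx g - Y = lie (g - 1) Y * invmx g.
      by rewrite /lie !(mulrBl, mulrBr) mul1r mulr1 -[Y * g * _]mulrA VK mulr1; zmodule.
    have -> (Z W : 'M[R]_m) : s^-1 *: (Z * W) = (s^-1 *: Z) * W by exact: scalemxAl.
    by rewrite -lieZl /L -lieDl /D [X + _]addrC subrK.
  rewrite mulrBr mulr1 /L; zmodule.
have h1 : opnorm (lie D Y) <= 2 * (e' * opnorm Y).
  apply: le_trans (opnormB _ _) _.
  have : opnorm D * opnorm Y <= e' * opnorm Y by rewrite ler_wpM2r.
  by have := opnormM D Y; have := opnormM Y D; lra.
apply: le_trans (opnormD _ _) _.
have h2 := opnormM L (invmx g - 1).
have h3 : opnorm L <= opnorm (lie X Y) + 2 * opnorm Y.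
  apply: le_trans (opnormD _ _) _.
  have : e' * opnorm Y <= opnorm Y by rewrite ler_piMl.
  lra.
have h4 : opnorm (invmx g - 1) <= e' by lra.
have h5 : opnorm L * opnorm (invmx g - 1) <= (opnorm (lie X Y) + 2 * opnorm Y) * e'.
  by rewrite ler_pM ?opnorm_ge0.
have h6 : C * e' <= e by rewrite mulrC -ler_pdivlMr.
have h7 : 0 <= opnorm X * (opnorm (lie X Y) + 2 * opnorm Y) * e'.
  by rewrite !mulr_ge0 ?addr_ge0 ?mulr_ge0 // ltW.
have h8 : 0 <= opnorm (lie X Y) * e' by rewrite mulr_ge0 // ltW.
have h9 : 0 <= opnorm Y * e' by rewrite mulr_ge0 // ltW.
move: h1 h2 h5 h6 h7 h8 h9 e'0; rewrite /C; lra.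
Qed.
End Tangent.

Lemma norm_le_opnorm (R : realType) m (A : 'M[R]_m) : `|A| <= opnorm A.
Proof.
case: m A => [|m] A; first by rewrite [A]flatmx0 normr0 opnorm_ge0.
by rewrite opnormE ler_peMl // ler1n.
Qed.

Lemma opnorm_cluster (R : realType) m (u : nat -> 'M[R]_m) C :
  (forall k, opnorm (u k) <= C) ->
  exists X, forall e, 0 < e -> forall K, exists2 k, (K <= k)%N & opnorm (u k - X) < e.
Proof.
move=> uC; have [k|X hX] := @bounded_mxseq_cluster _ _ _ u C.
  exact: le_trans (norm_le_opnorm _) (uC k).
exists X => e e0 K; have e'0 : 0 < e / m.+1%:R by rewrite divr_gt0.
have [k Kk uX] := hX _ e'0 K; exists k => //; move: uX; rewrite ltr_pdivlMr //.
by apply: le_lt_trans; rewrite opnormE mulrC ler_wpM2l // ler_nat.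
Qed.

Lemma invr_nat_lt (R : realType) (d : R) : 0 < d -> exists K, forall k, (K <= k)%N -> k.+1%:R^-1 < d.
Proof.
move=> d0; exists (Num.truncn d^-1) => k Kk.
rewrite invf_plt ?posrE // (lt_le_trans (truncnS_gt _)) // ler_nat ltnS //.
Qed.

Section Tangent.
Variables (R : realType) (m : nat) (H : set 'M[R]_m).
Hypothesis HH : closed_matrix_group H.
Local Notation h := (tangent H).
Implicit Types (X Y g : 'M[R]_m).

Let H1 : H 1. Proof. by case: HH. Qed.
Let HM g g' : H g -> H g' -> H (g * g'). Proof. by case: HH => _ + _ _; apply. Qed.
Let HX g k : H g -> H (g ^+ k).
Proof. by move=> Hg; elim: k => [|k IH]; rewrite ?expr0 // exprS; apply: HM. Qed.

(** By compactness: if it failed along a sequence of elements tending to 1, a cluster point of the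
    normalised differences [g - 1] would be tangent and, rescaled, would approximate one of them. *)
Lemma tangent_approx e : 0 < e -> exists2 d, 0 < d &
  forall g, H g -> opnorm (g - 1) < d ->
    exists2 X, h X & opnorm (g - 1 - X) <= e * opnorm (g - 1).
Proof.
move=> e0; apply: contrapT => nh.
have /choice[g hg] : forall k, exists g, [/\ H g, opnorm (g - 1) < k.+1%:R^-1 &
    forall X, h X -> e * opnorm (g - 1) < opnorm (g - 1 - X)].
  move=> k; apply: contrapT => ng; apply: nh; exists k.+1%:R^-1; first by rewrite invr_gt0.
  move=> g Hg gk; apply: contrapT => nX; apply: ng; exists g; split=> // X hX.
  by rewrite ltNge; apply/negP => le; apply: nX; exists X.
pose s k := opnorm (g k - 1).
have s0 k : 0 < s k.
  have [_ _ /(_ 0 (tangent0 HH))] := hg k; rewrite subr0 -/(s k).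
  have : 0 <= s k by exact: opnorm_ge0.
  by rewrite le_eqVlt => /orP[/eqP <-|//]; rewrite mulr0 ltxx.
have [|X hX] := @opnorm_cluster _ _ (fun k => (s k)^-1 *: (g k - 1)) 1.
  by move=> k; rewrite opnormZ gtr0_norm ?invr_gt0 // mulVf // gt_eqF.
have gX k : opnorm (g k - 1 - s k *: X) = s k * opnorm ((s k)^-1 *: (g k - 1) - X).
  have -> : g k - 1 - s k *: X = s k *: ((s k)^-1 *: (g k - 1) - X).
    by rewrite [in RHS]scalerBr scalerA mulfV ?gt_eqF // scale1r.
  by rewrite opnormZ gtr0_norm.
have tX : h X.
  apply: tangent_frequently => // e1 d e10 d0.
  have [K hK] := invr_nat_lt d0; have [k Kk uk] := hX _ e10 K.
  have [Hgk gk _] := hg k; exists (g k), (s k); split=> //.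
    exact: lt_trans gk (hK _ Kk).
  by rewrite gX mulrC ler_wpM2r // ltW.
have [k _ uk] := hX _ e0 0%N; have [_ _ /(_ _ (tangentZ HH (s k) tX))] := hg k.
by rewrite gX -/(s k) mulrC ltr_pM2l // ltNge ltW.
Qed.

(** The element is a power [g ^+ M] with [g] close to [1 + X / M]. On a row [y] killed by [X], each
    factor contributes a displacement of at most [|y| e / M], and the remaining powers stretch rows
    by a factor at most 3. *)
Lemma tangent_power X e : h X -> opnorm X <= 2^-1 -> 0 < e -> e <= 4^-1 ->
  exists2 g, H g & opnorm (g - 1 - X) <= (opnorm X + e) ^+ 2 + e /\
    forall y : 'rV_m, y *m X = 0 -> `|y *m g - y| <= 3 * `|y| * e.
Proof.
move=> hX X2 e0 e4; have /nbhs_ballP[d /= d0 hd] := hX _ e0.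
have [K /(_ K (leqnn K)) Kd] := invr_nat_lt d0; set M := K.+1 in Kd.
have M0 : 0 < M%:R :> R by []. have Mi : 0 < M%:R^-1 :> R by rewrite invr_gt0.
have [||g Hg gM] := hd M%:R^-1 => //; first by rewrite /ball /= sub0r normrN gtr0_norm.
have X0 := opnorm_ge0 X.
have [Y YE] : exists Y, Y = g - 1 by exists (g - 1).
have gY : g = 1 + Y by rewrite YE addrC subrK.
have {gM} : opnorm (M%:R *: Y - X) <= e.
  have -> : M%:R *: Y - X = M%:R *: (Y - M%:R^-1 *: X).
    by rewrite [in RHS]scalerBr scalerA mulfV ?gt_eqF // scale1r.
  by rewrite opnormZ gtr0_norm // mulrC -ler_pdivlMr // YE.
move=> MY; have {}MY' : M%:R * opnorm Y <= opnorm X + e.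
  rewrite -[M%:R]gtr0_norm // -opnormZ -[_ *: Y](subrK X).
  by apply: le_trans (opnormD _ _) _; lra.
have Y0 := opnorm_ge0 Y.
have pw k : (k <= M)%N -> opnorm (g ^+ k - 1) <= 2.
  rewrite -(ler_nat R) => kM; have kY : k%:R * opnorm Y <= opnorm X + e by apply: le_trans MY'; rewrite ler_wpM2r.
  have {}pw : opnorm ((1 + Y) ^+ k - 1 - k%:R *: Y) <= (k%:R * opnorm Y) ^+ 2.
    by apply: opnorm_powers; lra.
  rewrite gY -[_ - 1](subrK (k%:R *: Y)); apply: le_trans (opnormD _ _) _.
  rewrite opnormZ ger0_norm //; have : 0 <= k%:R * opnorm Y by rewrite mulr_ge0.
  move=> z0; have z1 : k%:R * opnorm Y <= 1 by lra.
  have : (k%:R * opnorm Y) ^+ 2 <= 1 by rewrite expr_le1.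
  lra.
exists (g ^+ M); first exact: HX.
split=> [|y yX].
  have pwM : opnorm ((1 + Y) ^+ M - 1 - M%:R *: Y) <= (M%:R * opnorm Y) ^+ 2.
    by apply: opnorm_powers; lra.
  have -> : g ^+ M - 1 - X = ((1 + Y) ^+ M - 1 - M%:R *: Y) + (M%:R *: Y - X).
    by rewrite gY; zmodule.
  apply: le_trans (opnormD _ _) _; apply: lerD MY; apply: le_trans pwM _.
  by rewrite ler_sqr // nnegrE ?mulr_ge0 //; lra.
have yY : M%:R * `|y *m Y| <= `|y| * e.
  rewrite -[M%:R]gtr0_norm // -normrZ scalemxAr -[_ *: Y](subrK X) mulmxDr yX addr0.
  by apply: le_trans (norm_mulmx_opnorm _ _) _; rewrite ler_wpM2l.
suff st k : (k <= M)%N -> `|y *m g ^+ k - y| <= 3 * (k%:R * `|y *m Y|).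
  by apply: le_trans (st M (leqnn M)) _; lra.
elim: k => [|k IH] kM; first by rewrite expr0 mulmx1 subrr normr0 mul0r mulr0.
have {}IH := IH (ltnW kM).
have -> : y *m g ^+ k.+1 - y = (y *m Y) *m g ^+ k + (y *m g ^+ k - y).
  by rewrite exprS gY -[(1 + Y) * _]/(_ *m _) mulmxA mulmxDr mulmx1 mulmxDl; zmodule.
apply: le_trans (ler_normD _ _) _; rewrite -natr1.
suff : `|y *m Y *m g ^+ k| <= 3 * `|y *m Y| by lra.
rewrite -[g ^+ k](subrK 1) mulmxDr mulmx1; apply: le_trans (ler_normD _ _) _.
have := norm_mulmx_opnorm (y *m Y) (g ^+ k - 1); have := pw k (ltnW kM).
have := normr_ge0 (y *m Y); nra.
Qed.

(** A substitute for the exponential: a cluster point of the elements of [tangent_power] as the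
    error tends to 0. The rows killed by [X] are fixed exactly, not only to first order, which the
    arguments with stabilisers need. *)
Lemma tangent_exp X : h X -> opnorm X <= 2^-1 ->
  exists2 g, H g & opnorm (g - 1 - X) <= opnorm X ^+ 2 /\
    forall y : 'rV_m, y *m X = 0 -> y *m g = y.
Proof.
move=> hX X2; have X0 := opnorm_ge0 X.
pose e k : R := 4^-1 * k.+1%:R^-1.
have e0 k : 0 < e k by rewrite mulr_gt0 ?invr_gt0.
have e4 k : e k <= 4^-1 by rewrite ler_piMr // invf_le1 // ler1n.
have /choice[g hg] : forall k, exists g, [/\ H g, opnorm (g - 1 - X) <= (opnorm X + e k) ^+ 2 + e k &
    forall y : 'rV_m, y *m X = 0 -> `|y *m g - y| <= 3 * `|y| * e k].
  by move=> k; have [g Hg [g1 g2]] := tangent_power hX X2 (e0 k) (e4 k); exists g.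
have [|x hx] := @opnorm_cluster _ _ (fun k => g k - 1 - X) 2.
  move=> k; have [_ gk _] := hg k; apply: le_trans gk _.
  have := e0 k; have := e4 k; nra.
have esm d : 0 < d -> exists k, opnorm (g k - 1 - X - x) < d /\ e k < d.
  move=> d0; have [K hK] := invr_nat_lt d0; have [k Kk uk] := hx _ d0 K.
  exists k; split=> //; apply: le_lt_trans (hK _ Kk).
  by rewrite ler_piMl ?invr_ge0 // invf_le1 // ler1n.
have xX : opnorm x <= opnorm X ^+ 2.
  apply/ler_addgt0Pr => d d0; have d3 : 0 < d / 4 by lra.
  have [k [xk ek]] := esm _ d3; have [_ gk _] := hg k.
  have := e0 k; have := e4 k.
  have -> : x = (g k - 1 - X) - (g k - 1 - X - x) by zmodule.
  by move=> ? ?; apply: le_trans (opnormB _ _) _; nra.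
have HK : H (1 + X + x).
  have [_ _ _ cl] := HH; apply: cl => [|d d0].
    apply: unitmx_near1; have -> : 1 + X + x - 1 = X + x by zmodule.
    by apply: le_lt_trans (opnormD _ _) _; nra.
  have [k [xk _]] := esm _ d0; have [Hk _ _] := hg k; exists (g k) => //.
  by rewrite (_ : _ - _ = g k - 1 - X - x) //; zmodule.
exists (1 + X + x) => //; split=> [|y yX].
  by rewrite (_ : _ - _ - _ = x) //; zmodule.
suff : `|y *m (1 + X + x) - y| <= 0 by rewrite normr_le0 subr_eq0 => /eqP.
apply/ler_addgt0Pr => d d0; have dy : 0 < d / (4 * (`|y| + 1)) by rewrite divr_gt0 // mulr_gt0 // ltr_wpDl.
have [k [xk ek]] := esm _ dy; have [_ _ /(_ _ yX) gk] := hg k.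
have -> : y *m (1 + X + x) - y = (y *m g k - y) - y *m (g k - 1 - X - x).
  by rewrite !(mulmxDr, mulmxN, mulmx1); zmodule.
rewrite add0r; apply: le_trans (ler_normB _ _) _.
have := norm_mulmx_opnorm y (g k - 1 - X - x).
have : `|y| * opnorm (g k - 1 - X - x) <= `|y| * (d / (4 * (`|y| + 1))) by rewrite ler_wpM2l // ltW.
have : `|y| * e k <= `|y| * (d / (4 * (`|y| + 1))) by rewrite ler_wpM2l // ltW.
have : `|y| * (d / (4 * (`|y| + 1))) <= d / 4.
  rewrite invfM mulrA mulrCA mulrA ler_pdivrMr; last by rewrite ltr_wpDl.
  by have := normr_ge0 y; nra.
lra.
Qed.

End Tangent.

(** * From open orbits to spanning tangent vectors *)

Section TangentOnto.
Variables (R : realType) (m : nat) (H : set 'M[R]_m).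
Hypothesis HH : closed_matrix_group H.
Local Notation h := (tangent H).
Implicit Types (X Y g : 'M[R]_m).

Let HM g g' : H g -> H g' -> H (g * g'). Proof. by case: HH => _ + _ _; apply. Qed.
Let HU g : H g -> g \in unitmx. Proof. by case: HH => _ _ + _ => /(_ g)/[apply][[]]. Qed.
Let HV g : H g -> H (invmx g). Proof. by case: HH => _ _ + _ => /(_ g)/[apply][[]]. Qed.

(** The pseudo-inverse of the evaluation at [y] on the space of tangent vectors is linear, hence
    bounded. *)
Lemma evaluation_section (y : 'rV[R]_m) : exists2 C, 0 <= C &
  forall X, h X -> exists2 Y, h Y & y *m Y = y *m X /\ opnorm Y <= C * `|y *m X|.
Proof.
have [|c u v|V VP] := @vspace_of_linear R [the vectType R of 'M[R]_m] h.
- exact: tangent0.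
- by move=> hu hv; apply: tangentD => //; apply: tangentZ.
pose ev := linfun (mulmx y : 'M[R]_m -> 'rV[R]_m).
pose f := (ev \o projv V)%VF.
pose s := (projv V \o f^-1)%VF.
have [C C0 hC] := bounded_linear_row (linearP s).
exists (m%:R * C) => [|X hX]; first exact: mulr_ge0.
exists (s (y *m X)); first by apply/(VP (s (y *m X))); rewrite /s comp_lfunE; exact: memv_proj.
split; last by rewrite opnormE -mulrA ler_wpM2l //; exact: hC.
have fs u : y *m s u = f ((f^-1)%VF u) by rewrite /s /f /ev !comp_lfunE lfunE.
rewrite fs limg_lfunVK //.
have -> : y *m X = f X by rewrite /f /ev comp_lfunE projv_id ?lfunE //; apply/VP.
exact: memv_img (memvf _).
Qed.

(** Minimality up to [t] is all that [tangent_onto] uses, so that the infimum need not be shown to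
    be attained. *)
Lemma near_optimal (y w : 'rV[R]_m) (t e : R) : 0 < t ->
  (exists g, [/\ H g, opnorm (g - 1) < e & y *m g = w]) ->
  exists g, [/\ H g, opnorm (g - 1) < e + t, y *m g = w &
    forall g', H g' -> y *m g' = w -> opnorm (g - 1) <= opnorm (g' - 1) + t].
Proof.
move=> t0 [g0 [Hg0 g0e yg0]].
pose A := [set opnorm (g - 1) | g in [set g | H g /\ y *m g = w]].
have iA : has_inf A.
  split; first by exists (opnorm (g0 - 1)); exists g0.
  by exists 0 => _ [g _ <-]; exact: opnorm_ge0.
have lA g : H g -> y *m g = w -> inf A <= opnorm (g - 1).
  by move=> Hg yg; apply: ge_inf; [case: iA|exists g].
have [_ [g [Hg yg] <-] gt] := inf_adherent t0 iA.
exists g; split=> // [|g' Hg' yg'].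
  by apply: lt_trans gt _; rewrite ltrD2r (le_lt_trans _ g0e) // lA.
by apply: ltW; apply: lt_le_trans gt _; rewrite lerD2r lA.
Qed.

(** An element that moves [y] by [t *: v] may be much farther than [t] from 1, so [g] is chosen
    almost minimal. Its tangent approximation [X] is split into [X1], of size controlled by
    [y *m X], and a tangent vector that kills [y]. Dividing [g] by the element that [tangent_exp]
    gives for the latter yields a competitor, and minimality bounds the size of [g] by a multiple of
    [t]. Then [y *m X] is so close to [t *: v] that [v] cannot stay away from the space of all
    [y *m X]. *)
Lemma tangent_onto (y v : 'rV[R]_m) :
  (forall e, 0 < e -> exists2 d, 0 < d & forall t, 0 < t -> t < d ->
     exists g, [/\ H g, opnorm (g - 1) < e & y *m g = y + t *: v]) ->
  exists2 X, h X & y *m X = v.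
Proof.
move=> O; apply: contrapT => nX.
have [|c _ _ [X [hX <-]] [Y [hY <-]]|E EP] :=
  @vspace_of_linear R [the vectType R of 'rV[R]_m] (fun u => exists X, h X /\ y *m X = u).
- by exists 0; rewrite mulmx0; split=> //; apply: tangent0.
- exists (c *: X + Y); rewrite mulmxDr -scalemxAr; split=> //.
  by apply: tangentD => //; apply: tangentZ.
have vE : v \notin E by apply/negP => /EP[X [hX yX]]; apply: nX; exists X.
have [C1 C10 hC1] := bounded_linear_row (linearP (projv E)).
have [k k0 hk] := evaluation_section y.
pose f0 := `|v - projv E v|.
have f00 : 0 < f0.
  rewrite normr_gt0 subr_eq0; apply: contra vE => /eqP ->; exact: memv_proj.
set nv := `|v|; have nv0 : 0 <= nv by exact: normr_ge0.
set b := `|y|; have b0 : 0 <= b by exact: normr_ge0.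
pose A := 2 + 8 * (k * nv).
have knv0 : 0 <= k * nv by rewrite mulr_ge0.
have A0 : 0 < A by rewrite /A; lra.
(* The sum of three terms, one for each of the bounds on [eta = D^-1] established below. *)
pose D := 16 + 16 * (k * b) + 2 * ((1 + C1) * b * A) / f0.
have D2 : 0 <= (1 + C1) * b * A by rewrite !mulr_ge0 //; lra.
have D0 : 0 < D.
  have : 0 <= 2 * ((1 + C1) * b * A) / f0 by rewrite divr_ge0 ?mulr_ge0 //; lra.
  by have := mulr_ge0 k0 b0; rewrite /D; lra.
pose eta := D^-1; have eta0 : 0 < eta by rewrite invr_gt0.
have Deta : D * eta = 1 by rewrite mulfV // gt_eqF.
have [eta1 eta2 eta3] : [/\ eta <= 16^-1, k * b * eta <= 16^-1 &
    (1 + C1) * b * A * eta <= f0 / 2].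
  have e1 : 0 <= k * b * eta by rewrite !mulr_ge0 // ltW.
  have e2 : 0 <= (1 + C1) * b * A * eta by rewrite mulr_ge0 // ltW.
  have e3 : 0 <= (1 + C1) * b * A * eta / f0 by rewrite divr_ge0 // ltW.
  have e4 : 16 * eta + 16 * (k * b * eta) + 2 * ((1 + C1) * b * A * eta / f0) = 1.
    by rewrite -[RHS]Deta /D; clearbody eta; field; rewrite gt_eqF.
  split; [lra|lra|].
  by rewrite [f0 / 2]mulrC -ler_pdivrMr //; lra.
have AE : A = 2 + 8 * (k * nv) by [].
clear D2 D0 Deta; clearbody eta; clear D; clearbody A.
have [d d0 hd] := tangent_approx HH eta0.
pose tau := Num.min d 128^-1.
have tau0 : 0 < tau by rewrite lt_min d0 invr_gt0 /=.
have taud : tau <= d by rewrite ge_min lexx.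
have tau1 : tau <= 128^-1 by rewrite ge_min lexx orbT.
clearbody tau.
have [dO dO0 hO] := O (tau / 2) (divr_gt0 tau0 (ltr0Sn _ 1)).
have [t [t0 t1 t2 t3]] : exists t, [/\ 0 < t, t < dO, t < tau / 2 & t < (64 * (k * nv + 1))^-1].
  apply: (@filter_ex _ (0 : R)^'+); near=> t; split; near: t.
  - exact: nbhs_right_gt.
  - exact: nbhs_right_lt.
  - by apply: nbhs_right_lt; rewrite divr_gt0.
  - by apply: nbhs_right_lt; rewrite invr_gt0 mulr_gt0 //; lra.
have {}t3 : 64 * (k * nv * t) < 1.
  have : t * (64 * (k * nv + 1)) < 1 by rewrite -ltr_pdivlMr ?div1r // mulr_gt0 //; lra.
  by move: t0; lra.
have [g [Hg gs yg gmin]] := near_optimal t0 (hO t t0 t1).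
have s0 := opnorm_ge0 (g - 1); set s := opnorm (g - 1) in gs gmin s0.
have [||X hX gX] := hd g => //; first by rewrite -/s; lra.
rewrite -/s in gX.
have etas : eta * s <= s / 16 by rewrite mulrC ler_wpM2l.
have yX : `|t *: v - y *m X| <= b * (eta * s).
  have -> : t *: v - y *m X = y *m (g - 1 - X).
    by rewrite !(mulmxDr, mulmxN, mulmx1) yg; zmodule.
  by apply: le_trans (norm_mulmx_opnorm _ _) _; rewrite ler_wpM2l.
have yXt : `|y *m X| <= nv * t + b * (eta * s).
  rewrite -[y *m X](subKr (t *: v)); apply: le_trans (ler_normB _ _) _.
  by rewrite normrZ gtr0_norm // mulrC lerD2l.
have [X1 hX1 [yX1 nX1]] := hk X hX.
have X1b : opnorm X1 <= k * nv * t + s / 16.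
  apply: le_trans nX1 _; have : k * `|y *m X| <= k * (nv * t + b * (eta * s)) by rewrite ler_wpM2l.
  have : k * b * eta * s <= 16^-1 * s by rewrite ler_wpM2r.
  clear; lra.
have hX0 : h (X - X1) by apply: tangentD => //; apply: tangent_opp.
have nX' : opnorm X <= s + s / 16.
  rewrite -[X](subKr (g - 1)); apply: le_trans (opnormB _ _) _; rewrite -/s.
  by move: gX etas; clear; lra.
have X0b : opnorm (X - X1) <= 2 * s + k * nv * t.
  by apply: le_trans (opnormB _ _) _; move: nX' X1b s0; clear; lra.
have X0c : opnorm (X - X1) <= 32^-1 by move: X0b gs t2 t3 tau1; clear; lra.
have X00 := opnorm_ge0 (X - X1).
have X0s : opnorm (X - X1) ^+ 2 <= s / 16 + k * nv * t / 32.
  by move: X0b X0c X00; clear; nra.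
have [|e He [eX ey]] := tangent_exp HH hX0; first lra.
have {}ey : y *m e = y by apply: ey; rewrite mulmxBr yX1 subrr.
clear yXt nX1 nX' X0b gs t1 t2 t3 eta1 eta2 dO0 d0 tau0 taud tau1.
have eU := HU He.
have ey' : y *m invmx e = y by rewrite -{1}ey -mulmxA mulmxV // mulmx1.
have e1 : opnorm (e - 1) <= 16^-1.
  rewrite -[e - 1](subrK (X - X1)); apply: le_trans (opnormD _ _) _.
  by move: eX X0c X00; nra.
have [|e2 _] := opnorm_invmx eU; first lra.
have ge : opnorm (g - e) <= 3 * (s / 16) + 2 * (k * nv * t).
  have -> : g - e = (g - 1 - X) + (X1 - (e - 1 - (X - X1))) by zmodule.
  apply: le_trans (opnormD _ _) _; have := opnormB X1 (e - 1 - (X - X1)).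
  by move: (mulr_ge0 knv0 (ltW t0)) gX etas X1b eX X0s s0; lra.
have ge0 := opnorm_ge0 (g - e).
have g'b : opnorm (invmx e * g - 1) <= 2 * opnorm (g - e).
  have -> : invmx e * g - 1 = (invmx e - 1) * (g - e) + (g - e).
    rewrite !mulrBr !mulrBl !mul1r (_ : invmx e * e = 1); last exact: mulVmx.
    zmodule.
  apply: le_trans (opnormD _ _) _; have := opnormM (invmx e - 1) (g - e).
  have : opnorm (invmx e - 1) * opnorm (g - e) <= 1 * opnorm (g - e).
    by rewrite ler_wpM2r //; move: e1 e2; lra.
  lra.
have := gmin (invmx e * g) (HM (HV He) Hg).
rewrite -[invmx e * g]/(_ *m _) mulmxA ey' => /(_ yg).
rewrite -[invmx e *m g]/(_ * _) => gm.
(* Minimality against the competitor [invmx e * g]. *)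
have sA : s <= A * t by rewrite AE; move: gm g'b ge t0 s0 (mulr_ge0 knv0 (ltW t0)); lra.
(* Removing the projection on [E] from [t *: v - y *m X] erases [y *m X] and leaves [t] times a
   vector of norm [f0]. *)
have : f0 * t <= (1 + C1) * (b * (eta * s)).
  have -> : f0 * t = `|(t *: v - y *m X) - projv E (t *: v - y *m X)|.
    rewrite linearB linearZ /= (@projv_id _ _ _ (y *m X)); last by apply/EP; exists X.
    rewrite opprB addrA subrK -scalerBr normrZ gtr0_norm // mulrC //.
  apply: le_trans (ler_normB _ _) _; have := hC1 (t *: v - y *m X).
  have : C1 * `|t *: v - y *m X| <= C1 * (b * (eta * s)) by rewrite ler_wpM2l.
  by move: yX; lra.
have : (1 + C1) * b * eta * s <= (1 + C1) * b * eta * (A * t).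
  by rewrite ler_wpM2l // !mulr_ge0 ?(ltW eta0) // addr_ge0.
have : (1 + C1) * b * A * eta * t <= f0 / 2 * t by rewrite ler_wpM2r // ltW.
have := mulr_gt0 f00 t0.
lra.
Unshelve. all: by end_near. Qed.

End TangentOnto.

(** * Deck transformations and affine lifts *)

HB.instance Definition _ (R : realType) m n := Complete.on 'M[R]_(m, n).

(** The encoding by [pickle] turns the cover into a sequence of open complements, with [setT] at the
    codes of no index. *)
Lemma baire_countable (R : realType) (V : completeNormedModType R) (J : countType)
    (F : J -> set V) :
  (forall i, closed (F i)) -> (forall x, exists i, F i x) ->
  exists i x, exists2 e : R, 0 < e & ball x e `<=` F i.
Proof.
move=> cF covF; apply: contrapT => nF.
pose O k : set V := if unpickle k is Some i then ~` F i else setT.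
have [] := @Baire R V O _ setT _ openT; last 2 first.
- by exists 0.
- move=> x [_ Ox]; have [i Fi] := covF x.
  by have := Ox (pickle i) I; rewrite /O pickleK.
move=> k; rewrite /O; case: unpickle => [i|]; last first.
  by split; [exact: openT|move=> D [x Dx] _; exists x].
split; first exact: closed_openC.
move=> D [x Dx] oD; apply: contrapT => nD; apply: nF.
have /nbhs_ballP[e e0 De] : nbhs x D by apply: open_nbhs_nbhs.
by exists i, x, e => // y /De Dy; apply: contrapT => nFy; apply: nD; exists y.
Qed.

(** Connectedness of the segment from [x0] to [x]. Openness is asked relative to [E] only, so that
    closed balls are allowed. *)
Lemma star_shaped_ind (R : realType) (V : normedModType R) (E P : set V) (x0 : V) :
  (forall x t, E x -> 0 <= t <= 1 -> E (x0 + t *: (x - x0))) -> E x0 -> P x0 ->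
  (forall x, E x -> P x -> \forall y \near x, E y -> P y) ->
  (forall x, E x -> ~ P x -> \forall y \near x, E y -> ~ P y) ->
  forall x, E x -> P x.
Proof.
move=> star E0 P0 oP oN x Ex.
pose f (t : R) := x0 + t *: (x - x0).
have cf : continuous f.
  by move=> t; apply: cvgD; [exact: cvg_cst|apply: cvgZr_tmp; exact: cvg_id].
pose S := [set` `[(0 : R), 1]].
have Ef t : S t -> E (f t) by rewrite /S /= in_itv /= => /(star _ _ Ex).
pose B := S `&` f @^-1` P.
suff BE : B = S.
  have : B 1 by rewrite BE /S /= in_itv /= ler01 lexx.
  by case=> _; rewrite /= /f scale1r addrC subrK.
apply: (@segment_connected R 0 1).
- exists 0; split; first by rewrite /S /= in_itv /= lexx ler01.
  by rewrite /preimage /= (_ : f 0 = x0) // /f scale0r addr0.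
- exists ([set t | S t -> P (f t)]°); first exact: open_interior.
  rewrite eqEsubset; split=> t [It Pt]; split=> //; last exact: (nbhs_singleton Pt It).
  have nQ := cf t _ (oP _ (Ef _ It) Pt).
  by apply: (@filterS _ (nbhs t) _ _ _ _ nQ) => s /= Q /[dup] /Ef Es _; exact: Q.
- exists (~` [set t | S t -> ~ P (f t)]°); first exact/open_closedC/open_interior.
  rewrite eqEsubset; split=> t [It Pt]; split=> //.
    by move=> /nbhs_singleton /(_ It).
  apply: contrapT => nP; apply: Pt; have nQ := cf t _ (oN _ (Ef _ It) nP).
  by apply: (@filterS _ (nbhs t) _ _ _ _ nQ) => s /= Q /[dup] /Ef Es _; exact: Q.
Qed.

Lemma nbhs_norm_lt (R : realType) (V : normedModType R) (x : V) (A : set V) :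
  nbhs x A -> exists2 d : R, 0 < d & forall y, `|x - y| < d -> A y.
Proof.
move=> /nbhs_ballP[d /= d0 dA]; exists d => // y xy; apply: dA.
by rewrite -ball_normE.
Qed.

Lemma near_norm_lt (R : realType) (V : normedModType R) (x : V) (d : R) :
  0 < d -> \forall y \near x, `|x - y| < d.
Proof. by move=> d0; have := nbhsx_ballx x d d0; rewrite -ball_normE. Qed.

Lemma open_norm_lt (R : realType) n (r : R) : open [set x : 'rV[R]_n | `|x| < r].
Proof.
have -> : [set x : 'rV[R]_n | `|x| < r] = Num.norm @^-1` [set x | x < r] by [].
by apply: open_comp => [v _|]; [exact: norm_continuous|exact: (@open_lt R r)].
Qed.

Section Deck.
Variables (R : realType) (n : nat) (G : set ('rV[R]_n -> 'rV[R]_n)).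
Variables (M : topologicalType) (p : 'rV[R]_n -> M).
Hypothesis hM : aspherical_manifold G p.
Local Notation E := 'rV[R]_n.

Lemma deck_comp g k : G g -> G k -> G (g \o k).
Proof. by case: hM => -[_ _ + _] _ _ _ _; apply. Qed.

Lemma deck_inv g : G g -> exists2 k, G k & cancel g k /\ cancel k g.
Proof. by case: hM => -[_ _ _ +] _ _ _ _; apply. Qed.

Lemma deck_continuous g : G g -> continuous g.
Proof. by case: hM => -[+ _ _ _] _ _ _ _ Gg => /(_ g Gg)[]. Qed.

Lemma deck_proj g x : G g -> p (g x) = p x.
Proof.
move=> Gg; case: hM => _ _ _ [_ pG _] _.
by apply/esym/pG; exists g.
Qed.

Lemma proj_deck x y : p x = p y -> exists2 g, G g & g x = y.
Proof. by case: hM => _ _ _ [_ pG _] _ /pG. Qed.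

Lemma proj_surj m : exists x, p x = m.
Proof. by case: hM => _ _ _ [+ _ _] _; apply. Qed.

Lemma deck_eq g k x : G g -> G k -> g x = k x -> g = k.
Proof.
move=> Gg Gk gk; have [k' Gk' [kK k'K]] := deck_inv Gk.
have [_ free _ _ _] := hM.
have := free x (k' \o g) (deck_comp Gk' Gg); rewrite /= gk kK => /(_ erefl) e.
by apply/funext => y; have := congr1 (fun f => k (f y)) e; rewrite /= k'K.
Qed.

Lemma proj_open V : open V -> open (p @` V).
Proof.
move=> oV; have [_ _ _ [_ _ pO] _] := hM; apply/pO.
have -> : p @^-1` (p @` V) = \bigcup_(g in G) (g @^-1` V).
  rewrite eqEsubset; split=> [x [y Vy /esym /proj_deck[g Gg gx]]|x [g Gg Vx]].
    by exists g => //=; rewrite gx.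
  by exists (g x) => //; rewrite deck_proj.
apply: bigcup_open => g Gg; apply: open_comp => // x _; exact: deck_continuous.
Qed.

Lemma proj_continuous : continuous p.
Proof.
have [_ _ _ [_ _ pO] _] := hM.
by apply/continuousP => V /pO.
Qed.

Lemma wandering x : exists U : set E, [/\ open U, U x & forall g y, G g -> U y -> U (g y) -> g = id].
Proof.
have [_ _ pd _ _] := hM; have [U [oU Ux] hU] := pd x.
exists U; split=> // g y Gg Uy Ugy; apply: hU => //.
by exists (g y); split=> //; exists y.
Qed.

Lemma proj_locally_inj x : exists U : set E,
  [/\ open U, U x & forall y z, U y -> U z -> p y = p z -> y = z].
Proof.
have [U [oU Ux wU]] := wandering x; exists U; split=> // y z Uy Uz.
by move=> /proj_deck[g Gg gy]; rewrite -gy (wU g y) // gy.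
Qed.

(** Near each point [f] agrees with one deck transformation, by the wandering neighbourhoods;
    connectedness of the space makes it the same one everywhere. *)
Lemma deck_of_lift f : continuous f -> (forall x, p (f x) = p x) -> G f.
Proof.
move=> cf pf.
have loc (x : E) (g : E -> E) : G g -> f x = g x -> \forall y \near x, f y = g y.
  move=> Gg fg; have [U [oU Ux wU]] := wandering (f x).
  have nU : nbhs (f x) U by apply: open_nbhs_nbhs.
  have nU' : nbhs (g x) U by rewrite -fg.
  near=> y.
  have Uf : U (f y) by near: y; exact: (cf x U nU).
  have Ug : U (g y) by near: y; exact: (deck_continuous Gg nU').
  have [k Gk kf] := @proj_deck (f y) (g y) (etrans (pf y) (esym (deck_proj y Gg))).
  by rewrite -kf (wU k (f y)) // kf.
have [g0 G0 fg0] := proj_deck (esym (pf 0)).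
suff -> : f = g0 by [].
apply/funext => x; apply: (@star_shaped_ind _ _ setT [set x | f x = g0 x] 0) => //.
- move=> y _ /loc fy; by apply: filterS (fy G0).
- move=> y _ nfy; have [g Gg fg] := proj_deck (esym (pf y)).
  apply: filterS (loc y g Gg (esym fg)) => z fz _ fz0.
  by apply: nfy; rewrite /= -fg (@deck_eq g g0 z) // -fz fz0.
Unshelve. all: by end_near. Qed.

Hypothesis hcompact : compact [set: M].

(** The projections of the balls centred at 0 are open and cover the compact [M]. *)
Lemma fundamental_ball : exists2 r : R, 0 < r & forall x, exists2 g, G g & `|g x| < r.
Proof.
have /compact_near_coveringP cc := hcompact.
pose B (k : nat) := [set x : E | `|x| < k%:R].
have [k _ hk] : \forall k \near \oo, [set: M] `<=` (fun m => (p @` B k) m).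
  apply: cc => m _; have [x <-] := proj_surj m.
  exists (p @` B (Num.truncn `|x|).+1, [set k | (Num.truncn `|x|).+1 <= k]%N).
    split=> /=; last by exists (Num.truncn `|x|).+1.
    apply: open_nbhs_nbhs; split; last by exists x => //; exact: truncnS_gt.
    by apply: proj_open; exact: open_norm_lt.
  move=> [_ k] /= [[y yB <-] xk]; exists y => //.
  by apply: lt_le_trans yB _; rewrite ler_nat.
exists k.+1%:R => // x.
have [y yB /esym /proj_deck[g Gg gx]] := hk k (leqnn k) (p x) I.
by exists g => //; rewrite gx (lt_trans yB) // ltr_nat.
Qed.

(** The points that some deck transformation in [C] sends into the ball form an open set. Its
    complement is open too, because two elements of [G] that send a common point into the ball
    differ by an element which brings a point of the ball back to the ball. *)
Lemma deck_generation (C : set (E -> E)) r :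
  (forall x, exists2 g, G g & `|g x| < r) -> 0 < r ->
  C id -> (forall g k, C g -> C k -> C (g \o k)) ->
  (forall g k, C g -> cancel g k -> cancel k g -> C k) ->
  (forall g x, G g -> `|x| < r -> `|g x| < r -> C g) ->
  forall g, G g -> C g.
Proof.
move=> hr r0 C1 CM CV CS.
have oB g : G g -> forall x, `|g x| < r -> \forall y \near x, `|g y| < r.
  move=> Gg x gx; have : \forall z \near g x, `|z| < r.
    by apply: open_nbhs_nbhs; split; first exact: open_norm_lt.
  exact: deck_continuous Gg x _.
have CP g k x : G g -> C k -> G k -> `|g x| < r -> `|k x| < r -> C g.
  move=> Gg Ck Gk gx kx; have [k' Gk' [kK k'K]] := deck_inv Gk.
  have : C (g \o k') by apply: (CS _ (k x)) => //=; [exact: deck_comp|rewrite kK].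
  move=> /(CM _ k)/(_ Ck); suff -> : (g \o k') \o k = g by [].
  by apply/funext => z /=; rewrite kK.
pose P x := exists2 g, G g /\ C g & `|g x| < r.
have PT x : P x.
  apply: (@star_shaped_ind _ _ setT P 0) => //.
  - by exists id; rewrite /= ?normr0 //; split=> //; case: hM => -[].
  - move=> y _ [g [Gg Cg] gy]; apply: filterS (oB g Gg y gy) => z gz _.
    by exists g.
  - move=> y _ nPy; have [g Gg gy] := hr y.
    apply: filterS (oB g Gg y gy) => z gz _ [k [Gk Ck] kz]; apply: nPy.
    by exists g => //; split=> //; apply: (CP g k z).
move=> g Gg; have [g' Gg' [gK g'K]] := deck_inv Gg.
have [k [Gk Ck] kg] := PT (g 0).
suff Cg' : C g' by apply: CV Cg' g'K gK.
by apply: (CP g' k (g 0)) => //; rewrite gK normr0.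
Qed.

End Deck.

(** * Affine maps as block matrices acting on rows with leading entry 1 *)

Section Affine.
Variables (R : realType) (n : nat).
Implicit Types (g : 'M[R]_(1 + n)) (x : 'rV[R]_n).

Definition hat x : 'rV[R]_(1 + n) := row_mx 1 x.
Definition act g x : 'rV[R]_n := rsubmx (hat x *m g).
Definition affine_matrix g := exists A b, g = block_mx 1 b 0 A.

Lemma act_block A b x : act (block_mx 1 b 0 A) x = b + x *m A.
Proof. by rewrite /act /hat mul_row_block row_mxKr mul1mx. Qed.

Lemma hat_act g x : affine_matrix g -> hat x *m g = hat (act g x).
Proof.
move=> [A [b ->]]; rewrite act_block /hat mul_row_block.
by rewrite mulmx0 addr0 !mul1mx.
Qed.

Lemma hat_inj : injective hat.
Proof. by move=> x y /eq_row_mx[]. Qed.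

Lemma hatB x y : hat x - hat y = row_mx 0 (x - y).
Proof. by rewrite /hat opp_row_mx add_row_mx subrr. Qed.

Lemma act_mul g g' x : affine_matrix g -> act (g * g') x = act g' (act g x).
Proof. by move=> ag; rewrite /act -[g * g']/(g *m g') mulmxA -hat_act. Qed.

Lemma act1 x : act 1 x = x.
Proof. by rewrite /act mulmx1 row_mxKr. Qed.

Lemma affine_matrix1 : affine_matrix 1.
Proof. by exists 1, 0; rewrite -scalar_mx_block. Qed.

Lemma affine_matrix_mul g g' : affine_matrix g -> affine_matrix g' -> affine_matrix (g * g').
Proof.
move=> [A [b ->]] [A' [b' ->]]; exists (A *m A'), (b' + b *m A').
by rewrite -[LHS]/(_ *m _) mulmx_block !mul1mx !mul0mx !mulmx0 !addr0 add0r.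
Qed.

Lemma affine_matrix_unit A (b : 'rV[R]_n) :
  (block_mx (1 : 'M[R]_1) b 0 A \in unitmx) = (A \in unitmx).
Proof. by rewrite !unitmxE det_ublock det1 mul1r. Qed.

Lemma affine_matrix_inv g : affine_matrix g -> g \in unitmx -> affine_matrix (invmx g).
Proof.
move=> [A [b ->]]; rewrite affine_matrix_unit => uA.
exists (invmx A), (- b *m invmx A).
have gV : block_mx (1 : 'M[R]_1) b 0 A *m block_mx 1 (- b *m invmx A) 0 (invmx A) = 1.
  rewrite mulmx_block !mul1mx !mul0mx !mulmx0 !addr0 add0r mulmxV // mulNmx addNr.
  by rewrite -scalar_mx_block.
have uB : block_mx (1 : 'M[R]_1) b 0 A \in unitmx by rewrite affine_matrix_unit.
by have := mulKmx uB (block_mx 1 (- b *m invmx A) 0 (invmx A)); rewrite gV mulmx1.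
Qed.

Lemma actK g : affine_matrix g -> g \in unitmx -> cancel (act g) (act (invmx g)).
Proof. by move=> ag ug x; rewrite -act_mul // -[g * _]/(g *m _) mulmxV // act1. Qed.

Lemma actVK g : affine_matrix g -> g \in unitmx -> cancel (act (invmx g)) (act g).
Proof.
move=> ag ug x; rewrite -act_mul; last exact: affine_matrix_inv.
by rewrite -[invmx g * g]/(invmx g *m g) mulVmx // act1.
Qed.

Lemma norm_rsubmx m k l (v : 'M[R]_(m, k + l)) : `|rsubmx v| <= `|v|.
Proof. by apply: ler_norm_coord => // i j; rewrite mxE; apply: ler_coord_norm. Qed.

Lemma norm_lsubmx m k l (v : 'M[R]_(m, k + l)) : `|lsubmx v| <= `|v|.
Proof. by apply: ler_norm_coord => // i j; rewrite mxE; apply: ler_coord_norm. Qed.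

Lemma affine_matrixE g : affine_matrix g <-> lsubmx g = lsubmx (1 : 'M[R]_(1 + n)).
Proof.
have l1 A (b : 'rV[R]_n) : lsubmx (block_mx 1 b 0 A) = col_mx 1 0.
  by rewrite block_mxEh row_mxKl.
have e1 : lsubmx (1 : 'M[R]_(1 + n)) = col_mx 1 0.
  have -> : (1 : 'M[R]_(1 + n)) = block_mx 1 0 0 1 by exact: scalar_mx_block.
  exact: l1.
rewrite e1; split=> [[A [b ->]]|gl]; first exact: l1.
exists (dsubmx (rsubmx g)), (usubmx (rsubmx g)).
by rewrite block_mxEh vsubmxK -gl hsubmxK.
Qed.

Lemma act_near g g' x : `|act g x - act g' x| <= `|hat x| * opnorm (g - g').
Proof.
rewrite /act -linearB /= -mulmxBr; apply: le_trans (norm_rsubmx _) _.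
exact: norm_mulmx_opnorm.
Qed.

Lemma act_near1 g x : `|act g x - x| <= `|hat x| * opnorm (g - 1).
Proof. by rewrite -{2}[x]act1; apply: act_near. Qed.

Lemma act_sub g x y : affine_matrix g -> `|act g x - act g y| <= opnorm g * `|x - y|.
Proof.
move=> ag; rewrite -norm_row_mx0 -hatB -!hat_act // -mulmxBl hatB -[`|x - y|]norm_row_mx0.
by rewrite mulrC; exact: norm_mulmx_opnorm.
Qed.

Lemma act_continuous g : affine_matrix g -> continuous (act g).
Proof.
move=> ag x; apply/(@cvgrPdist_lt _ _ _ (nbhs x)) => e e0.
have D0 : 0 < opnorm g + 1 by have := opnorm_ge0 g; lra.
have h : 0 < e / (opnorm g + 1) by rewrite divr_gt0.
near=> y; apply: le_lt_trans (act_sub _ _ ag) _.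
have : `|x - y| < e / (opnorm g + 1).
  by near: y; exact: (@near_norm_lt R 'rV[R]_n x _ h).
rewrite ltr_pdivlMr // => h1; apply: le_lt_trans h1.
by rewrite mulrDr mulr1 mulrC lerDl.
Unshelve. all: by end_near. Qed.

End Affine.

Lemma rational_mx_dense (R : realType) m k (g : 'M[R]_(m, k)) e : 0 < e ->
  exists q : 'M[rat]_(m, k), `|g - map_mx ratr q| < e.
Proof.
move=> e0; have e20 : 0 < e / 2 by lra.
have /choice[q hq] : forall ij : 'I_m * 'I_k, exists q : rat, `|g ij.1 ij.2 - ratr q| < e / 2.
  move=> ij; have /rat_in_itvoo[q] : g ij.1 ij.2 < g ij.1 ij.2 + e / 2 by lra.
  by rewrite in_itv /= => /andP[q1 q2]; exists q; rewrite ltr_norml; apply/andP; split; lra.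
exists (\matrix_(i, j) q (i, j)); apply: (@le_lt_trans _ _ (e / 2)); last by lra.
by apply: ler_norm_coord => [|i j]; rewrite ?mxE ltW // (hq (i, j)).
Qed.

Lemma lt_div_norm1 (R : realType) (V : normedModType R) (v : V) (a d : R) :
  0 <= a -> a < d / (`|v| + 1) -> `|v| * a < d.
Proof.
move=> a0; have v0 := normr_ge0 v.
by rewrite ltr_pdivlMr; [nra|lra].
Qed.

(** * Affine normaliser and centraliser of the deck group *)

Section Normalizer.
Variables (R : realType) (n : nat) (G : set ('rV[R]_n -> 'rV[R]_n)).
Variables (M : topologicalType) (p : 'rV[R]_n -> M).
Hypothesis hM : aspherical_manifold G p.
Local Notation E := 'rV[R]_n.
Implicit Types g : 'M[R]_(1 + n).

(** Both inclusions are required, since a conjugate of [G] contained in [G] could be smaller than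
    [G]. *)
Definition affine_normalizer : set 'M[R]_(1 + n) := [set g |
  [/\ affine_matrix g, g \in unitmx, forall k, G k -> G (act g \o k \o act (invmx g)) &
      forall k, G k -> G (act (invmx g) \o k \o act g)]].

Definition affine_centralizer : set 'M[R]_(1 + n) := [set g |
  [/\ affine_matrix g, g \in unitmx & forall k x, G k -> k (act g x) = act g (k x)]].

Local Notation N := affine_normalizer.
Local Notation H := affine_centralizer.

Lemma normalizer_inv g : N g -> N (invmx g).
Proof.
move=> [ag ug N1 N2]; split; rewrite ?unitmx_inv ?invmxK //.
exact: affine_matrix_inv.
Qed.

Lemma normalizer_mul g g' : N g -> N g' -> N (g * g').
Proof.
move=> [ag ug N1 N2] [ag' ug' N1' N2'].
have agg : affine_matrix (g * g') by exact: affine_matrix_mul.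
have ugg : g * g' \in unitmx by rewrite -[g * g']/(g *m g') unitmx_mul ug.
have VE x : act (invmx (g * g')) x = act (invmx g) (act (invmx g') x).
  apply: (can_inj (actK agg ugg)); rewrite actVK // act_mul //.
  by rewrite !actVK.
split=> // k Gk.
  have := N1' _ (N1 _ Gk); congr G; apply/funext => x /=.
  by rewrite VE act_mul.
have := N2 _ (N2' _ Gk); congr G; apply/funext => x /=.
by rewrite VE act_mul.
Qed.

Lemma normalizer1 : N 1.
Proof.
split; [exact: affine_matrix1|exact: unitmx1| |] => k Gk;
  rewrite (_ : _ \o _ = k) //; apply/funext => x /=;
  by rewrite invmx1 !act1.
Qed.

(** The conjugate of [k] by [g] is a deck transformation that sends [act g 0] to [act g (k 0)]. For
    [g] close to 1 this point and [k (act g 0)] lie in a set where [p] is injective, and they have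
    the same projection; so the conjugate is [k]. *)
Lemma commute_near k : G k -> exists2 e, 0 < e &
  forall g, N g -> opnorm (g - 1) < e -> forall x, k (act g x) = act g (k x).
Proof.
move=> Gk; have [U [oU Uk iU]] := proj_locally_inj hM (k 0).
have nU : nbhs (k 0) U by exact: open_nbhs_nbhs.
have [d1 d10 hd1] := nbhs_norm_lt nU.
have [d2 d20 hd2] := nbhs_norm_lt (deck_continuous hM Gk nU).
exists (Num.min (d1 / (`|hat (k 0)| + 1)) (d2 / (`|hat (0 : E)| + 1))).
  by rewrite lt_min !divr_gt0 // ltr_wpDl.
move=> g [ag ug /(_ k Gk) Ng _]; rewrite lt_min => /andP[g1 g2].
have U1 : U (act g (k 0)).
  apply: hd1; rewrite distrC; apply: le_lt_trans (act_near1 _ _) _.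
  by apply: lt_div_norm1 g1; exact: opnorm_ge0.
have U2 : U (k (act g 0)).
  apply: hd2; rewrite distrC; apply: le_lt_trans (act_near1 _ _) _.
  by apply: lt_div_norm1 g2; exact: opnorm_ge0.
have e0 : act g (k 0) = k (act g 0).
  apply: iU => //; rewrite (deck_proj hM _ Gk).
  by rewrite -(deck_proj hM (act g 0) Ng) /= actK.
have e1 : act g \o k \o act (invmx g) = k.
  by apply: (@deck_eq _ _ _ _ _ hM _ _ (act g 0)) => //=; rewrite actK.
by move=> x; rewrite -{1}e1 /= actK.
Qed.

Lemma lim_affine_matrix g :
  (forall e, 0 < e -> exists2 g', affine_matrix g' & opnorm (g' - g) < e) -> affine_matrix g.
Proof.
move=> hg; apply/affine_matrixE/eqP; rewrite -subr_eq0 -normr_le0.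
apply/ler_addgt0Pr => e e0; have [g' /affine_matrixE <- gg'] := hg e e0.
rewrite add0r -linearB /=; apply: le_trans (norm_lsubmx _) _.
by rewrite distrC (le_trans (norm_le_opnorm _)) // ltW.
Qed.

Lemma centralizer_closed_group : closed_matrix_group H.
Proof.
split.
- by split; [exact: affine_matrix1|exact: unitmx1|move=> k x _; rewrite !act1].
- move=> g g' [ag ug cg] [ag' ug' cg']; split; first exact: affine_matrix_mul.
    by rewrite -[g * g']/(g *m g') unitmx_mul ug.
  by move=> k x Gk; rewrite !act_mul // cg' // cg.
- move=> g [ag ug cg]; split=> //; split; rewrite ?unitmx_inv //.
    exact: affine_matrix_inv.
  by move=> k x Gk; rewrite -{2}[x](actVK ag ug) cg // actK.
move=> g ug hg.
have ag : affine_matrix g.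
  by apply: lim_affine_matrix => e /hg[g' [ag' _ _] h]; exists g'.
split=> // k x Gk; apply/eqP; rewrite -subr_eq0 -normr_le0.
apply/ler_addgt0Pr => d d0; rewrite add0r.
have [e e0 he] := nbhs_norm_lt (deck_continuous hM Gk (near_norm_lt (k (act g x)) (divr_gt0 d0 (ltr0Sn _ 1)))).
have [|g' [ag' ug' cg']] := hg (Num.min (e / (`|hat x| + 1)) (d / 2 / (`|hat (k x)| + 1))).
  by rewrite lt_min !divr_gt0 // ltr_wpDl.
rewrite lt_min => /andP[g1 g2].
have h1 : `|k (act g x) - k (act g' x)| < d / 2.
  apply: he; rewrite distrC; apply: le_lt_trans (act_near _ _ _) _.
  by apply: lt_div_norm1 g1; exact: opnorm_ge0.
have h2 : `|act g' (k x) - act g (k x)| < d / 2.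
  by apply: le_lt_trans (act_near _ _ _) _; apply: lt_div_norm1 g2; exact: opnorm_ge0.
have := ler_distD (k (act g' x)) (k (act g x)) (act g (k x)).
rewrite -(cg' _ x Gk) in h2; lra.
Qed.

Lemma cluster_proj (x y : nat -> E) (X : 'rV_(n + n)) :
  (forall k, p (x k) = p (y k)) ->
  (forall e, 0 < e -> forall K, exists2 k, (K <= k)%N & `|row_mx (x k) (y k) - X| < e) ->
  p (lsubmx X) = p (rsubmx X).
Proof.
move=> pxy hX; have [_ _ _ _ [hausM _ _]] := hM; apply: hausM => A B nA nB.
have [d1 d10 hd1] := nbhs_norm_lt (proj_continuous hM nA).
have [d2 d20 hd2] := nbhs_norm_lt (proj_continuous hM nB).
have [|k _] := hX (Num.min d1 d2) _ 0%N; first by rewrite lt_min d10.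
rewrite lt_min distrC => /andP[k1 k2]; exists (p (x k)); split.
  apply: hd1; rewrite -[x k](row_mxKl _ (y k)) -linearB.
  exact: le_lt_trans (norm_lsubmx _) k1.
rewrite pxy; apply: hd2; rewrite -[y k](row_mxKr (x k)) -linearB.
exact: le_lt_trans (norm_rsubmx _) k2.
Qed.

Hypothesis hcompact : compact [set: M].

(** One bound for all of [G]. By [deck_generation] it suffices to commute with the elements that
    bring a point of a fundamental ball back to it. If this failed along a sequence tending to 1,
    the points and their images would accumulate, proper discontinuity would make a fixed deck
    transformation [f] recur, and [commute_near] applies to [f]. *)
Lemma normalizer_near1 : exists2 e, 0 < e & forall g, N g -> opnorm (g - 1) < e -> H g.
Proof.
have [r r0 hr] := fundamental_ball hM hcompact.
apply: contrapT => nh.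
have /choice[z hz] : forall k, exists z : 'M[R]_(1 + n) * ((E -> E) * E),
    [/\ N z.1, opnorm (z.1 - 1) < k.+1%:R^-1, G z.2.1 /\ `|z.2.2| < r, `|z.2.1 z.2.2| < r &
        ~ forall x, z.2.1 (act z.1 x) = act z.1 (z.2.1 x)].
  move=> k; apply: contrapT => nz; apply: nh; exists k.+1%:R^-1; first by rewrite invr_gt0.
  move=> g Ng gk; have [ag ug _ _] := Ng; split=> //.
  suff : forall k0, G k0 -> forall x, k0 (act g x) = act g (k0 x) by move=> h k0 x /h.
  apply: (deck_generation hM hr r0) => //.
  - by move=> f f' hf hf' x /=; rewrite hf' hf.
  - by move=> f f' hf fK f'K x; rewrite -{1}[x]f'K -hf fK.
  move=> f x Gf xr fxr; apply: contrapT => nf; apply: nz.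
  by exists (g, (f, x)).
pose x k := (z k).2.2; pose y k := (z k).2.1 (x k).
have [|X hX] := @bounded_rowseq_cluster R _ (fun k => row_mx (x k) (y k)) r.
  move=> k; have [_ _ [_ xr] yr _] := hz k.
  apply: ler_norm_coord => [|i j]; first exact: ltW.
  case: (split_ordP j) => l ->; rewrite ?row_mxEl ?row_mxEr;
    apply: le_trans (ler_coord_norm _ _ _) _; exact: ltW.
have pxy k : p (x k) = p (y k) by have [_ _ [Gz _] _ _] := hz k; rewrite /y (deck_proj hM).
have [f Gf fX] := proj_deck hM (cluster_proj pxy hX).
have [f' Gf' [fK f'K]] := deck_inv hM Gf.
have [U [oU UX wU]] := wandering hM (lsubmx X).
have [d1 d10 hd1] := nbhs_norm_lt (open_nbhs_nbhs (conj oU UX)).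
have nU2 : nbhs (f' (rsubmx X)) U by rewrite -fX fK; exact: open_nbhs_nbhs.
have [d2 d20 hd2] := nbhs_norm_lt (deck_continuous hM Gf' nU2).
have [e e0 he] := commute_near Gf; have [K hK] := invr_nat_lt e0.
have [|k Kk] := hX (Num.min d1 d2) _ K; first by rewrite lt_min d10.
rewrite lt_min distrC => /andP[k1 k2].
have [Nz zk [Gz _] _ nz] := hz k; apply: nz.
suff -> : (z k).2.1 = f by apply: he => //; apply: lt_trans zk (hK _ Kk).
have Ux : U (x k).
  apply: hd1; rewrite -[x k](row_mxKl _ (y k)) -linearB.
  exact: le_lt_trans (norm_lsubmx _) k1.
have Uy : U (f' (y k)).
  apply: hd2; rewrite -[y k](row_mxKr (x k)) -linearB.
  exact: le_lt_trans (norm_rsubmx _) k2.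
have e1 := wU (f' \o (z k).2.1) (x k) (deck_comp hM Gf' Gz) Ux Uy.
apply/funext => w; have := congr1 (fun h => f (h w)) e1.
by rewrite /= f'K.
Qed.

Hypothesis htrans : acts_transitively (Aff0 p).

(** An affine lift of a homeomorphism of [M] conjugates [G] into itself in both directions, by
    [deck_of_lift]; [k] then adjusts the point above [p y]. *)
Lemma normalizer_transitive x y : exists g k, [/\ N g, G k & k (act g x) = y].
Proof.
have [f /connected_component_sub[[cf [f' [cf' fK f'K]]]]] := htrans (p x) (p y).
move=> [a [A [b [uA aE]]] [_ pa]] fxy.
pose g : 'M[R]_(1 + n) := block_mx 1 b 0 A.
have ag : affine_matrix g by exists A, b.
have ug : g \in unitmx by rewrite affine_matrix_unit.
have agE : act g = a by rewrite aE; apply/funext => z; rewrite act_block addrC.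
have pg z : p (act g z) = f (p z) by rewrite agE -[f (p z)]/((f \o p) z) -pa.
have pV z : p (act (invmx g) z) = f' (p z) by rewrite -{2}[z](actVK ag ug) pg fK.
have cg := act_continuous ag; have cV := act_continuous (affine_matrix_inv ag ug).
have pgx : p (act g x) = p y by rewrite pg.
have [k Gk kx] := proj_deck hM pgx.
exists g, k; split=> //; split=> // h Gh; apply: (deck_of_lift hM).
- move=> z; apply: continuous_comp; first exact: cV.
  by apply: continuous_comp; [exact: (deck_continuous hM Gh)|exact: cg].
- by move=> z /=; rewrite pg (deck_proj hM) // pV f'K.
- move=> z; apply: continuous_comp; first exact: cg.
  by apply: continuous_comp; [exact: (deck_continuous hM Gh)|exact: cV].
- by move=> z /=; rewrite pV (deck_proj hM) // pg fK.
Qed.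

End Normalizer.

(** * Open orbits of the centraliser *)

Section LocalOrbits.
Variables (R : realType) (n : nat) (G : set ('rV[R]_n -> 'rV[R]_n)).
Variables (M : topologicalType) (p : 'rV[R]_n -> M).
Hypothesis hM : aspherical_manifold G p.
Hypothesis hcompact : compact [set: M].
Hypothesis htrans : acts_transitively (Aff0 p).
Local Notation E := 'rV[R]_n.
Local Notation N := (affine_normalizer G).
Local Notation H := (affine_centralizer G).
Implicit Types g : 'M[R]_(1 + n).

Let HH : closed_matrix_group H. Proof. exact: centralizer_closed_group hM. Qed.

(** Bounded sequences of matrices cluster, and [e < 1] keeps the limits invertible. *)
Lemma small_orbit_closed (x : E) e : e < 1 ->
  closed [set act g x | g in [set g | H g /\ opnorm (g - 1) <= e]].
Proof.
move=> e1 y cy.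
have /choice[g hg] : forall k : nat, exists g, [/\ H g, opnorm (g - 1) <= e & `|y - act g x| < k.+1%:R^-1].
  move=> k; have k0 : 0 < k.+1%:R^-1 :> R by rewrite invr_gt0.
  by have [_ [[g [Hg ge] <-] h]] := cy _ (near_norm_lt y k0); exists g.
have [|X hX] := @opnorm_cluster R _ (fun k => g k - 1) e; first by move=> k; have [] := hg k.
have sm d : 0 < d -> exists k, opnorm (g k - (1 + X)) < d /\ k.+1%:R^-1 < d.
  move=> d0; have [K hK] := invr_nat_lt d0; have [k Kk gk] := hX d d0 K.
  by exists k; rewrite opprD addrA; split=> //; exact: hK.
have Xe : opnorm X <= e.
  apply/ler_addgt0Pr => d d0; have [k [gk _]] := sm d d0; have [_ ge _] := hg k.
  have -> : X = (g k - 1) - (g k - (1 + X)) by zmodule.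
  by apply: le_trans (opnormB _ _) _; lra.
have [_ _ _ cl] := HH; exists (1 + X).
  split; last by rewrite /= (_ : 1 + X - 1 = X) //; zmodule.
  apply: cl; first by apply: unitmx_near1; rewrite (_ : 1 + X - 1 = X); [lra|zmodule].
  by move=> d d0; have [k [gk _]] := sm d d0; have [Hg _ _] := hg k; exists (g k).
apply/eqP; rewrite eq_sym -subr_eq0 -normr_le0; apply/ler_addgt0Pr => d d0; rewrite add0r.
have x0 : 0 < `|hat x| + 1 by have := normr_ge0 (hat x); lra.
have [|k []] := sm (Num.min (d / 2 / (`|hat x| + 1)) (d / 2)).
  by rewrite lt_min !divr_gt0.
rewrite !lt_min => /andP[/lt_div_norm1 k1 _] /andP[_ k2]; have [_ _ gy] := hg k.
have := ler_distD (act (g k) x) y (act (1 + X) x).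
have := act_near (g k) (1 + X) x; have := k1 (opnorm_ge0 _); have := lt_trans gy k2; lra.
Qed.

(** [G] is countable: an element is determined by a rational point that it sends into a wandering
    neighbourhood of 0. The identity serves as default value. *)
Lemma deck_rational_choice : exists f : 'rV[rat]_n -> E -> E, (forall q, G (f q)) /\
  forall k, G k -> exists q, f q = k.
Proof.
have [U [oU U0 wU]] := wandering hM (0 : E).
have /choice[f hf] : forall q : 'rV[rat]_n, exists f : E -> E, G f /\
    forall k, G k -> U (k (map_mx ratr q)) -> k = f.
  move=> q; have [[f [Gf Uf]]|nf] := pselect (exists f, G f /\ U (f (map_mx ratr q))).
    exists f; split=> // k Gk Uk; have [f' Gf' [fK f'K]] := deck_inv hM Gf.
    have e1 := wU (k \o f') _ (deck_comp hM Gk Gf') Uf.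
    rewrite /= fK in e1; have {}e1 := e1 Uk.
    by apply/funext => w; have := congr1 (fun h => h (f w)) e1; rewrite /= fK.
  exists id; split=> [|k Gk Uk]; first by case: hM => -[].
  by case: nf; exists k.
exists f; split=> [q|k Gk]; first by have [] := hf q.
have [k' Gk' [kK k'K]] := deck_inv hM Gk.
have nU : nbhs (k (k' 0)) U by rewrite k'K; exact: open_nbhs_nbhs.
have [d d0 hd] := nbhs_norm_lt (deck_continuous hM Gk nU).
have [q hq] := rational_mx_dense (k' 0) d0.
by exists q; have [_ h] := hf q; rewrite -(h k Gk) //; exact: hd.
Qed.

(** A countable dense part of the normaliser: for each rational matrix and each precision, an
    element that close to the matrix if there is one, and 1 otherwise. *)
Lemma normalizer_rational_choice : exists f : 'M[rat]_(1 + n) * nat -> 'M[R]_(1 + n),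
  (forall j, N (f j)) /\ forall g e, N g -> 0 < e -> exists j, opnorm (f j - g) < e.
Proof.
have /choice[f hf] : forall j : 'M[rat]_(1 + n) * nat, exists g, N g /\
    forall g', N g' -> opnorm (g' - map_mx ratr j.1) < j.2.+1%:R^-1 ->
      opnorm (g - map_mx ratr j.1) < j.2.+1%:R^-1.
  move=> j; have [[g [Ng gj]]|ng] := pselect (exists g, N g /\ opnorm (g - map_mx ratr j.1) < j.2.+1%:R^-1).
    by exists g.
  exists 1; split=> [|g Ng gj]; first exact: normalizer1.
  by case: ng; exists g.
exists f; split=> [j|g e Ng e0]; first by have [] := hf j.
have e20 : 0 < e / 2 by lra.
have [K /(_ K (leqnn K)) Ke] := invr_nat_lt e20.
have [|q hq] := @rational_mx_dense R _ _ g (K.+1%:R^-1 / (1 + n)%:R).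
  by rewrite divr_gt0 ?invr_gt0.
have gq : opnorm (g - map_mx ratr q) < K.+1%:R^-1 by rewrite opnormE mulrC -ltr_pdivlMr.
exists (q, K); have [_ /(_ g Ng gq) fq] := hf (q, K); rewrite /= in fq.
have -> : f (q, K) - g = (f (q, K) - map_mx ratr q) - (g - map_mx ratr q) by zmodule.
apply: le_lt_trans (opnormB _ _) _; have := lt_trans fq Ke; have := lt_trans gq Ke; lra.
Qed.

(** Countably many preimages of the small closed orbit [K] cover the space: write [y = k (act g x)];
    then [g] differs from one of the dense elements by a normaliser element so close to 1 that it is
    in [H]. By Baire's theorem one of the preimages contains a ball, which is carried back to
    [K]. *)
Lemma small_orbit_interior (x : E) e : 0 < e -> e <= 2^-1 ->
  exists g d, [/\ H g, opnorm (g - 1) <= e, 0 < d & forall y, `|act g x - y| < d ->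
    exists g', [/\ H g', opnorm (g' - 1) <= e & act g' x = y]].
Proof.
move=> e0 e2; have [eN eN0 heN] := normalizer_near1 hM hcompact.
pose e1 := Num.min e (eN / 2).
have e10 : 0 < e1 by rewrite lt_min e0 divr_gt0.
have e1e : e1 <= e by rewrite ge_min lexx.
have e1N : e1 <= eN / 2 by rewrite ge_min lexx orbT.
pose K := [set act g x | g in [set g | H g /\ opnorm (g - 1) <= e1]].
have cK : closed K by apply: small_orbit_closed; lra.
have [fd [Gfd hfd]] := deck_rational_choice.
have [fn [Nfn hfn]] := normalizer_rational_choice.
pose T (j : 'rV[rat]_n * ('M[rat]_(1 + n) * nat)) := act (invmx (fn j.2)) \o fd j.1.
have cT j : continuous (T j).
  have [af uf _ _] := Nfn j.2.
  move=> z; apply: continuous_comp; first exact: (deck_continuous hM (Gfd j.1)).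
  exact/act_continuous/affine_matrix_inv.
have [|y|j [y0 [d d0 hd]]] := @baire_countable R E _ (fun j => T j @^-1` K).
- by move=> j; apply: closed_comp => // z _; exact: cT.
- have [g [k [Ng Gk kgx]]] := normalizer_transitive hM htrans x y.
  have [k' Gk' [kK k'K]] := deck_inv hM Gk; have [q fq] := hfd k' Gk'.
  have [ag ug _ _] := Ng.
  have C0 : 0 < opnorm (invmx g) + 1 by have := opnorm_ge0 (invmx g); lra.
  have [|i hi] := hfn g (e1 / 2 / (opnorm (invmx g) + 1)) Ng; first by rewrite !divr_gt0.
  have [af uf _ _] := Nfn i.
  have w1 : opnorm (fn i * invmx g - 1) <= e1 / 2.
    have -> : fn i * invmx g - 1 = (fn i - g) * invmx g.
      rewrite mulrBl; congr (_ - _); exact/esym/mulmxV.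
    apply: le_trans (opnormM _ _) _; have a0 := opnorm_ge0 (fn i - g).
    by move: hi; rewrite ltr_pdivlMr //; nra.
  have uw : fn i * invmx g \in unitmx.
    by rewrite -[fn i * invmx g]/(fn i *m invmx g) unitmx_mul uf unitmx_inv.
  have [|w2 _] := opnorm_invmx uw; first lra.
  have iw : invmx (fn i * invmx g) = g * invmx (fn i).
    have : (fn i * invmx g) *m (g * invmx (fn i)) = 1.
      rewrite -[fn i * invmx g]/(fn i *m invmx g) -[g * invmx (fn i)]/(g *m invmx (fn i)).
      by rewrite mulmxA mulmxKV // mulmxV.
    by move=> h; rewrite -[LHS]mulmx1 -[1%:M]h mulKmx.
  rewrite iw in w2.
  exists (q, i); exists (g * invmx (fn i)).
    split; last by lra.
    apply: heN; last by lra.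
    by apply: normalizer_mul => //; exact: normalizer_inv.
  by rewrite act_mul // /T /= fq -kgx kK.
have [af uf _ _] := Nfn j.2.
have [k Gk [fK kK]] := deck_inv hM (Gfd j.1).
have [g0 [Hg0 g0e] g0x] : K (T j y0) by apply: hd; exact: ballxx.
have nB : nbhs (k (act (fn j.2) (T j y0))) (ball y0 d).
  by rewrite /T /= actVK // fK; exact: nbhsx_ballx.
have ck : continuous (k \o act (fn j.2)).
  by move=> z; apply: continuous_comp; [exact: act_continuous|exact: (deck_continuous hM Gk)].
have [d' d'0 hd'] := nbhs_norm_lt (ck (T j y0) _ nB).
exists g0, d'; split=> //; first exact: le_trans g0e e1e.
rewrite g0x => y /hd' /= /hd [g [Hg ge] gx]; exists g; split=> //; first exact: le_trans ge e1e.
by rewrite gx /T /= kK actK.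
Qed.

(** Dividing by the [g0] of [small_orbit_interior] carries the interior point [act g0 x] of the
    small orbit back to [x]. *)
Lemma local_transitivity (x : E) e : 0 < e -> exists2 d, 0 < d &
  forall v, `|v| < d -> exists g, [/\ H g, opnorm (g - 1) < e & act g x = x + v].
Proof.
move=> e0; pose e1 := Num.min (e / 8) 2^-1.
have e10 : 0 < e1 by rewrite lt_min divr_gt0 //= invr_gt0.
have e12 : e1 <= 2^-1 by rewrite ge_min lexx orbT.
have e18 : e1 <= e / 8 by rewrite ge_min lexx.
have [g0 [d [Hg0 g0e d0 hd]]] := small_orbit_interior x e10 e12.
have C0 : 0 < opnorm g0 + 1 by have := opnorm_ge0 g0; lra.
have [ag0 ug0 _] := Hg0; exists (d / (opnorm g0 + 1)); first exact: divr_gt0.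
move=> v vd; have [|g [Hg ge gx]] := hd (act g0 (x + v)).
  apply: le_lt_trans (act_sub _ _ ag0) _; rewrite opprD addNKr normrN.
  by move: vd; rewrite ltr_pdivlMr //; have := normr_ge0 v; nra.
have [_ HM HV _] := HH; have [ag ug _] := Hg.
have [_ HV0] := HV _ Hg0.
exists (g * invmx g0); split; [exact: HM| |by rewrite act_mul // gx actK].
have -> : g * invmx g0 - 1 = (g - g0) * invmx g0.
  by rewrite mulrBl; congr (_ - _); exact/esym/mulmxV.
have -> : (g - g0) * invmx g0 = (g - g0) * (invmx g0 - 1) + (g - g0) by rewrite mulrBr mulr1 subrK.
have [|h1 _] := opnorm_invmx ug0; first lra.
have h2 : opnorm (g - g0) <= 2 * e1.
  have -> : g - g0 = (g - 1) - (g0 - 1) by zmodule.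
  by apply: le_trans (opnormB _ _) _; lra.
apply: le_lt_trans (opnormD _ _) _.
have := opnormM (g - g0) (invmx g0 - 1).
have : opnorm (g - g0) * opnorm (invmx g0 - 1) <= (2 * e1) * 1 by rewrite ler_pM ?opnorm_ge0 //; lra.
lra.
Qed.

(** * Affine fields tangent to the centraliser *)

Definition tangent_fields (A : 'M[R]_n) (b : 'rV[R]_n) := tangent H (block_mx 0 b 0 A).

Lemma tangent_affine X : tangent H X -> exists A b, X = block_mx 0 b 0 A.
Proof.
move=> hX; have lX : lsubmx X = 0.
  apply/eqP; rewrite -normr_le0; apply/ler_addgt0Pr => e e0.
  have [g [s [[ag _ _] s0 _ gs]]] := tangent_ex hX e0 ltr01.
  have : `|s *: lsubmx X| <= e * s.
    have -> : s *: lsubmx X = - lsubmx (g - 1 - s *: X).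
      have /affine_matrixE lg := ag.
      by rewrite !linearB linearZ /= lg subrr sub0r opprK.
    rewrite normrN; apply: le_trans (norm_lsubmx _) _; exact: le_trans (norm_le_opnorm _) gs.
  by rewrite normrZ gtr0_norm // add0r mulrC ler_pM2r.
exists (dsubmx (rsubmx X)), (usubmx (rsubmx X)).
rewrite block_mxEh vsubmxK col_mx0 -[LHS]hsubmxK; by rewrite lX.
Qed.

Lemma hat_tangent (A : 'M[R]_n) (b : 'rV[R]_n) (x : E) :
  hat x *m block_mx (0 : 'M[R]_1) b 0 A = row_mx 0 (b + x *m A).
Proof. by rewrite /hat mul_row_block !mulmx0 addr0 mul1mx. Qed.

Lemma tangent_fields_lie : affine_lie_algebra tangent_fields.
Proof.
split; rewrite /tangent_fields.
- by rewrite block_mx0; exact: tangent0.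
- move=> c A b A' b' h1 h2.
  have := tangentD HH (tangentZ HH c h1) h2.
  by rewrite scale_block_mx add_block_mx !scaler0 !addr0.
move=> A b A' b' h1 h2; have := tangent_lie HH h1 h2.
rewrite /lie -[block_mx _ _ _ _ * _]/(_ *m _) -[X in _ - X]/(_ *m _) !mulmx_block.
by rewrite !mul0mx !mulmx0 !add0r opp_block_mx add_block_mx !oppr0 !addr0.
Qed.

Lemma tangent_fields_transitive : transitive_fields tangent_fields.
Proof.
move=> x v; have [|X hX hXv] := @tangent_onto _ _ _ HH (hat x) (row_mx 0 v).
  move=> e e0; have [d d0 hd] := local_transitivity x e0.
  have D0 : 0 < `|v| + 1 by have := normr_ge0 v; lra.
  exists (d / (`|v| + 1)) => [|t t0 td]; first by rewrite divr_gt0.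
  have [|g [Hg ge gx]] := hd (t *: v).
    by rewrite normrZ gtr0_norm // mulrC lt_div_norm1 // ltW.
  exists g; split=> //; have [ag _ _] := Hg.
  by rewrite (hat_act _ ag) gx /hat scale_row_mx add_row_mx scaler0 addr0.
have [A [b XE]] := tangent_affine hX; exists A, b; split; first by rewrite /tangent_fields -XE.
by move: hXv; rewrite XE hat_tangent => /eq_row_mx[].
Qed.

(** For small [t], [tangent_exp] gives an element of [H] close to [1 + t X] that fixes [x]. It
    commutes with [k], so it fixes [k x], and the value of the field [t X] at [k x] is of second
    order in [t]. *)
Lemma tangent_zero_deck A b x k : tangent_fields A b -> G k ->
  b + x *m A = 0 -> b + k x *m A = 0.
Proof.
move=> h Gk bx; set X : 'M[R]_(1 + n) := block_mx 0 b 0 A in h.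
have X0 := opnorm_ge0 X.
have hx : hat x *m X = 0 by rewrite hat_tangent bx row_mx0.
suff : hat (k x) *m X = 0 by rewrite hat_tangent => /(congr1 rsubmx); rewrite row_mxKr linear0.
apply/eqP; rewrite -normr_le0; apply/ler_addgt0Pr => e e0.
set C := `|hat (k x)| * (opnorm X) ^+ 2; have C0 : 0 <= C by rewrite mulr_ge0 // sqr_ge0.
(* The first bound makes the remaining error at most [e], the second makes [tangent_exp]
   applicable. *)
pose t := Num.min (e / (C + 1)) (2^-1 / (opnorm X + 1)).
have t0 : 0 < t by rewrite lt_min !divr_gt0 //; lra.
have t1 : t * (C + 1) <= e by rewrite -ler_pdivlMr ?ge_min ?lexx //; lra.
have t2 : t * (opnorm X + 1) <= 2^-1.
  by rewrite -ler_pdivlMr ?ge_min ?lexx ?orbT //; lra.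
have [|g Hg [gX gfix]] := tangent_exp HH (tangentZ HH t h).
  by rewrite opnormZ gtr0_norm //; nra.
have [ag _ cg] := Hg.
have gx : act g x = x.
  by apply: (@hat_inj R n); rewrite -hat_act // gfix // -scalemxAr hx scaler0.
have gkx : hat (k x) *m g = hat (k x) by rewrite hat_act // -cg // gx.
have e1 : t *: (hat (k x) *m X) = - (hat (k x) *m (g - 1 - t *: X)).
  by rewrite !mulmxBr mulmx1 gkx subrr sub0r opprK scalemxAr.
have : t * `|hat (k x) *m X| <= t * (t * C).
  rewrite -{1}(gtr0_norm t0) -normrZ e1 normrN; apply: le_trans (norm_mulmx_opnorm _ _) _.
  rewrite opnormZ gtr0_norm // in gX.
  have -> : t * (t * C) = `|hat (k x)| * (t * opnorm X) ^+ 2 by rewrite /C; ring.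
  by rewrite ler_wpM2l.
rewrite ler_pM2l // add0r => h1; apply: le_trans h1 _; lra.
Qed.

Lemma det_bound m (A : 'M[R]_m) c : (forall i j, `|A i j| <= c) ->
  `|\det A| <= (\sum_(s : 'S_m) 1) * c ^+ m.
Proof.
move=> Ac; rewrite /determinant; apply: le_trans (ler_norm_sum _ _ _) _.
rewrite mulr_suml ler_sum // => s _.
rewrite mul1r normrM normrX normrN1 expr1n mul1r normr_prod.
have -> : c ^+ m = \prod_(i < m) c by rewrite prodr_const card_ord.
by apply: ler_prod => i _; rewrite normr_ge0 Ac.
Qed.

(** Some translate [k x] lies in a fixed ball, and [k x - x] is a zero direction at [x] by
    [tangent_zero_deck], so that the determinant has the same value at [k x]. *)
Lemma frame_matrix_bounded (X : 'I_n -> 'M[R]_n * 'rV[R]_n) :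
  (forall i, tangent_fields (X i).1 (X i).2) ->
  exists C, forall x, `|\det (frame_matrix X x)| <= C.
Proof.
move=> hX; have [r r0 hr] := fundamental_ball hM hcompact.
pose c := \sum_i (`|(X i).2| + n%:R * (r * `|(X i).1|)).
exists ((\sum_(s : 'S_n) 1) * c ^+ n) => x; have [k Gk kx] := hr x.
have -> : \det (frame_matrix X x) = \det (frame_matrix X (k x)).
  rewrite -[k x](subrK x) addrC; apply/esym.
  apply: (det_translate_zero_direction tangent_fields_lie tangent_fields_transitive) => //.
  move=> A b hA bx; rewrite mulmxBl; apply/eqP; rewrite subr_eq0; apply/eqP.
  by apply: (addrI b); rewrite bx (tangent_zero_deck hA Gk bx).
apply: det_bound => i j; rewrite /frame_matrix mxE.
apply: le_trans (ler_coord_norm _ _ _) _; apply: le_trans (ler_normD _ _) _.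
rewrite /c (bigD1 i) //= -[leLHS]addr0 lerD //; last first.
  by apply: sumr_ge0 => l _; rewrite addr_ge0 // !mulr_ge0 // ltW.
rewrite lerD2l; apply: le_trans (norm_mulmx _ _) _.
by rewrite ler_wpM2l // ler_wpM2r // ltW.
Qed.

End LocalOrbits.

(** * The simply transitive group *)

Lemma opnorm_mul1 (R : realType) m (g g' : 'M[R]_m) a b :
  opnorm (g - 1) <= a -> opnorm (g' - 1) <= b -> opnorm (g * g' - 1) <= a + b + a * b.
Proof.
move=> ga gb; have -> : g * g' - 1 = (g - 1) * (g' - 1) + ((g - 1) + (g' - 1)).
  rewrite mulrBl !mulrBr !mulr1 !mul1r; zmodule.
apply: le_trans (opnormD _ _) _; have := opnormD (g - 1) (g' - 1).
have := opnormM (g - 1) (g' - 1).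
have : opnorm (g - 1) * opnorm (g' - 1) <= a * b by rewrite ler_pM ?opnorm_ge0.
lra.
Qed.

Lemma opnorm_inv1 (R : realType) m (g : 'M[R]_m) a : g \in unitmx ->
  opnorm (g - 1) <= a -> a <= 2^-1 -> opnorm (invmx g - 1) <= 2 * a.
Proof. by move=> ug ga a2; have [|h _] := opnorm_invmx ug; lra. Qed.

Lemma invmx_mul (R : realType) m (g g' : 'M[R]_m) : g \in unitmx -> g' \in unitmx ->
  invmx (g * g') = invmx g' * invmx g.
Proof.
move=> ug ug'; have e : (g * g') *m (invmx g' * invmx g) = 1.
  by rewrite -[g * g']/(g *m g') -[invmx g' * _]/(invmx g' *m _) mulmxA mulmxK // mulmxV.
by rewrite -[LHS]mulmx1 -[1%:M]e mulKmx // -[g * g']/(g *m g') unitmx_mul ug.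
Qed.

Section SimplyTransitiveGroup.
Variables (R : realType) (n : nat) (H : set 'M[R]_(1 + n)) (L : 'rV[R]_n -> 'M[R]_n).
Hypothesis HH : closed_matrix_group H.
Hypothesis Haff : forall g, H g -> affine_matrix g.
Hypothesis Hloc : forall (x : 'rV[R]_n) e, 0 < e -> exists2 d, 0 < d &
  forall v, `|v| < d -> exists g, [/\ H g, opnorm (g - 1) < e & act g x = x + v].
Hypothesis LP : forall c a b, L (c *: a + b) = c *: L a + L b.
Definition field_mx w : 'M[R]_(1 + n) := block_mx (0 : 'M[R]_1) w 0 (L w).
Hypothesis HL : forall X, tangent H X -> exists w, X = field_mx w.
Definition right_mx x : 'M[R]_n := \matrix_i (x *m L (delta_mx 0 i)).
Hypothesis Rnil : forall x, matrix_nilpotent (right_mx x).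
(** [w *m frame x] is the value at [x] of the field of [w], so the inverse of [frame x] turns a
    displacement of [x] into a field. *)
Definition frame x : 'M[R]_n := 1%:M + right_mx x.
Local Notation E := 'rV[R]_n.

Let H1 : H 1. Proof. by case: HH. Qed.
Let HM g g' : H g -> H g' -> H (g * g'). Proof. by case: HH => _ + _ _; apply. Qed.
Let HU g : H g -> g \in unitmx. Proof. by case: HH => _ _ + _ => /(_ g)/[apply][[]]. Qed.
Let HV g : H g -> H (invmx g). Proof. by case: HH => _ _ + _ => /(_ g)/[apply][[]]. Qed.
Let VK g : H g -> invmx g * g = 1. Proof. by move=> /HU; exact: mulVmx. Qed.
Let KV g : H g -> g * invmx g = 1. Proof. by move=> /HU; exact: mulmxV. Qed.

Lemma det_frame x : \det (frame x) = 1.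
Proof. exact: det_unipotent (Rnil x). Qed.

Lemma frame_unit x : frame x \in unitmx.
Proof. by rewrite unitmxE det_frame unitr1. Qed.

Lemma right_mxE x w : w *m right_mx x = x *m L w.
Proof.
have L0 : L 0 = 0 by have := LP (-1) 0 0; rewrite scaler0 addr0 scaleN1r addNr.
rewrite mulmx_sum_row {2}[w]row_sum_delta.
elim/big_rec2: _ => [|i A b _ ->]; first by rewrite L0 mulmx0.
by rewrite LP mulmxDr -scalemxAr rowK.
Qed.

Lemma hat_field x w : hat x *m field_mx w = row_mx 0 (w *m frame x).
Proof. by rewrite hat_tangent mulmxDr mulmx1 right_mxE. Qed.

Lemma field_mx_linear : linear field_mx.
Proof.
by move=> c a b; rewrite /field_mx LP scale_block_mx add_block_mx !scaler0 !addr0.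
Qed.

(** As the determinant is 1, the inverse is the adjugate, whose entries are minors of a bounded
    matrix. *)
Lemma invmx_frame_bound r : exists2 C, 0 <= C & forall x, `|x| <= r -> `|invmx (frame x)| <= C.
Proof.
pose c := 1 + n%:R * (`|r| * \sum_i `|L (delta_mx 0 i)|).
have c0 : 0 <= c by rewrite addr_ge0 // !mulr_ge0 // sumr_ge0.
exists ((\sum_(s : 'S_n.-1) 1) * c ^+ n.-1) => [|x xr].
  by rewrite mulr_ge0 ?exprn_ge0 // sumr_ge0.
rewrite /invmx frame_unit det_frame invr1 scale1r.
apply: ler_norm_coord => [|i j]; first by rewrite mulr_ge0 ?exprn_ge0 // sumr_ge0.
rewrite mxE /cofactor normrM normrX normrN1 expr1n mul1r.
apply: det_bound => k l; rewrite [row' _ _ _ _]mxE [col' _ _ _ _]mxE [frame x _ _]mxE.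
rewrite [1%:M _ _]mxE [right_mx x _ _]mxE.
apply: le_trans (ler_normD _ _) _; apply: lerD; first by case: (_ == _); rewrite ?normr1 ?normr0.
apply: le_trans (ler_coord_norm _ _ _) _; apply: le_trans (norm_mulmx _ _) _.
rewrite ler_wpM2l // ler_pM // ?(le_trans xr) ?ler_norm //.
by rewrite (bigD1 (lift j k)) //= lerDl sumr_ge0.
Qed.

Lemma norm_hat (x : E) : `|hat x| <= 1 + `|x|.
Proof.
apply: ler_norm_coord => [|i j]; first by rewrite addr_ge0.
case: (split_ordP j) => l ->; rewrite ?row_mxEl ?row_mxEr.
  by rewrite (ord1 i) (ord1 l) mxE eqxx normr1 lerDl.
by apply: le_trans (ler_coord_norm _ _ _) _; rewrite lerDr.
Qed.

Lemma hat_sub1 g x : H g -> hat x *m (g - 1) = row_mx 0 (act g x - x).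
Proof. by move=> /Haff ag; rewrite mulmxBr mulmx1 hat_act // hatB. Qed.

(* Near the identity an element of [H] is determined, to first order, by the displacement of any point. *)
Lemma local_chart r : exists2 C, 0 <= C & forall eps, 0 < eps -> exists2 e, 0 < e &
  forall x g, `|x| <= r -> H g -> opnorm (g - 1) < e ->
    opnorm (g - 1) <= C * `|act g x - x| /\
    opnorm (g - 1 - field_mx ((act g x - x) *m invmx (frame x))) <= eps * `|act g x - x|.
Proof.
have [CX CX0 hCX] := bounded_linear_row field_mx_linear.
have [CB' CB'0 hCB] := invmx_frame_bound r.
pose CB := n%:R * CB'; have CB0 : 0 <= CB by rewrite mulr_ge0.
pose D := (1 + n)%:R * CX; have D0 : 0 <= D by rewrite mulr_ge0.
have hD w : opnorm (field_mx w) <= D * `|w| by rewrite opnormE /D -mulrA ler_wpM2l.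
pose h := 1 + `|r|; have h0 : 0 <= h by rewrite addr_ge0.
pose K := D * CB; have K0 : 0 <= K by rewrite mulr_ge0.
exists (2 * K) => [|eps eps0]; first by rewrite mulr_ge0.
(* Its inverse is a tolerance [eta] small enough for both inequalities below. *)
pose W := 2 * (K * h + 1) + (1 + K * h) * (2 * K) / eps.
have Kh0 : 0 <= K * h by exact: mulr_ge0.
have Y0 : 0 <= (1 + K * h) * (2 * K) by apply: mulr_ge0; lra.
have Z0 : 0 <= (1 + K * h) * (2 * K) / eps by rewrite divr_ge0 // ltW.
have W0 : 0 < W by rewrite /W; lra.
have [eta [eta0 eta1 eta2]] : exists eta, [/\ 0 < eta, (K * h + 1) * eta <= 2^-1 &
    (1 + K * h) * (2 * K) * eta <= eps].
  exists W^-1; rewrite invr_gt0; split=> //.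
    rewrite ler_pdivrMr // /W; lra.
  have eZ : eps * ((1 + K * h) * (2 * K) / eps) = (1 + K * h) * (2 * K).
    by rewrite mulrC divfK ?gt_eqF.
  have eK : 0 <= eps * (K * h) by rewrite mulr_ge0 // ltW.
  by move: eZ; rewrite ler_pdivrMr // /W; set Z := _ / eps => eZ; lra.
have [e e0 he] := tangent_approx HH eta0; exists e => // x g xr Hg ge.
have [_ /HL[w ->] gX] := he g Hg ge.
set v := act g x - x; set s := opnorm (g - 1) in gX *.
have s0 : 0 <= s by exact: opnorm_ge0.
have hx : `|hat x| <= h by apply: le_trans (norm_hat x) _; rewrite lerD2l (le_trans xr) ?ler_norm.
have vw : `|v - w *m frame x| <= h * (eta * s).
  have -> : `|v - w *m frame x| = `|hat x *m (g - 1 - field_mx w)|.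
    by rewrite mulmxBr hat_sub1 // hat_field opp_row_mx add_row_mx subr0 norm_row_mx0.
  by apply: le_trans (norm_mulmx_opnorm _ _) _; rewrite ler_pM ?opnorm_ge0.
have iB (u : 'rV[R]_n) : `|u *m invmx (frame x)| <= CB * `|u|.
  apply: le_trans (norm_mulmx _ _) _; rewrite /CB -mulrA ler_wpM2l // mulrC.
  by rewrite ler_wpM2r // hCB.
set w0 := v *m invmx (frame x).
have ww : `|w - w0| <= CB * (h * (eta * s)).
  have -> : w - w0 = - ((v - w *m frame x) *m invmx (frame x)).
    by rewrite mulmxBl mulmxK ?frame_unit // opprB.
  by rewrite normrN; apply: le_trans (iB _) _; rewrite ler_wpM2l.
have w0b : `|w0| <= CB * `|v| by exact: iB.
have Xw0 : opnorm (field_mx w0) <= K * `|v|.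
  by apply: le_trans (hD _) _; rewrite /K -mulrA ler_wpM2l.
have Xww : opnorm (field_mx w - field_mx w0) <= K * h * (eta * s).
  have -> : field_mx w - field_mx w0 = field_mx (w - w0).
    by have := field_mx_linear (-1) w0 w; rewrite !scaleN1r [- w0 + w]addrC => ->; rewrite [RHS]addrC.
  by apply: le_trans (hD _) _; have := ler_wpM2l D0 ww; rewrite /K; lra.
have fin : opnorm (g - 1 - field_mx w0) <= (1 + K * h) * eta * s.
  have -> : g - 1 - field_mx w0 = (g - 1 - field_mx w) + (field_mx w - field_mx w0) by zmodule.
  by apply: le_trans (opnormD _ _) _; lra.
have sv : s <= 2 * K * `|v|.
  have : s <= opnorm (g - 1 - field_mx w0) + opnorm (field_mx w0).
    by rewrite /s -{1}[g - 1](subrK (field_mx w0)); exact: opnormD.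
  have : (K * h + 1) * eta * s <= 2^-1 * s by rewrite ler_wpM2r.
  lra.
split=> //; apply: le_trans fin _.
have v0 : 0 <= `|v| by [].
have : (1 + K * h) * eta * s <= (1 + K * h) * eta * (2 * K * `|v|).
  by apply: ler_wpM2l => //; apply: mulr_ge0; lra.
have : (1 + K * h) * (2 * K) * eta * `|v| <= eps * `|v| by rewrite ler_wpM2r.
lra.
Qed.

Lemma stabilizer_discrete x : exists2 e, 0 < e &
  forall g, H g -> opnorm (g - 1) < e -> act g x = x -> g = 1.
Proof.
have [C C0 hC] := local_chart `|x|; have [e e0 he] := hC 1 ltr01.
exists e => // g Hg ge gx; have [h _] := he x g (lexx _) Hg ge.
apply/eqP; rewrite -subr_eq0; apply/eqP/opnorm_eq0/eqP.
by rewrite eq_le opnorm_ge0 andbT; move: h; rewrite gx subrr normr0 mulr0.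
Qed.

(** By compactness: near a cluster point [x0] of a sequence of bad pairs, go from the first point to
    [x0] and from there to the second. *)
Lemma local_transitivity_uniform r e : 0 < e -> exists2 d, 0 < d & forall x v,
  `|x| <= r -> `|v| < d -> exists g, [/\ H g, opnorm (g - 1) < e & act g x = x + v].
Proof.
move=> e0; apply: contrapT => nh.
have /choice[z hz] : forall k : nat, exists z : E * E, [/\ `|z.1| <= r, `|z.2| < k.+1%:R^-1 &
    ~ exists g, [/\ H g, opnorm (g - 1) < e & act g z.1 = z.1 + z.2]].
  move=> k; apply: contrapT => nz; apply: nh; exists k.+1%:R^-1; first by rewrite invr_gt0.
  by move=> x v xr vk; apply: contrapT => ng; apply: nz; exists (x, v).
have [|x0 hx0] := @bounded_rowseq_cluster R _ (fun k => (z k).1) r; first by move=> k; have [] := hz k.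
pose a := Num.min (e / 5) 2^-1.
have a0 : 0 < a by rewrite lt_min divr_gt0 //= invr_gt0.
have a2 : a <= 2^-1 by rewrite ge_min lexx orbT.
have ae : a <= e / 5 by rewrite ge_min lexx.
have [d d0 hd] := Hloc x0 a0.
have d20 : 0 < d / 2 by lra.
have [K hK] := invr_nat_lt d20; have [k Kk zk] := hx0 _ d20 K.
have [_ vk nz] := hz k; apply: nz; have {}vk := lt_trans vk (hK _ Kk).
have [|g1 [Hg1 g1a g1x]] := hd ((z k).1 - x0); first lra.
have [|g2 [Hg2 g2a g2x]] := hd ((z k).1 + (z k).2 - x0).
  by rewrite addrAC; apply: le_lt_trans (ler_normD _ _) _; lra.
rewrite addrC subrK in g1x; rewrite addrC subrK in g2x.
exists (invmx g1 * g2); split; first by apply: HM => //; exact: HV.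
  apply: le_lt_trans (opnorm_mul1 (opnorm_inv1 (HU Hg1) (ltW g1a) a2) (ltW g2a)) _; nra.
by rewrite act_mul ?g2x; [rewrite -{1}g1x actK ?g2x // ?HU //; exact: Haff|exact/Haff/HV].
Qed.

Definition left_lipschitz_at r (s : E -> 'M[R]_(1 + n)) x := exists C d, [/\ 0 <= C, 0 < d &
  forall y, `|y| <= r -> `|x - y| < d -> opnorm (invmx (s x) * s y - 1) <= C * `|x - y|].

(** Each ray is cut into short steps, and arbitrarily chosen small elements of [H] lead from one
    step to the next. Nothing links the choices made for neighbouring points, yet the section is
    Lipschitz: [invmx (s x) * s y] is an element of [H] close to 1 that moves [x] to [y], so
    [local_chart] bounds it, with a constant that does not grow along the ray. *)
Lemma ball_section r : exists s : E -> 'M[R]_(1 + n), s 0 = 1 /\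
  forall x, `|x| <= r -> [/\ H (s x), act (s x) 0 = x & left_lipschitz_at r s x].
Proof.
have [C C0 hC] := local_chart r; have [e e0 he] := hC 1 ltr01.
(* Room for three factors within [2 * a], [a] and [a] of 1, whose product must stay within [e] of
   1. *)
pose a := Num.min (e / 7) 8^-1.
have a0 : 0 < a by rewrite lt_min divr_gt0 //= invr_gt0.
have a8 : a <= 8^-1 by rewrite ge_min lexx orbT.
have ae : a <= e / 7 by rewrite ge_min lexx.
have [d d0 hd] := local_transitivity_uniform r a0.
have [N hN] : exists N : nat, `|r| < d * N.+1%:R.
  by exists (Num.truncn (`|r| / d)); rewrite mulrC -ltr_pdivrMr // truncnS_gt.
pose t i : R := i%:R / N.+1%:R.
have t01 i : (i <= N.+1)%N -> 0 <= t i <= 1.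
  by move=> iN; rewrite divr_ge0 //= ler_pdivrMr // mul1r ler_nat.
have tS i : t i.+1 = t i + N.+1%:R^-1 by rewrite /t -natr1 mulrDl mul1r.
have tr i x : (i <= N.+1)%N -> `|x| <= r -> `|t i *: x| <= r.
  by move=> /t01 /andP[t0 t1] xr; rewrite normrZ ger0_norm //; have := normr_ge0 x; nra.
have /choice[l hl] : forall ix : nat * E, exists g, (ix.1 <= N)%N -> `|ix.2| <= r ->
    [/\ H g, opnorm (g - 1) < a & act g (t ix.1 *: ix.2) = t ix.1.+1 *: ix.2].
  move=> [i x] /=; have [[iN xr]|nix] := pselect ((i <= N)%N /\ `|x| <= r); last first.
    by exists 1 => iN xr; case: nix.
  have [||g [Hg ga gx]] := hd (t i *: x) (N.+1%:R^-1 *: x).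
  - exact: tr (leqW iN) xr.
  - rewrite normrZ gtr0_norm ?invr_gt0 // mulrC ltr_pdivrMr //.
    by apply: le_lt_trans hN; apply: le_trans xr (ler_norm _).
  by exists g => _ _; split=> //; rewrite gx tS scalerDl.
pose s i x := \prod_(j < i) l (nat_of_ord j, x).
have sS i x : s i.+1 x = s i x * l (i, x) by rewrite /s big_ord_recr.
have main i : (i <= N.+1)%N -> forall x, `|x| <= r ->
    [/\ H (s i x), act (s i x) 0 = t i *: x & exists2 d', 0 < d' & forall y, `|y| <= r ->
      `|x - y| < d' -> opnorm (invmx (s i x) * s i y - 1) <= C * `|x - y|].
  elim: i => [|i IH] iN x xr.
    rewrite /s big_ord0 /t mul0r scale0r; split=> //; first by rewrite act1.
    exists 1 => // y _ _; rewrite /s big_ord0 mulr1 invmx1 subrr opnorm0.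
    by rewrite mulr_ge0.
  have {}IH := IH (ltnW iN); have [Hs sx [d' d'0 hd']] := IH x xr.
  have [Hl la lx] := hl (i, x) iN xr; rewrite /= in lx.
  have HS : H (s i.+1 x) by rewrite sS; exact: HM.
  have sx1 : act (s i.+1 x) 0 = t i.+1 *: x by rewrite sS act_mul ?sx //; exact: Haff.
  have Cd0 : 0 < a / (C + 1) by rewrite divr_gt0 //; lra.
  split=> //; exists (Num.min d' (a / (C + 1))); first by rewrite lt_min d'0.
  move=> y yr; rewrite lt_min => /andP[xd' xa].
  have {}xa : C * `|x - y| <= a.
    by move: xa; rewrite ltr_pdivlMr ?ltr_wpDl //; have := normr_ge0 (x - y); nra.
  have [Hsy sy _] := IH y yr; have [Hly lya ly] := hl (i, y) iN yr; rewrite /= in ly.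
  have HSy : H (s i.+1 y) by rewrite sS; exact: HM.
  have sy1 : act (s i.+1 y) 0 = t i.+1 *: y by rewrite sS act_mul ?sy //; exact: Haff.
  have ka := le_trans (hd' y yr xd') xa.
  have kE : invmx (s i.+1 x) * s i.+1 y = invmx (l (i, x)) * (invmx (s i x) * s i y) * l (i, y).
    by rewrite !sS invmx_mul ?HU // !mulrA.
  have Hk : H (invmx (s i.+1 x) * s i.+1 y) by apply: HM => //; exact: HV.
  have ksm : opnorm (invmx (s i.+1 x) * s i.+1 y - 1) < e.
    rewrite kE; have a2 : a <= 2^-1 by lra.
    have h1 := opnorm_mul1 (opnorm_inv1 (HU Hl) (ltW la) a2) ka.
    by apply: le_lt_trans (opnorm_mul1 h1 (ltW lya)) _; nra.
  have kx : act (invmx (s i.+1 x) * s i.+1 y) (t i.+1 *: x) = t i.+1 *: y.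
    rewrite act_mul; last exact/Haff/HV.
    by rewrite -sx1 actK ?HU //; exact: Haff.
  have xr1 : `|t i.+1 *: x| <= r by exact: tr.
  have [h _] := he _ _ xr1 Hk ksm.
  apply: le_trans h _; rewrite kx -scalerBr normrZ distrC.
  have /t01 /andP[t0 t1] := iN; rewrite ger0_norm //.
  by rewrite ler_wpM2l // ler_piMl.
have t1 : t N.+1 = 1 by rewrite /t mulfV.
have [r0|r0] := ltP r 0.
  by exists (fun=> 1); split=> // x xr; have := normr_ge0 x; lra.
have [|Hs0 s00 _] := main N.+1 (leqnn _) 0; first by rewrite normr0.
(* The product built at 0 fixes 0 but may differ from 1, hence this normalisation. *)
exists (fun x => invmx (s N.+1 0) * s N.+1 x); split; first exact: VK.
move=> x xr; have [Hs sx [d' d'0 hd']] := main N.+1 (leqnn _) x xr.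
split; first by apply: HM => //; exact: HV.
  rewrite act_mul; last exact/Haff/HV.
  have -> : act (invmx (s N.+1 0)) 0 = 0.
    by rewrite scaler0 in s00; rewrite -{2}s00 actK ?HU //; exact: Haff.
  by rewrite sx t1 scale1r.
exists C, d'; split=> // y yr xy; rewrite invmx_mul ?unitmx_inv ?HU // invmxK.
by rewrite mulrA -[_ * invmx _]mulrA KV // mulr1; exact: hd'.
Qed.

(** Continuity is expressed through quotients in [H], the form in which [stabilizer_discrete] can be
    applied. *)
Definition left_continuous_at (D : set E) (s : E -> 'M[R]_(1 + n)) x :=
  forall e, 0 < e -> \forall z \near x, D z -> opnorm (invmx (s x) * s z - 1) < e.

Lemma left_lipschitz_continuous (D : set E) s x C d : 0 <= C -> 0 < d ->
  (forall y, D y -> `|x - y| < d -> opnorm (invmx (s x) * s y - 1) <= C * `|x - y|) ->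
  left_continuous_at D s x.
Proof.
move=> C0 d0 hs e e0; have C1 : 0 < C + 1 by lra.
have m0 : 0 < Num.min d (e / (C + 1)) by rewrite lt_min d0 divr_gt0.
apply: filterS (near_norm_lt x m0) => y; rewrite lt_min => /andP[y1 y2] Dy.
apply: le_lt_trans (hs y Dy y1) _.
by move: y2; rewrite ltr_pdivlMr //; have := normr_ge0 (x - y); nra.
Qed.

(** For [z] near [y], the element [invmx (s y) * (s z * invmx (s' z)) * s' y] is close to 1 and
    fixes [act (s y) 0]; stabilisers being discrete, it is 1. So the set where the sections agree is
    open and closed in [D]. *)
Lemma section_unique (D : set E) (y0 : E) (s s' : E -> 'M[R]_(1 + n)) :
  (forall x t, D x -> 0 <= t <= 1 -> D (y0 + t *: (x - y0))) -> D y0 ->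
  (forall y, D y -> [/\ H (s y), H (s' y) & act (s y) 0 = act (s' y) 0]) ->
  (forall y, D y -> left_continuous_at D s y) ->
  (forall y, D y -> left_continuous_at D s' y) ->
  s y0 = s' y0 -> forall y, D y -> s y = s' y.
Proof.
move=> star D0 hs cs cs' ss0.
suff key y : D y -> \forall z \near y, D z ->
    invmx (s y) * (s z * invmx (s' z)) * s' y = 1.
  apply: (@star_shaped_ind _ _ D [set y | s y = s' y] y0) => // y Dy sy.
    apply: filterS (key y Dy) => z kz Dz; have [Hs Hs' _] := hs y Dy.
    have [Hsz Hsz' _] := hs z Dz; move: sy (kz Dz); rewrite /= => <- e1.
    have : s y * (invmx (s y) * (s z * invmx (s' z)) * s y) * invmx (s y) * s' z = s' z.
      by rewrite e1 mulr1 KV // mul1r.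
    by rewrite !mulrA KV // mul1r -!mulrA (mulrA (s y)) KV // mul1r VK // mulr1.
  apply: filterS (key y Dy) => z kz Dz sz; apply: sy; have {}kz := kz Dz.
  have [Hs Hs' _] := hs y Dy; have [Hsz Hsz' _] := hs z Dz.
  move: kz; rewrite /= in sz; rewrite /= sz KV // mulr1 => e1.
  by rewrite -[LHS]mulr1 -e1 mulrA KV // mul1r.
move=> Dy; have [e e0 he] := stabilizer_discrete (act (s y) 0).
pose a := Num.min (e / 5) 2^-1.
have a0 : 0 < a by rewrite lt_min divr_gt0 //= invr_gt0.
have a2 : a <= 2^-1 by rewrite ge_min lexx orbT.
have ae : a <= e / 5 by rewrite ge_min lexx.
have [Hs Hs' ss] := hs y Dy.
near=> z => Dz; have [Hsz Hsz' ssz] := hs z Dz.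
have k1 : opnorm (invmx (s y) * s z - 1) < a.
  by move: Dz; near: z; exact: cs.
have k2 : opnorm (invmx (s' y) * s' z - 1) < a.
  by move: Dz; near: z; exact: cs'.
have Hk : H (invmx (s' y) * s' z) by apply: HM => //; exact: HV.
have qE : invmx (s y) * (s z * invmx (s' z)) * s' y =
    (invmx (s y) * s z) * invmx (invmx (s' y) * s' z).
  by rewrite invmx_mul ?unitmx_inv ?HU // invmxK !mulrA.
apply: he.
- by do 2?apply: HM => //; [exact: HV|apply: HM => //; exact: HV].
- rewrite qE; apply: le_lt_trans (opnorm_mul1 (ltW k1) (opnorm_inv1 (HU Hk) (ltW k2) a2)) _; nra.
have aV g x : H g -> act (invmx g) (act g x) = x by move=> Hg; rewrite actK ?HU //; exact: Haff.
have Hc : H (invmx (s y) * (s z * invmx (s' z))) by apply: HM; [exact: HV|apply: HM => //; exact: HV].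
rewrite act_mul; last exact: Haff.
rewrite act_mul; last exact/Haff/HV.
by rewrite aV // act_mul; [rewrite ssz aV|exact: Haff].
Unshelve. all: by end_near. Qed.

(** By uniqueness the sections on the balls of integer radius agree where both are defined. *)
Lemma global_section : exists s : E -> 'M[R]_(1 + n), s 0 = 1 /\
  forall x, [/\ H (s x), act (s x) 0 = x & left_continuous_at setT s x].
Proof.
have /choice[s hs] := fun r : nat => ball_section r%:R.
have lc r x : `|x| <= r%:R -> left_continuous_at [set y | `|y| <= r%:R] (s r) x.
  move=> xr; have [_ /(_ x xr)[_ _ [C [d [C0 d0 h]]]]] := hs r.
  exact: left_lipschitz_continuous C0 d0 h.
have agree r r' x : `|x| <= r%:R -> `|x| <= r'%:R -> s r x = s r' x.
  wlog rr : r r' / (r <= r')%N.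
    by move=> h xr xr'; have [/h|/ltnW/h] := leqP r r'; [apply|move=> ->].
  have rR : r%:R <= r'%:R :> R by rewrite ler_nat.
  move=> xr _; apply: (@section_unique [set y | `|y| <= r%:R] 0 (s r) (s r')) => //=.
  - move=> y t yr /andP[t0 t1]; rewrite add0r subr0 normrZ ger0_norm //.
    by have := normr_ge0 y; nra.
  - by rewrite normr0.
  - move=> y yr; have [_ /(_ y yr)[H1' a1 _]] := hs r.
    by have [_ /(_ y (le_trans yr rR))[H2' a2 _]] := hs r'; rewrite a1 a2.
  - by move=> y yr; exact: lc.
  - move=> y yr e e0; apply: filterS (lc r' y (le_trans yr rR) e e0) => z h zr.
    exact/h/(le_trans zr).
  - by rewrite (hs r).1 (hs r').1.
pose k (x : E) := (Num.truncn `|x|).+1.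
have xk x : `|x| <= (k x)%:R by apply: ltW; exact: truncnS_gt.
exists (fun x => s (k x) x); split; first by rewrite (hs _).1.
move=> x; have [_ /(_ x (xk x))[Hx ax _]] := hs (k x); split=> //.
have x1 : `|x| <= (k x).+1%:R by apply: le_trans (xk x) _; rewrite ler_nat.
move=> e e0; have := lc (k x).+1 x x1 e e0.
apply: filterS2 (near_norm_lt x ltr01) => y xy h _.
have y1 : `|y| <= (k x).+1%:R.
  rewrite -natr1 -[y](subKr x); apply: le_trans (ler_normB _ _) _.
  by rewrite lerD // ?xk // ltW.
by rewrite (agree _ _ _ (xk x) x1) (agree _ _ _ (xk y) y1); exact: h.
Qed.

(** [A] is the linear part of the section [s]. The two sides of [s (act (s x) y) = s y * s x] are
    continuous in [y], move 0 to the same point and agree at [y = 0], so [section_unique] applies.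
    The derivative comes from [local_chart] for [invmx (s x) * s (x + v)], which moves [x] by
    [v]. *)
Theorem group_law : exists A : E -> 'M[R]_n,
  [/\ A 0 = 1%:M, forall x, H (block_mx 1 x 0 (A x)) /\ A x \in unitmx,
      forall x y, A (x + y *m A x) = A y *m A x &
      forall x e, 0 < e -> exists2 d, 0 < d & forall v, `|v| < d ->
        `|A (x + v) - A x - A x *m L (v *m invmx (frame x))| <= e * `|v|].
Proof.
have [s [s0 hs]] := global_section.
pose A x : 'M[R]_n := drsubmx (s x).
have sE x : s x = block_mx 1 x 0 (A x).
  have [/Haff[B [b sb]] + _] := hs x; rewrite /A sb act_block mul0mx addr0 => ->.
  by rewrite block_mxKdr.
have smul x y : s (act (s x) y) = s y * s x.
  apply: (@section_unique setT 0 (fun y => s (act (s x) y)) (fun y => s y * s x)) => //.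
  - move=> z _; have [Hz az _] := hs z; have [Hx ax _] := hs x.
    have [Hxz axz _] := hs (act (s x) z); split=> //; first exact: HM.
    by rewrite axz act_mul ?az //; exact: Haff.
  - move=> z _ e e0; have [Hx _ _] := hs x; have [_ _ lcz] := hs (act (s x) z).
    have nw := @act_continuous _ _ _ (Haff Hx) z _ (lcz e e0).
    by apply: (@filterS _ (nbhs z) _ _ _ _ nw) => w /= h _; exact: h.
  - move=> z _ e e0; have [Hx _ _] := hs x; have [Hz _ lcz] := hs z.
    pose c := opnorm (invmx (s x)) * opnorm (s x) + 1.
    have c0 : 0 < c by rewrite ltr_wpDl // mulr_ge0 ?opnorm_ge0.
    apply: filterS (lcz _ (divr_gt0 e0 c0)) => w /(_ I) h _.
    have -> : invmx (s z * s x) * (s w * s x) - 1 =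
        invmx (s x) * (invmx (s z) * s w - 1) * s x.
      by rewrite mulrBr mulrBl mulr1 VK // invmx_mul ?HU // !mulrA.
    apply: le_lt_trans (opnormM _ _) _; have := opnormM (invmx (s x)) (invmx (s z) * s w - 1).
    move: h; rewrite ltr_pdivlMr // /c.
    have := opnorm_ge0 (invmx (s z) * s w - 1); have := opnorm_ge0 (s x); nra.
  - by have [_ -> _] := hs x; rewrite s0 mul1r.
exists A; split.
- by rewrite /A s0 [1](@scalar_mx_block _ 1 n (1 : R)) block_mxKdr.
- move=> x; have [Hx _ _] := hs x; rewrite -sE; split=> //.
  by have := HU Hx; rewrite sE affine_matrix_unit.
- move=> x y; have sa : act (s x) y = x + y *m A x by rewrite sE act_block.
  have := congr1 drsubmx (smul x y); rewrite sa -[drsubmx (s (_ + _))]/(A _) => ->.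
  by rewrite (sE y) (sE x) -[_ * _]/(_ *m _) mulmx_block block_mxKdr mul0mx add0r.
move=> x e e0; have [Hx ax lcx] := hs x.
have [C C0 hC] := local_chart `|x|.
pose c := opnorm (s x) + 1; have c0 : 0 < c by have := opnorm_ge0 (s x); rewrite /c; lra.
have [e' e'0 he'] := hC _ (divr_gt0 e0 c0).
have [d d0 hd] := nbhs_norm_lt (lcx _ e'0); exists d => // v vd.
set g := invmx (s x) * s (x + v).
have [Hxv axv _] := hs (x + v).
have Hg : H g by apply: HM => //; exact: HV.
have ge : opnorm (g - 1) < e' by apply: hd => //; rewrite opprD addNKr normrN.
have gx : act g x - x = v.
  have ax' : act (invmx (s x)) x = 0 by rewrite -{2}ax actK ?HU //; exact: Haff.
  by rewrite /g act_mul ?ax' ?axv; [rewrite addrC addKr|exact/Haff/HV].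
have [_ h] := he' x g (lexx _) Hg ge; rewrite gx in h.
set w := v *m _ in h *.
pose Z : 'M[R]_(1 + n) := s x * (g - 1 - field_mx w).
have -> : A (x + v) - A x - A x *m L w = drsubmx Z.
  have -> : Z = s (x + v) - s x - s x *m field_mx w.
    by rewrite /Z !mulrBr mulr1 /g mulrA KV // mul1r.
  have dB (X Y : 'M[R]_(1 + n)) : drsubmx (X - Y) = drsubmx X - drsubmx Y.
    by apply/matrixP => i j; rewrite !mxE.
  rewrite !dB [X in X *m field_mx w]sE /field_mx mulmx_block block_mxKdr.
  by rewrite mul0mx add0r.
apply: (@le_trans _ _ (opnorm Z)).
  apply: le_trans (norm_le_opnorm _).
  have nd (X : 'M[R]_(1 + n)) : `|drsubmx X| <= `|X|.
    by apply: ler_norm_coord => // i j; rewrite !mxE; exact: ler_coord_norm.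
  exact: nd.
apply: le_trans (opnormM _ _) _.
have : opnorm (s x) * opnorm (g - 1 - field_mx w) <= c * (e / c * `|v|).
  by rewrite ler_pM ?opnorm_ge0 // /c lerDl.
have -> : c * (e / c * `|v|) = e * `|v| by rewrite mulrA [c * (e / c)]mulrC divfK // gt_eqF.
by [].
Qed.

End SimplyTransitiveGroup.

(** * Triangular groups and solvability *)

Section TriangularGroup.
Variables (F : fieldType) (n : nat).
Implicit Types D : 'M[F]_n.

(** Level 0 is lower triangular, level 1 strictly so. *)
Definition lower_band j D := forall a b : 'I_n, (a < b + j)%N -> D a b = 0.

Lemma lower_bandM i j D D' : lower_band i D -> lower_band j D' -> lower_band (i + j) (D * D').
Proof.
move=> hD hD' a b ab; rewrite -[D * D']/(D *m D') mxE big1 // => c _.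
have [ac|ca] := ltnP a (c + i); first by rewrite hD // mul0r.
rewrite hD' ?mulr0 //; have : (c + i < b + (i + j))%N by apply: leq_ltn_trans ca ab.
by rewrite addnA addnAC ltn_add2r.
Qed.

Lemma lower_bandD j D D' : lower_band j D -> lower_band j D' -> lower_band j (D + D').
Proof. by move=> hD hD' a b ab; rewrite mxE hD // hD' // addr0. Qed.

Lemma lower_bandN j D : lower_band j D -> lower_band j (- D).
Proof. by move=> hD a b ab; rewrite mxE hD // oppr0. Qed.

Lemma lower_bandW i j D : (i <= j)%N -> lower_band j D -> lower_band i D.
Proof. by move=> ij hD a b ab; apply: hD; apply: leq_trans ab _; rewrite leq_add2l. Qed.

Variables (G : groupType) (B : G -> 'M[F]_n).
Hypothesis B1 : B 1%g = 1.
Hypothesis BM : forall x y, B (x * y)%g = B y * B x.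
Hypothesis Btrig : forall x, lower_band 0 (B x).
Hypothesis Bker : forall x y, B x = 1 -> B y = 1 -> commg x y = 1%g.

Let U j : set G := [set x | lower_band j (B x - 1)].

Lemma level_subgroup j : subgroup (U j).
Proof.
split; rewrite /U /=.
- by rewrite B1 subrr => a b _; rewrite mxE.
- move=> x y hx hy; rewrite BM.
  have -> : B y * B x - 1 = (B y - 1) * B x + (B x - 1) by rewrite mulrBl mul1r; zmodule.
  apply: lower_bandD => //; rewrite -[j]addn0; exact: lower_bandM.
- move=> x hx; have xV : B x * B (x^-1)%g = 1 by rewrite -BM mulVg B1.
  have -> : B (x^-1)%g - 1 = - ((B x - 1) * B (x^-1)%g) by rewrite mulrBl xV mul1r opprB.
  by apply: lower_bandN; rewrite -[j]addn0; exact: lower_bandM.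
Qed.

(** For [j > 0], the commutator of the matrices only involves products of two matrices of level [j],
    and [j + j > j]; for [j = 0], the diagonals of the two products agree. *)
Lemma commutator_level j x y : U j x -> U j y -> U j.+1 (commg x y).
Proof.
move=> hx hy; rewrite /U /= /commg /conjg !BM.
have e : B y * B x * B (y^-1)%g * B (x^-1)%g - 1 =
    (B y * B x - B x * B y) * (B (y^-1)%g * B (x^-1)%g).
  have yV : B y * B (y^-1)%g = 1 by rewrite -BM mulVg B1.
  have xV : B x * B (x^-1)%g = 1 by rewrite -BM mulVg B1.
  rewrite mulrBl -!mulrA (mulrA (B y) (B (y^-1)%g)) yV mul1r xV //.
rewrite e -[j.+1]addn0; apply: lower_bandM; last first.
  by rewrite -[0%N]addn0; apply: lower_bandM.
case: j hx hy {e} => [|j] hx hy; last first.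
  have -> : B y * B x - B x * B y = (B y - 1) * (B x - 1) - (B x - 1) * (B y - 1).
    rewrite !mulrBl !mulrBr !mulr1 !mul1r; zmodule.
  have jj : (j.+2 <= j.+1 + j.+1)%N by rewrite addSn addnS !ltnS leq_addr.
  by apply: lower_bandD; [|apply: lower_bandN]; apply: lower_bandW jj _; apply: lower_bandM.
move=> a b; rewrite addn1 ltnS leq_eqVlt => /orP[/eqP ab|ab]; last first.
  have : lower_band 0 (B y * B x - B x * B y).
    by apply: lower_bandD; [|apply: lower_bandN]; rewrite -[0%N]addn0; apply: lower_bandM.
  by apply; rewrite addn0.
have -> : a = b by apply/val_inj.
have diag x' y' : (B x' * B y') b b = B x' b b * B y' b b.
  rewrite -[_ * _]/(_ *m _) mxE (bigD1 b) //= big1 ?addr0 // => c.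
  rewrite neq_ltn => /orP[cb|bc]; last by rewrite Btrig ?mul0r // addn0.
  by rewrite [B y' _ _]Btrig ?mulr0 // addn0.
have subE (X Y : 'M[F]_n) : (X - Y) b b = X b b - Y b b by rewrite !mxE.
by rewrite subE !diag mulrC subrr.
Qed.

(** After [n] steps of the derived series [B] is trivial, and one more step lands in 1 by [Bker]. *)
Lemma triangular_solvable : solvable_group G.
Proof.
have levels k : iter k (@derived_subgroup G) [set: G] `<=` U k.
  elim: k => [|k IH] /=.
    move=> x _; apply: lower_bandD => //; apply: lower_bandN => a b; rewrite addn0 => ab.
    by rewrite mxE -val_eqE /= ltn_eqF.
  move=> x hx; apply: hx; split; first exact: level_subgroup.
  by move=> _ [y Dy [z Dz <-]]; apply: commutator_level; exact: IH.
have sub1 : subgroup [set (1 : G)%g].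
  by split=> //= [x y -> ->|x ->]; rewrite ?mulg1 ?invg1.
exists n.+1; rewrite eqEsubset; split=> [x|x ->]; last first.
  by move=> K [[K1 _ _] _].
apply=> //; split=> // _ [y Dy [z Dz <-]] /=.
by apply: Bker; apply/eqP; rewrite -subr_eq0; apply/eqP/matrixP => a b;
  rewrite [RHS]mxE; [apply: (levels n y Dy)|apply: (levels n z Dz)];
  apply: leq_trans (ltn_ord a) (leq_addl _ _).
Qed.

End TriangularGroup.

(* The barrier [e * expR ((C + 1) * t)] grows strictly faster than [f] can. *)
Lemma gronwall_zero (R : realType) (V : normedModType R) (f : R -> V) (C : R) :
  0 <= C -> f 0 = 0 ->
  (forall t e, 0 <= t <= 1 -> 0 < e -> exists2 d, 0 < d & forall s, `|s| < d ->
     `|f (t + s) - f t| <= `|s| * (C * `|f t| + e)) ->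
  f 1 = 0.
Proof.
move=> C0 f0 hf; apply/eqP; rewrite -normr_le0; apply/ler_addgt0Pr => e e0; rewrite add0r.
(* So that the barrier [b] has the value [e] at time 1. *)
pose e1 := e / expR (C + 1); have e10 : 0 < e1 by rewrite divr_gt0 ?expR_gt0.
pose b t := e1 * expR ((C + 1) * t).
have eb : e = b 1 by rewrite /b mulr1 divfK // gt_eqF ?expR_gt0.
rewrite eb; pose S := [set t : R | 0 <= t <= 1 /\ forall u, 0 <= u <= t -> `|f u| <= b u].
have S0 : S 0.
  split; first by rewrite lexx ler01.
  move=> u; rewrite -eq_le => /eqP <-; rewrite f0 normr0 /b.
  by rewrite mulr_ge0 ?expR_ge0 // ltW.
have hS : has_sup S by split; [exists 0|exists 1 => t [/andP[]]].
(* The bound by the barrier passes to the limit at [s], and if [s < 1] the strict growth of the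
   barrier carries it a little beyond. *)
set s := sup S; have s0 : 0 <= s by apply: ub_le_sup => //; case: hS.
have s1 : s <= 1 by apply: ge_sup => [|t [/andP[]] //]; exists 0.
have below u : 0 <= u -> u < s -> `|f u| <= b u.
  move=> u0 us; have su : 0 < s - u by lra.
  have [t [_ St] ut] := sup_adherent su hS; apply: St; rewrite u0 /=.
  by move: ut; rewrite -/s; lra.
have bmono u t : 0 <= u -> u <= t -> b u * (1 + (C + 1) * (t - u)) <= b t.
  move=> u0 ut; rewrite /b -mulrA; apply: ler_wpM2l; first exact: ltW.
  have -> : (C + 1) * t = (C + 1) * u + (C + 1) * (t - u) by ring.
  by rewrite expRD ler_wpM2l ?expR_ge0 // expR_ge1Dx.
have b0 u : 0 < b u by rewrite mulr_gt0 ?expR_gt0.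
have be1 u : 0 <= u -> e1 <= b u.
  move=> u0; have := bmono 0 u (lexx _) u0; rewrite /b mulr0 expR0 mulr1 subr0.
  have : 0 <= e1 * ((C + 1) * u) by rewrite !mulr_ge0 //; lra.
  lra.
have s01 : 0 <= s <= 1 by rewrite s0.
have fs : `|f s| <= b s.
  have [->|sN] := eqVneq s 0; first by rewrite f0 normr0 ltW.
  have sp : 0 < s by rewrite lt_neqAle eq_sym sN.
  apply/ler_addgt0Pr => eta eta0; have [d d0 hd] := hf s 1 s01 ltr01.
  pose K := C * `|f s| + 1; have K0 : 0 < K by rewrite ltr_wpDl // mulr_ge0.
  pose r := Num.min (d / 2) (Num.min s (eta / K)).
  have r0 : 0 < r by rewrite !lt_min !divr_gt0 // sp.
  have rd : r <= d / 2 by rewrite ge_min lexx.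
  have rs : r <= s by rewrite !ge_min lexx !orbT.
  have rK : r * K <= eta by rewrite -ler_pdivlMr // !ge_min lexx !orbT.
  have h := hd (- r); rewrite normrN gtr0_norm // distrC -/K in h.
  have {}h : `|f s - f (s - r)| <= r * K by apply: h; lra.
  have h1 : `|f (s - r)| <= b (s - r) by apply: below; lra.
  have h2 := bmono (s - r) s; rewrite subKr in h2.
  have {}h2 : b (s - r) * (1 + (C + 1) * r) <= b s by apply: h2; lra.
  have : 0 <= b (s - r) * ((C + 1) * r).
    by apply: mulr_ge0; [exact: ltW|apply: mulr_ge0; lra].
  by have := ler_distD (f (s - r)) (f s) 0; rewrite !subr0; lra.
have [s1'|s1'] := ltP s 1; last by have -> : 1 = s by apply/eqP; rewrite eq_le s1 s1'.
have [d d0 hd] := hf s e1 s01 e10.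
pose r := Num.min (d / 2) (1 - s).
have r0 : 0 < r by rewrite lt_min divr_gt0 //=; lra.
have rd : r <= d / 2 by rewrite ge_min lexx.
have r1 : r <= 1 - s by rewrite ge_min lexx orbT.
suff : S (s + r) by move=> /(ub_le_sup hS.2); rewrite -/s; lra.
split; first by apply/andP; split; lra.
move=> u /andP[u0 ur]; have [us|su] := ltP u s; first exact: below.
have h := hd (u - s); rewrite [s + _]addrC subrK ger0_norm in h; last lra.
have {}h : `|f u - f s| <= (u - s) * (C * `|f s| + e1) by apply: h; lra.
have h1 := bmono s u s0 su; have h2 := be1 s s0.
have h3 : (u - s) * (C * `|f s| + e1) <= (u - s) * (C * b s + b s).
  rewrite ler_wpM2l; [by []|lra|]; have : C * `|f s| <= C * b s by rewrite ler_wpM2l.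
  lra.
by have := ler_distD (f s) (f u) 0; rewrite !subr0; lra.
Qed.

(** * Smooth maps *)

Section Smooth.
Variable R : realType.
Implicit Types V W Z : normedModType R.

Lemma differentiable_criterion V W (f : V -> W) x (l : V -> W) :
  linear l -> continuous l ->
  (forall e, 0 < e -> \forall v \near 0, `|f (v + x) - f x - l v| <= e * `|v|) ->
  differentiable f x /\ forall v, 'D_v f x = l v.
Proof.
move=> lL cl hf; pose L : {linear V -> W} := HB.pack l (GRing.isLinear.Build _ _ _ _ _ lL).
have cL : continuous L by [].
have fE : f \o shift x = cst (f x) + L +o_ 0 id.
  apply/eqaddoP => e e0; apply: filterS (hf e e0) => v /=.
  by rewrite -[(f \o shift x - (cst (f x) + L)) v]/(f (v + x) - (f x + l v)) opprD addrA.
have dE := diff_unique cL fE.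
have df : differentiable f x by apply/diff_locallyP; rewrite dE.
by split=> // v; rewrite deriveE // dE.
Qed.

Lemma differentiable_estimate V W (f : V -> W) x : differentiable f x ->
  forall e, 0 < e -> \forall v \near 0, `|f (v + x) - f x - 'd f x v| <= e * `|v|.
Proof.
move=> /diff_locallyP[_ /eqaddoP h] e e0; apply: filterS (h e e0) => v /=.
by rewrite -[(_ - _) v]/(f (v + x) - (f x + 'd f x v)) opprD addrA.
Qed.

Lemma near_eq_derive V W (f g : V -> W) x v : (\forall y \near x, f y = g y) ->
  differentiable g x -> differentiable f x /\ 'D_v f x = 'D_v g x.
Proof.
move=> fg dg; have fgx := nbhs_singleton fg.
have [|||df Df] := @differentiable_criterion V W f x ('d g x).
- exact: linearP.
- exact: diff_continuous.
- move=> e e0; have h := differentiable_estimate dg e0.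
  have sx : \forall w \near (0 : V), f (w + x) = g (w + x).
    have [d d0 hd] := nbhs_norm_lt fg; apply: filterS (near_norm_lt 0 d0) => w.
    by rewrite sub0r normrN => wd; apply: hd; rewrite opprD addrCA subrr addr0 normrN.
  by apply: filterS2 sx h => w -> ; rewrite fgx.
- by split=> //; rewrite Df deriveE.
Qed.

(** Smoothness on a subset is obtained from globally defined smooth maps that agree locally, which
    is why the other rules are stated on [setT]. *)
Lemma Ck_local V W k (U : set V) (f : V -> W) :
  (forall x, U x -> exists g, (\forall y \near x, f y = g y) /\ Ck_on k setT g) -> Ck_on k U f.
Proof.
elim: k U f => [|k IH] U f h /=.
  move=> x /h[g [fg /(_ x I) cg]]; have fgx := nbhs_singleton fg.
  move=> B; rewrite fgx => /cg gB; apply: filterS2 fg gB => y fgy.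
  by rewrite /= fgy.
split=> [x /h[g [fg [dg _]]]|v].
  by have [] := near_eq_derive 0 fg (dg x I).
apply: IH => x /h[g [fg [dg Dg]]]; exists ('D_v g); split; last exact: Dg.
have := near_join fg; apply: filterS => y fgy.
by have [_ ->] := near_eq_derive v fgy (dg y I).
Qed.

Lemma Ck_ext V W k (f g : V -> W) : f =1 g -> Ck_on k setT g -> Ck_on k setT f.
Proof. by move=> fg; rewrite (funext fg). Qed.

Lemma Ck_cst V W k (c : W) : Ck_on k setT (fun _ : V => c).
Proof.
elim: k c => [|k IH] c /=; first by move=> x _; exact: cst_continuous.
split=> [x _|v]; first exact: differentiable_cst.
apply: Ck_ext (IH 0) => x; exact: derive_cst.
Qed.

Lemma linear_Ck V W k (l : V -> W) : linear l -> continuous l -> Ck_on k setT l.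
Proof.
move=> lL cl; have h x : differentiable l x /\ forall v, 'D_v l x = l v.
  apply: differentiable_criterion => // e e0; near=> v.
  have -> : l (v + x) = l v + l x by have := lL 1 v x; rewrite !scale1r.
  by rewrite addrK subrr normr0 mulr_ge0 // ltW.
case: k => [|k] /=; first by move=> x _; exact: cl.
split=> [x _|v]; first by have [] := h x.
by apply: Ck_ext (Ck_cst _ _ (l v)) => x; have [_ ->] := h x.
Unshelve. all: by end_near. Qed.

Lemma CkD V W k (f g : V -> W) : Ck_on k setT f -> Ck_on k setT g ->
  Ck_on k setT (fun x => f x + g x).
Proof.
elim: k f g => [|k IH] f g /=.
  by move=> cf cg x _; apply: cvgD; [exact: cf|exact: cg].
move=> [df Df] [dg Dg]; split=> [x _|v]; first by apply: differentiableD; [exact: df|exact: dg].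
apply: Ck_ext (IH _ _ (Df v) (Dg v)) => x; rewrite -deriveD //.
  exact: diff_derivable (df x I).
exact: diff_derivable (dg x I).
Qed.

Lemma Ck_linear_comp V W Z k (l : W -> Z) (f : V -> W) : linear l -> continuous l ->
  Ck_on k setT f -> Ck_on k setT (fun x => l (f x)).
Proof.
move=> lL cl; have l0 : l 0 = 0 by have := lL (-1) 0 0; rewrite scaler0 addr0 scaleN1r addNr.
have dl y : differentiable l y by have [] := linear_Ck 1 lL cl => + _; apply.
have ll y v : 'd l y v = l v.
  have [|_ <-] := @differentiable_criterion W Z l y l lL cl; last by rewrite deriveE.
  move=> e e0; near=> w.
  have -> : l (w + y) = l w + l y by have := lL 1 w y; rewrite !scale1r.
  by rewrite addrK subrr normr0 mulr_ge0 // ltW.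
elim: k f => [|k IH] f /=.
  by move=> cf x _; apply: continuous_comp; [exact: cf|exact: cl].
move=> [df Df]; split=> [x _|v].
  by apply: differentiable_comp; [exact: df|exact: dl].
apply: Ck_ext (IH _ (Df v)) => x; rewrite deriveE; last by apply: differentiable_comp; [exact: df|exact: dl].
by rewrite diff_comp //= ?ll ?deriveE //; exact: df.
Unshelve. all: by end_near. Qed.

End Smooth.

Lemma bounded_linear_mx (R : realType) m n (V : normedModType R) (f : 'M[R]_(m, n) -> V) :
  linear f -> exists2 C, 0 <= C & forall u, `|f u| <= C * `|u|.
Proof.
move=> fL; have [|C C0 hC] := @bounded_linear_row R (m * n) V (f \o vec_mx).
  by move=> a u v /=; rewrite linearP fL.
by exists C => // u; rewrite -{1}[u]mxvecK -norm_mxvec; exact: hC.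
Qed.

Lemma linear_mx_continuous (R : realType) m n (V : normedModType R) (f : 'M[R]_(m, n) -> V) :
  linear f -> continuous f.
Proof.
move=> fL x; have [C C0 hC] := bounded_linear_mx fL.
apply/(@cvgrPdist_lt _ _ _ (nbhs x)) => e e0.
have C1 : 0 < C + 1 by lra.
apply: filterS (near_norm_lt x (divr_gt0 e0 C1)) => y; rewrite ltr_pdivlMr // => xy.
have -> : f x - f y = f (x - y) by have := fL (-1) y x; rewrite !scaleN1r [- y + x]addrC => ->; rewrite [RHS]addrC.
by apply: le_lt_trans (hC _) _; have := normr_ge0 (x - y); nra.
Qed.

Section SmoothMatrices.
Variable R : realType.
Implicit Types V W : normedModType R.

Lemma CkS V W k (f : V -> W) : Ck_on k.+1 setT f -> Ck_on k setT f.
Proof.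
elim: k f => [|k IH] f /= [df Df]; first by move=> x _; exact/differentiable_continuous/df.
by split=> // v; exact/IH/Df.
Qed.

Lemma CkM V k (f g : V -> R^o) : Ck_on k setT f -> Ck_on k setT g ->
  Ck_on k setT (fun x => f x * g x : R^o).
Proof.
elim: k f g => [|k IH] f g cf cg; first by move=> x _; apply: cvgM; [exact: cf|exact: cg].
have [df Df] := cf; have [dg Dg] := cg.
split=> [x _|v]; first by apply: differentiableM; [exact: df|exact: dg].
apply: (@Ck_ext _ _ _ _ _ (fun x => f x * 'D_v g x + g x * 'D_v f x)).
  by move=> x; rewrite deriveM //; exact/diff_derivable/dg || exact/diff_derivable/df.
apply: (@CkD R V R^o k (fun x => f x * 'D_v g x) (fun x => g x * 'D_v f x)).
  by apply: IH; [exact: (CkS cf)|exact: Dg].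
by apply: IH; [exact: (CkS cg)|exact: Df].
Qed.

Lemma Ck_sum V W k (I : finType) (f : I -> V -> W) : (forall i, Ck_on k setT (f i)) ->
  Ck_on k setT (fun x => \sum_i f i x).
Proof.
move=> hf; suff : forall r, Ck_on k setT (fun x => \sum_(i <- r) f i x).
  by move=> /(_ (index_enum I)); apply: Ck_ext => x.
elim=> [|i r IH]; first by apply: Ck_ext (Ck_cst _ _ 0) => x; rewrite big_nil.
by apply: Ck_ext (CkD (hf i) IH) => x; rewrite big_cons.
Qed.

Lemma Ck_coord V m n k (f : V -> 'M[R]_(m, n)) i j :
  Ck_on k setT f -> Ck_on k setT (fun x => f x i j : R^o).
Proof.
have lL : linear (fun M : 'M[R]_(m, n) => M i j : R^o) by move=> a u v; rewrite !mxE.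
by move=> cf; exact: (Ck_linear_comp lL (linear_mx_continuous lL) cf).
Qed.

Lemma Ck_mx V m n k (f : V -> 'M[R]_(m, n)) :
  (forall i j, Ck_on k setT (fun x => f x i j : R^o)) -> Ck_on k setT f.
Proof.
move=> hf; apply: (@Ck_ext _ _ _ _ _ (fun x => \sum_i \sum_j f x i j *: delta_mx i j)).
  by move=> x; exact: matrix_sum_delta.
apply: Ck_sum => i; apply: Ck_sum => j.
have lL : linear (fun c : R^o => c *: (delta_mx i j : 'M[R]_(m, n))).
  by move=> a u v; rewrite scalerDl scalerA.
apply: (Ck_linear_comp lL _ (hf i j)) => x.
by apply: cvgZr_tmp; exact: cvg_id.
Qed.

Lemma Ck_mulmx V m n l k (f : V -> 'M[R]_(m, n)) (g : V -> 'M[R]_(n, l)) :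
  Ck_on k setT f -> Ck_on k setT g -> Ck_on k setT (fun x => f x *m g x).
Proof.
move=> cf cg; apply: Ck_mx => i j.
apply: (@Ck_ext _ _ _ _ _ (fun x => \sum_a f x i a * g x a j)) => [x|]; first by rewrite mxE.
by apply: Ck_sum => a; apply: CkM; exact: Ck_coord.
Qed.

Lemma CkN V W k (f : V -> W) : Ck_on k setT f -> Ck_on k setT (fun x => - f x).
Proof.
have nL : linear (fun w : W => - w) by move=> a u v; rewrite opprD scalerN.
by move=> cf; apply: (Ck_linear_comp nL _ cf) => x; exact: opp_continuous.
Qed.

End SmoothMatrices.

Section SmoothGroup.
Variables (R : realType) (n : nat) (A : 'rV[R]_n -> 'M[R]_n) (L : 'rV[R]_n -> 'M[R]_n).
Hypothesis LP : forall c a b, L (c *: a + b) = c *: L a + L b.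
Hypothesis A0 : A 0 = 1%:M.
Hypothesis AU : forall x, A x \in unitmx.
Hypothesis AM : forall x y, A (x + y *m A x) = A y *m A x.
Hypothesis dA0 : forall e, 0 < e -> \forall w \near (0 : 'rV[R]_n), `|A w - 1%:M - L w| <= e * `|w|.
Local Notation E := 'rV[R]_n.

Definition Ai x := invmx (A x).

Let Llin : linear L. Proof. exact: LP. Qed.

Lemma near0_mul (P : set E) (B : 'M[R]_n) : (\forall w \near (0 : E), P w) ->
  \forall v \near (0 : E), P (v *m B).
Proof.
move=> hP; have lB : linear (fun v : E => v *m B) by move=> a u v; rewrite mulmxDl scalemxAl.
by have := @linear_mx_continuous R 1 n E _ lB 0 P; apply; rewrite /= mul0mx.
Qed.

(** A remainder negligible against [|w|] stays so after a linear substitution and products with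
    fixed matrices. *)
Lemma small_conj (r : E -> 'M[R]_n) (M B N : 'M[R]_n) :
  (forall e, 0 < e -> \forall w \near (0 : E), `|r w| <= e * `|w|) ->
  forall e, 0 < e -> \forall v \near (0 : E), `|M *m r (v *m B) *m N| <= e * `|v|.
Proof.
move=> hr e e0; pose c := opnorm M * opnorm B * opnorm N + 1.
have c0 : 0 < c by rewrite ltr_wpDl // !mulr_ge0 ?opnorm_ge0.
apply: filterS (near0_mul B (hr _ (divr_gt0 e0 c0))) => v hv.
have h1 : `|M *m r (v *m B) *m N| <= opnorm M * (`|r (v *m B)| * opnorm N).
  rewrite -mulmxA; apply: le_trans (norm_mulmx _ _) _; rewrite opnormE mulrA ler_wpM2l //.
  by rewrite mulrCA; exact: norm_mulmx.
apply: le_trans h1 _.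
have ec : 0 <= e / c by rewrite divr_ge0 // ltW.
have h2 : `|r (v *m B)| <= e / c * (`|v| * opnorm B).
  by apply: le_trans hv _; apply: (ler_wpM2l ec); exact: norm_mulmx_opnorm.
have : opnorm M * (`|r (v *m B)| * opnorm N) <= opnorm M * (e / c * (`|v| * opnorm B) * opnorm N).
  by rewrite ler_wpM2l ?opnorm_ge0 // ler_wpM2r ?opnorm_ge0.
move=> h; apply: le_trans h _.
have -> : opnorm M * (e / c * (`|v| * opnorm B) * opnorm N) = (e / c * `|v|) * (c - 1).
  by rewrite /c; ring.
have -> : e * `|v| = (e / c * `|v|) * c by rewrite mulrAC divfK // gt_eqF.
by apply: (ler_wpM2l (mulr_ge0 ec (normr_ge0 v))); lra.
Qed.

(** Reduces differentiation at [x] to differentiation at 0. *)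
Lemma A_shift x v : A (v + x) = A (v *m Ai x) *m A x.
Proof. by rewrite -AM mulmxKV // addrC. Qed.

Lemma derivative_A x : differentiable A x /\ forall v, 'D_v A x = L (v *m Ai x) *m A x.
Proof.
have lL : linear (fun v => L (v *m Ai x) *m A x).
  by move=> a u v; rewrite mulmxDl -scalemxAl LP mulmxDl -scalemxAl.
apply: differentiable_criterion lL (linear_mx_continuous lL) _ => e e0.
apply: filterS (small_conj 1%:M (Ai x) (A x) dA0 e0) => v; rewrite mul1mx.
by rewrite A_shift !mulmxBl mul1mx.
Qed.

Lemma dAi0 e : 0 < e -> \forall w \near (0 : E), `|invmx (A w) - 1%:M + L w| <= e * `|w|.
Proof.
move=> e0; have [C C0 hC] := bounded_linear_row Llin.
have e2 : 0 < e / 2 by lra.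
pose K := n%:R * (C + 1); have K0 : 0 <= K by rewrite mulr_ge0 // addr_ge0.
have s0 : 0 < Num.min (2^-1 / (K + 1)) (e / (4 * (K * K + 1))).
  by rewrite lt_min !divr_gt0 ?mulr_gt0 ?invr_gt0 //; have := mulr_ge0 K0 K0; lra.
apply: filterS3 (near_norm_lt 0 s0) (dA0 e2) (dA0 ltr01) => w.
rewrite sub0r normrN lt_min !ltr_pdivlMr ?mulr_gt0 //; [|by have := mulr_ge0 K0 K0; lra|lra].
move=> /andP[w1 w2] h1 h2; have w0 := normr_ge0 w.
have a1 : opnorm (A w - 1) <= K * `|w|.
  rewrite opnormE /K -mulrA ler_wpM2l //.
  have : `|A w - 1%:M| <= `|A w - 1%:M - L w| + `|L w|.
    by rewrite -{1}[A w - 1%:M](subrK (L w)); exact: ler_normD.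
  have := hC w; rewrite -[A w - 1]/(A w - 1%:M); lra.
have [|_ h3] := opnorm_invmx (AU w); first lra.
have -> : invmx (A w) - 1%:M + L w = (invmx (A w) - 1 + (A w - 1)) - (A w - 1%:M - L w).
  rewrite -[1%:M]/(1 : 'M[R]_n); zmodule.
apply: le_trans (ler_normB _ _) _; have := le_trans (norm_le_opnorm _) h3.
have : opnorm (A w - 1) * opnorm (A w - 1) <= (K * `|w|) * (K * `|w|) by rewrite ler_pM ?opnorm_ge0.
have : (`|w| * (4 * (K * K + 1))) * `|w| <= e * `|w| by rewrite ler_wpM2r // ltW.
have : 0 <= `|w| * `|w| by rewrite mulr_ge0.
have -> : K * `|w| * (K * `|w|) = K * K * (`|w| * `|w|) by ring.
lra.
Qed.

Lemma derivative_Ai x : differentiable Ai x /\ forall v, 'D_v Ai x = - (Ai x *m L (v *m Ai x)).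
Proof.
have lL : linear (fun v => - (Ai x *m L (v *m Ai x))).
  by move=> a u v; rewrite mulmxDl -scalemxAl LP mulmxDr -scalemxAr opprD scalerN.
apply: differentiable_criterion lL (linear_mx_continuous lL) _ => e e0.
apply: filterS (small_conj (Ai x) (Ai x) 1%:M dAi0 e0) => v; rewrite mulmx1.
rewrite /Ai A_shift -/(Ai x) opprK.
have -> : invmx (A (v *m Ai x) *m A x) = Ai x *m invmx (A (v *m Ai x)).
  have e1 : A (v *m Ai x) *m A x *m (Ai x *m invmx (A (v *m Ai x))) = 1%:M.
    by rewrite mulmxA mulmxK // mulmxV.
  by rewrite -[LHS]mulmx1 -e1 mulKmx // unitmx_mul !AU.
by rewrite !(mulmxDr, mulmxN, mulmx1).
Qed.

(** The derivatives of [A] and [Ai] are products of [A], [Ai] and linear images of [Ai], so both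
    maps gain one degree of smoothness at each step. *)
Lemma A_Ai_Ck k : Ck_on k setT A /\ Ck_on k setT Ai.
Proof.
elim: k => [|k [cA cAi]].
  split=> x _; apply: differentiable_continuous.
    by have [] := derivative_A x.
  by have [] := derivative_Ai x.
have cL v : Ck_on k setT (fun x => L (v *m Ai x)).
  have lL : linear (fun M : 'M[R]_n => L (v *m M)) by move=> a b c; rewrite mulmxDr -scalemxAr LP.
  exact: (Ck_linear_comp lL (linear_mx_continuous lL) cAi).
split; split=> [x _|v].
- by have [] := derivative_A x.
- by apply: Ck_ext (Ck_mulmx (cL v) cA) => x; have [_ ->] := derivative_A x.
- by have [] := derivative_Ai x.
- by apply: Ck_ext (CkN (Ck_mulmx cAi (cL v))) => x; have [_ ->] := derivative_Ai x.
Qed.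

End SmoothGroup.

(** * Triangularity of the group from that of its Lie algebra *)

Section Triangular.
Variables (R : realType) (n : nat) (A : 'rV[R]_n -> 'M[R]_n) (L : 'rV[R]_n -> 'M[R]_n).
Hypothesis LP : forall c a b, L (c *: a + b) = c *: L a + L b.
Hypothesis Rnil : forall x, matrix_nilpotent (right_mx L x).
Hypothesis A0 : A 0 = 1%:M.
Hypothesis dA : forall x e, 0 < e -> exists2 d, 0 < d & forall v, `|v| < d ->
  `|A (x + v) - A x - A x *m L (v *m invmx (frame L x))| <= e * `|v|.
Variable P : 'M[R[i]]_n.
Hypothesis PU : P \in unitmx.
Hypothesis Ltrig : forall a, is_trig_mx (P *m map_mx (real_complex R) (L a) *m invmx P).

Definition triangular_form (M : 'M[R]_n) := P *m map_mx (real_complex R) M *m invmx P.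

Lemma triangular_formM M N : triangular_form (M *m N) = triangular_form M * triangular_form N.
Proof.
by rewrite /triangular_form -[RHS]/(_ *m _) map_mxM -!mulmxA mulKmx.
Qed.

Lemma triangular_formP (c : R) M N :
  triangular_form (c *: M + N) = (real_complex R c) *: triangular_form M + triangular_form N.
Proof.
by rewrite /triangular_form map_mxD map_mxZ mulmxDr mulmxDl -scalemxAr -scalemxAl.
Qed.

(** The real matrices with lower triangular form make up a space [T] stable under multiplication by
    each [L w]. Hence along a ray the derivative of [A] modulo [T] is bounded by [A] modulo [T], and
    [gronwall_zero] keeps [A] in [T]. *)
Lemma group_triangular x : lower_band 0 (triangular_form (A x)).
Proof.
have [|c u v hu hv|T TP] := @vspace_of_linear R [the vectType R of 'M[R]_n]
    (fun M => lower_band 0 (triangular_form M)).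
- by rewrite /triangular_form map_mx0 mulmx0 mul0mx => a b _; rewrite mxE.
- rewrite triangular_formP; apply: lower_bandD => // a b ab.
  by rewrite mxE hu // mulr0.
have Lb a : lower_band 0 (triangular_form (L a)).
  by move=> i j; rewrite addn0 => ij; have /is_trig_mxP := Ltrig a; apply.
pose q (M : 'M[R]_n) : 'M[R]_n := M - projv T M.
have qlin : linear q.
  by move=> c u v; rewrite /q linearP scalerBr; zmodule.
have qT M : lower_band 0 (triangular_form M) -> q M = 0.
  by move=> /(TP M) MT; rewrite /q projv_id // subrr.
have qD u v : q (u + v) = q u + q v by have := qlin 1 u v; rewrite !scale1r.
have [Cq Cq0 hCq] := bounded_linear_mx qlin.
have [CL CL0 hCL] := bounded_linear_row (LP : linear L).
have [CB CB0 hCB] := invmx_frame_bound Rnil `|x|.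
have qL M w : q (M *m L w) = q (q M *m L w).
  have {1}-> : M = projv T M + q M by rewrite /q addrC subrK.
  rewrite mulmxDl qD qT ?add0r // triangular_formM -[0%N]addn0.
  by apply: lower_bandM => //; apply/(TP (projv T M)); exact: memv_proj.
suff /eqP : q (A (1 *: x)) = 0.
  by rewrite scale1r subr_eq0 => /eqP ->; apply/(TP (projv T (A x))); exact: memv_proj.
pose K := Cq * (n%:R * (CL * (n%:R * (`|x| * CB)))).
have K0 : 0 <= K by rewrite !mulr_ge0.
apply: (@gronwall_zero R _ (fun t => q (A (t *: x))) K) => //.
  rewrite scale0r A0; apply: qT; rewrite /triangular_form map_mx1 mulmx1 mulmxV //.
  by move=> a b; rewrite addn0 => ab; rewrite mxE -val_eqE /= ltn_eqF.
move=> t e /andP[t0 t1] e0.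
have x0 := normr_ge0 x; have D0 : 0 < Cq * `|x| + 1 by rewrite ltr_wpDl // mulr_ge0.
have [d d0 hd] := dA (t *: x) (divr_gt0 e0 D0).
exists (d / (`|x| + 1)) => [|s]; first by rewrite divr_gt0 // ltr_wpDl.
rewrite ltr_pdivlMr ?ltr_wpDl // => sd.
have {}hd := hd (s *: x).
have sx : `|s *: x| = `|s| * `|x| by rewrite normrZ.
have {}hd : `|A (t *: x + s *: x) - A (t *: x) - A (t *: x) *m L (s *: x *m invmx (frame L (t *: x)))|
    <= e / (Cq * `|x| + 1) * `|s *: x|.
  by apply: hd; rewrite sx; have := normr_ge0 s; nra.
rewrite -scalerDl in hd.
set w := s *: x *m _ in hd; set r := (X in `|X|) in hd.
have -> : q (A ((t + s) *: x)) - q (A (t *: x)) = q (q (A (t *: x)) *m L w) + q r.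
  rewrite -qL -qD /r addrCA subrr addr0.
  by have := qlin (-1) (A (t *: x)) (A ((t + s) *: x)); rewrite !scaleN1r ![- _ + _]addrC.
apply: le_trans (ler_normD _ _) _; rewrite mulrDr; apply: lerD.
  apply: le_trans (hCq _) _.
  have wb : `|w| <= n%:R * (`|s| * `|x| * CB).
    apply: le_trans (norm_mulmx _ _) _; rewrite sx ler_wpM2l // ler_wpM2l ?mulr_ge0 // hCB //.
    by rewrite normrZ ger0_norm //; nra.
  have Lw : `|L w| <= CL * (n%:R * (`|s| * `|x| * CB)).
    by apply: le_trans (hCL _) _; rewrite ler_wpM2l.
  have qLw : `|q (A (t *: x)) *m L w| <= n%:R * (`|q (A (t *: x))| * (CL * (n%:R * (`|s| * `|x| * CB)))).
    by apply: le_trans (norm_mulmx _ _) _; rewrite ler_wpM2l // ler_wpM2l.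
  apply: le_trans (ler_wpM2l Cq0 qLw) _; rewrite le_eqVlt; apply/orP; left; apply/eqP.
  by rewrite /K; ring.
apply: le_trans (hCq _) _; apply: le_trans (ler_wpM2l Cq0 hd) _; rewrite sx.
have -> : Cq * (e / (Cq * `|x| + 1) * (`|s| * `|x|)) = (e / (Cq * `|x| + 1)) * (`|s| * (Cq * `|x|)) by ring.
have -> : `|s| * e = (e / (Cq * `|x| + 1)) * (`|s| * (Cq * `|x| + 1)).
  by rewrite mulrCA divfK ?gt_eqF // mulrC.
have ed0 : 0 <= e / (Cq * `|x| + 1) by rewrite divr_ge0 // ltW.
by apply: (ler_wpM2l ed0); rewrite ler_wpM2l // lerDl.
Qed.

End Triangular.

(** * The Lie group and the two atlases *)

Lemma Ck_comp_linear (R : realType) (V W Z : normedModType R) k (f : W -> Z) (l : V -> W) :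
  linear l -> continuous l -> Ck_on k setT f -> Ck_on k setT (fun x => f (l x)).
Proof.
move=> lL cl; have dl x : differentiable l x /\ forall v, 'D_v l x = l v.
  apply: differentiable_criterion => // e e0; near=> v.
  have -> : l (v + x) = l v + l x by have := lL 1 v x; rewrite !scale1r.
  by rewrite addrK subrr normr0 mulr_ge0 // ltW.
elim: k f => [|k IH] f /=.
  by move=> cf x _; apply: continuous_comp; [exact: cl|exact: cf].
move=> [df Df]; split=> [x _|v].
  by apply: differentiable_comp; [exact: (dl x).1|exact: df].
apply: Ck_ext (IH _ (Df (l v))) => x.
rewrite deriveE; last by apply: differentiable_comp; [exact: (dl x).1|exact: df].
rewrite diff_comp /=; [|exact: (dl x).1|exact: df].
by rewrite -(deriveE v (dl x).1) (dl x).2 deriveE //; exact: df.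
Unshelve. all: by end_near. Qed.

Lemma row_second_countable (R : realType) n : @second_countable 'rV[R]_n.
Proof.
pose b (qk : 'rV[rat]_n * nat) : set 'rV[R]_n :=
  @ball R 'rV[R]_n (map_mx ratr qk.1) qk.2.+1%:R^-1.
exists (b @` setT).
  by apply: card_le_trans (card_image_le _ _) _; exact: countableP.
split=> [_ [qk _ <-]|x A nA]; first exact: ball_open.
have [d d0 hd] := nbhs_norm_lt nA; have d20 : 0 < d / 2 by lra.
have [K /(_ K (leqnn K)) Kd] := invr_nat_lt d20.
have K0 : 0 < K.+1%:R^-1 :> R by rewrite invr_gt0.
have [q hq] := rational_mx_dense x K0.
exists (b (q, K)); first by split; [exists (q, K)|rewrite /b -ball_normE /= distrC].
move=> y; rewrite /b -ball_normE /= => qy; apply: hd.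
have := ler_distD (map_mx ratr q) x y; have := lt_trans hq Kd; have := lt_trans qy Kd; lra.
Qed.

Lemma row_hausdorff (R : realType) n : hausdorff_space 'rV[R]_n.
Proof. exact: (@norm_hausdorff R 'rV[R]_n). Qed.

Lemma row_connected (R : realType) n : connected [set: 'rV[R]_n].
Proof.
move=> B [b0 Bb0] [C oC BC] [D cD BD]; rewrite !setTI in BC BD.
rewrite eqEsubset; split=> // x _.
apply: (@star_shaped_ind R _ setT B b0) => // y _ By.
  have : nbhs y B by rewrite BC; apply: open_nbhs_nbhs; split=> //; rewrite -BC.
  by apply: filterS.
have : nbhs y (~` B).
  by apply: open_nbhs_nbhs; split=> //; rewrite BD; exact: closed_openC.
by apply: filterS.
Qed.

(* [f = p] gives the quotient atlas, and [f = p \o inv] the affine one. *)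
Definition inverse_charts (X M : topologicalType) (f : X -> M) : set (chart M X) :=
  [set c | is_chart c /\ forall m, dom c m -> f (fwd c m) = m].

(** As [f] is open, its inverse on a neighbourhood where it is injective is continuous; outside the
    image the coordinate map takes the value 0. *)
Lemma inverse_chart_at (R : realType) n (M : topologicalType) (f : 'rV[R]_n -> M) x :
  continuous f -> (forall V, open V -> open (f @` V)) ->
  (exists U : set 'rV[R]_n, [/\ open U, U x & forall y z, U y -> U z -> f y = f z -> y = z]) ->
  exists2 c, inverse_charts f c & dom c (f x).
Proof.
move=> cf of_ [U [oU Ux iU]].
have /choice[g hg] : forall m, exists y, (f @` U) m -> U y /\ f y = m.
  move=> m; have [[y Uy <-]|nm] := pselect ((f @` U) m); first by exists y.
  by exists 0.
have gf y : U y -> g (f y) = y.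
  by move=> Uy; have [|Ug fg] := hg (f y); [exists y|exact: iU].
have cod : g @` (f @` U) = U.
  rewrite eqEsubset; split=> [_ [_ [y Uy <-] <-]|y Uy]; first by rewrite gf.
  by exists (f y); [exists y|exact: gf].
exists (Chart (f @` U) g f); last by exists x.
split=> [|m /hg[] //]; split=> /=.
- exact: of_.
- by rewrite /codom_chart /= cod.
- rewrite continuous_open_subspace; last exact: of_.
  move=> m; rewrite inE => -[y Uy <-] A; rewrite gf // => nA.
  have [W [oW Wy] WA] : exists2 W, open_nbhs y W & W `<=` A by move: nA; rewrite nbhsE.
  have : nbhs (f y) (f @` (W `&` U)).
    by apply: open_nbhs_nbhs; split; [apply: of_; exact: openI|exists y].
  by apply: filterS => _ [z [Wz Uz] <-]; rewrite /= gf //; exact: WA.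
- by apply: continuous_subspaceT.
- by move=> m /hg[].
Qed.

(* The type carrying the group law [x * y = x + y *m A x]. *)
Definition affine_group (R : realType) n (A : 'rV[R]_n -> 'M[R]_n) (A0 : A 0 = 1%:M)
  (AU : forall x, A x \in unitmx) (AM : forall x y, A (x + y *m A x) = A y *m A x) := 'rV[R]_n.

Section AffineGroup.
Variables (R : realType) (n : nat) (A : 'rV[R]_n -> 'M[R]_n).
Variables (A0 : A 0 = 1%:M) (AU : forall x, A x \in unitmx)
  (AM : forall x y, A (x + y *m A x) = A y *m A x).
Local Notation E := 'rV[R]_n.
Local Notation T := (affine_group A0 AU AM).
Hypothesis cA : forall k, Ck_on k setT A.
Hypothesis cAi : forall k, Ck_on k setT (Ai A).

Definition gmul (x y : E) : E := x + y *m A x.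
Definition ginv (x : E) : E := - (x *m Ai A x).

Lemma gmulA : associative gmul.
Proof. by move=> x y z; rewrite /gmul AM mulmxDl -mulmxA addrA. Qed.
Lemma gmul0 : left_id 0 gmul.
Proof. by move=> x; rewrite /gmul A0 mulmx1 add0r. Qed.
Lemma gmulr0 : right_id 0 gmul.
Proof. by move=> x; rewrite /gmul mul0mx addr0. Qed.
Lemma gmulV : right_inverse 0 ginv gmul.
Proof. by move=> x; rewrite /gmul /ginv mulNmx mulmxKV // subrr. Qed.
Lemma A_ginv x : A (ginv x) = Ai A x.
Proof.
have : A (ginv x) *m A x = 1%:M by rewrite -AM -/(gmul x (ginv x)) gmulV A0.
by move=> e; rewrite /Ai -[RHS]mul1mx -e mulmxK.
Qed.
Lemma gVmul : left_inverse 0 ginv gmul.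
Proof. by move=> x; rewrite /gmul A_ginv /ginv addNr. Qed.
Lemma ginvK : involutive ginv.
Proof. by move=> x; rewrite -[LHS]gmulr0 -(gVmul x) gmulA gVmul gmul0. Qed.
Lemma ginvM x y : ginv (gmul x y) = gmul (ginv y) (ginv x).
Proof.
rewrite -[RHS]gmul0 -(gVmul (gmul x y)) -!gmulA (gmulA y) gmulV gmul0 gmulV gmulr0 //.
Qed.

HB.instance Definition _ := Topological.copy T 'rV[R]_n.
HB.instance Definition _ := isGroup.Build T gmulA gmul0 gmulr0 gVmul gmulV.

Definition affine_lie_group : topologicalGroupCarrierType := T.

Definition id_chart : chart affine_lie_group 'rV[R]_n := Chart setT id id.

Lemma row_linear_Ck (V : normedModType R) k (l : E -> V) : linear l -> Ck_on k setT l.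
Proof. by move=> lL; apply: linear_Ck => //; exact: linear_mx_continuous. Qed.

Lemma id_Ck k : Ck_on k setT (id : E -> E).
Proof. by apply: row_linear_Ck => a u v. Qed.

Lemma fst_Ck k : Ck_on k setT (fun z : E * E => z.1).
Proof. by apply: linear_Ck => // x; exact: cvg_fst. Qed.

Lemma snd_Ck k : Ck_on k setT (fun z : E * E => z.2).
Proof. by apply: linear_Ck => // x; exact: cvg_snd. Qed.

Lemma ginv_Ck k : Ck_on k setT ginv.
Proof. by apply: CkN; apply: Ck_mulmx; [exact: id_Ck|exact: cAi]. Qed.

Lemma gmul_Ck k : Ck_on k setT (fun z : E * E => gmul z.1 z.2).
Proof.
apply: CkD; first exact: fst_Ck.
apply: Ck_mulmx; first exact: snd_Ck.
by apply: (@Ck_comp_linear R _ _ _ k A (fun z : E * E => z.1)) => // x; exact: cvg_fst.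
Qed.

Lemma Ck_smooth_on (V W : normedModType R) (U : set V) (f : V -> W) :
  (forall k, Ck_on k setT f) -> smooth_on U f.
Proof.
move=> cf k; apply: Ck_local => x _; exists f; split=> //.
by apply: nearW.
Qed.

Lemma id_chartP : is_chart id_chart.
Proof.
split=> //=.
- exact: openT.
- by rewrite /codom_chart /= image_id; exact: openT.
- by apply: continuous_subspaceT => x; exact: cvg_id.
- by apply: continuous_subspaceT => x; exact: cvg_id.
Qed.

Lemma affine_group_lie : lie_group (R := R) (L := affine_lie_group) [set id_chart].
Proof.
split.
- split.
    split; [exact: row_hausdorff|exact: row_second_countable|].
    by move=> x; exists id_chart => //; exact: id_chartP.
  split; first by move=> _ ->; exact: id_chartP.
    by move=> x; exists id_chart.
  by move=> _ _ -> ->; apply: Ck_smooth_on => k; exact: id_Ck.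
- split; first by move=> z; exact: (@gmul_Ck 0 z I).
  move=> _ _ [_ -> [_ -> <-]] ->.
  by apply: Ck_smooth_on => k; exact: gmul_Ck.
- split; first by move=> z; exact: (@ginv_Ck 0 z I).
  by move=> _ _ -> ->; apply: Ck_smooth_on => k; exact: ginv_Ck.
Qed.

Lemma affine_group_connected : connected [set: affine_lie_group].
Proof. exact: row_connected. Qed.

(** On the kernel of [x |-> B (A x)] the matrix [A x] is 1, so that the law is addition there and
    commutators are trivial. *)
Lemma affine_group_solvable (F : fieldType) (B : 'M[R]_n -> 'M[F]_n) :
  B 1%:M = 1 -> (forall M N, B (M *m N) = B M * B N) -> injective B ->
  (forall x, lower_band 0 (B (A x))) -> solvable_group affine_lie_group.
Proof.
move=> B1 BM Binj Btrig.
apply: (@triangular_solvable F n affine_lie_group (fun x : E => B (A x))).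
- by rewrite -[(1 : affine_lie_group)%g]/(0 : E) A0.
- by move=> x y; rewrite -[(x * y)%g]/(gmul x y) /gmul AM BM.
- exact: Btrig.
- move=> x y; rewrite -B1 => /Binj Ax /Binj Ay.
  have xy : (x * y)%g = (y * x)%g.
    by rewrite -[(x * y)%g]/(gmul x y) -[(y * x)%g]/(gmul y x) /gmul Ax Ay !mulmx1 addrC.
  by rewrite /commg /conjg xy mulKg mulVg.
Qed.

End AffineGroup.

(** [fwd c \o u] and [h] both lift [u] through [f] and agree at [x]; local injectivity of [f] makes
    them agree nearby. *)
Lemma chart_lift (R : realType) n (M : topologicalType) (f : 'rV[R]_n -> M)
    (c : chart M 'rV[R]_n) (u : 'rV[R]_n -> M) (h : 'rV[R]_n -> 'rV[R]_n) x :
  (forall y, exists U : set 'rV[R]_n,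
    [/\ open U, U y & forall z w, U z -> U w -> f z = f w -> z = w]) ->
  inverse_charts f c -> continuous u -> continuous h -> dom c (u x) -> h x = fwd c (u x) ->
  (forall z, f (h z) = u z) -> \forall z \near x, fwd c (u z) = h z.
Proof.
move=> linj [[od _ cfwd _ _] fc] cu ch dx hx fh.
have [U [oU Ux iU]] := linj (h x).
have nd : nbhs (u x) (dom c) by exact: open_nbhs_nbhs.
have cx : {for u x, continuous (fwd c)}.
  by move: cfwd; rewrite continuous_open_subspace // => /(_ (u x)); apply; rewrite inE.
have nU : nbhs (fwd c (u x)) U by rewrite -hx; exact: open_nbhs_nbhs.
have n1 : nbhs x (u @^-1` dom c) := cu x _ nd.
have n2 : nbhs x (u @^-1` (fwd c @^-1` U)) := cu x _ (cx _ nU).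
have n3 : nbhs x (h @^-1` U) := ch x _ (open_nbhs_nbhs (conj oU Ux)).
apply: filterS3 n1 n2 n3 => z z1 z2 z3; apply: iU => //.
by rewrite fc // fh.
Qed.

(** * The quotient with its two atlases, as a solvmanifold *)

Section Structures.
Variables (R : realType) (n : nat) (G : set ('rV[R]_n -> 'rV[R]_n)).
Variables (M : topologicalType) (p : 'rV[R]_n -> M).
Hypothesis hM : aspherical_manifold G p.
Variable A : 'rV[R]_n -> 'M[R]_n.
Hypothesis (A0 : A 0 = 1%:M) (AU : forall x, A x \in unitmx)
  (AM : forall x y, A (x + y *m A x) = A y *m A x).
Hypothesis cA : forall k, Ck_on k setT A.
Hypothesis cAi : forall k, Ck_on k setT (Ai A).
Hypothesis deckE : forall g x, G g -> g x = gmul A x (g 0).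
Local Notation E := 'rV[R]_n.
Local Notation inv := (ginv A).

Lemma proj_gmul x c : p c = p 0 -> p (gmul A x c) = p x.
Proof.
move=> pc; have [g Gg <-] := proj_deck hM (esym pc).
by rewrite -deckE // (deck_proj hM _ Gg).
Qed.

Lemma proj_gmulV x y : p x = p y <-> p (gmul A (inv x) y) = p 0.
Proof.
split=> [/(proj_deck hM)[g Gg <-]|pc].
  by rewrite (deckE _ Gg) gmulA // gVmul // gmul0 // (deck_proj hM _ Gg).
by rewrite -(proj_gmul x pc) gmulA // gmulV // gmul0.
Qed.

(* [theta true] turns the charts of [p] into the affine charts. *)
Definition theta (b : bool) : E -> E := if b then inv else id.

Lemma theta_Ck b k : Ck_on k setT (theta b).
Proof. by case: b; [exact: ginv_Ck|exact: id_Ck]. Qed.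

Lemma theta_continuous b : continuous (theta b).
Proof. by move=> x; exact: (@theta_Ck b 0 x I). Qed.

Lemma thetaK b : involutive (theta b).
Proof. by case: b => //; exact: ginvK. Qed.

Lemma proj_theta_continuous b : continuous (p \o theta b).
Proof.
move=> x; apply: continuous_comp; first exact: theta_continuous.
exact: (proj_continuous hM).
Qed.

Lemma proj_theta_open b V : open V -> open ((p \o theta b) @` V).
Proof.
move=> oV; have -> : (p \o theta b) @` V = p @` (theta b @^-1` V).
  rewrite eqEsubset; split=> [_ [x Vx <-]|_ [x Vx <-]].
    by exists (theta b x) => //=; rewrite thetaK.
  by exists (theta b x) => //=; rewrite thetaK.
apply: (proj_open hM); apply: open_comp => // x _; exact: theta_continuous.
Qed.

Lemma proj_theta_locally_inj b x : exists U : set E,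
  [/\ open U, U x & forall y z, U y -> U z -> (p \o theta b) y = (p \o theta b) z -> y = z].
Proof.
have [U [oU Ux iU]] := proj_locally_inj hM (theta b x).
exists (theta b @^-1` U); split=> //.
  by apply: open_comp => // y _; exact: theta_continuous.
by move=> y z Uy Uz /= /(iU _ _ Uy Uz); exact: (can_inj (thetaK b)).
Qed.

(** With the inversion on both sides, the right translation by [g 0] becomes the left translation by
    its inverse, which is affine in [z]; the other three forms serve for smoothness. *)
Lemma deck_theta_E b b' g z : G g -> theta b' (g (theta b z)) =
  match b, b' with
  | false, false => z + g 0 *m A z
  | true, false => inv z + g 0 *m Ai A z
  | false, true => inv (g 0) + inv z *m A (inv (g 0))
  | true, true => inv (g 0) + z *m A (inv (g 0))
  end.
Proof.
move=> Gg; rewrite (deckE _ Gg); case: b; case: b' => //=.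
- by rewrite ginvM // ginvK.
- by rewrite /gmul A_ginv.
- by rewrite ginvM.
Qed.

Lemma deck_theta_Ck b b' g k : G g -> Ck_on k setT (fun z => theta b' (g (theta b z))).
Proof.
move=> Gg; apply: Ck_ext (fun z => deck_theta_E b b' z Gg) _.
have cc (c : E) : Ck_on k setT (fun _ : E => c) by exact: Ck_cst.
have cm (c : 'M[R]_n) : Ck_on k setT (fun _ : E => c) by exact: Ck_cst.
have ci : Ck_on k setT inv by exact: ginv_Ck.
have ciA : Ck_on k setT (id : E -> E) by exact: id_Ck.
case: b; case: b'.
- exact: (CkD (cc _) (Ck_mulmx ciA (cm _))).
- exact: (CkD ci (Ck_mulmx (cc _) (cAi k))).
- exact: (CkD (cc _) (Ck_mulmx ci (cm _))).
- exact: (CkD ciA (Ck_mulmx (cc _) (cA k))).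
Qed.

Lemma deck_theta_continuous b b' g : G g -> continuous (fun z => theta b' (g (theta b z))).
Proof. by move=> Gg z; exact: (@deck_theta_Ck b b' g 0 Gg z I). Qed.

Lemma inverse_chart_bwd b c m : inverse_charts (p \o theta b) c -> dom c m ->
  \forall z \near fwd c m, bwd c z = (p \o theta b) z.
Proof.
move=> [[_ oc _ _ bf] pc] dm.
have : nbhs (fwd c m) (codom_chart c) by apply: open_nbhs_nbhs; split=> //; exists m.
by apply: filterS => _ [m' dm' <-]; rewrite bf // pc.
Qed.

Lemma transition b b' c c' x :
  inverse_charts (p \o theta b) c -> inverse_charts (p \o theta b') c' ->
  (fwd c @` (dom c `&` dom c')) x ->
  exists2 g, G g & \forall z \near x, (fwd c' \o bwd c) z = theta b' (g (theta b z)).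
Proof.
move=> hc hc' [m [dm dm'] <-].
have pm : (p \o theta b) (fwd c m) = m by case: hc => _; apply.
have pm' : (p \o theta b') (fwd c' m) = m by case: hc' => _; apply.
have [g Gg gx] := proj_deck hM (etrans pm (esym pm')); exists g => //.
have lift := @chart_lift R n M (p \o theta b') c' (p \o theta b)
  (fun z => theta b' (g (theta b z))) (fwd c m).
have {}lift : \forall z \near fwd c m, fwd c' ((p \o theta b) z) = theta b' (g (theta b z)).
  apply: lift => //.
  - exact: proj_theta_locally_inj.
  - exact: proj_theta_continuous.
  - exact: deck_theta_continuous.
  - by rewrite pm.
  - by rewrite pm gx thetaK.
  - by move=> z /=; rewrite thetaK (deck_proj hM _ Gg).
by apply: filterS2 (inverse_chart_bwd hc dm) lift => z /= ->.
Qed.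

(** The set [S] of booleans treats the quotient atlas, the affine atlas and their union at once. *)
Lemma smooth_transitions (S : set bool) (C : set (chart M E)) :
  S !=set0 -> (forall c, C c <-> exists2 b, S b & inverse_charts (p \o theta b) c) ->
  atlas (@smooth_on R E E) C.
Proof.
move=> [b0 Sb0] hC; split.
- by move=> c /hC[b _ []].
- move=> m; have [x <-] := proj_surj hM m.
  have [|c cc dc] := @inverse_chart_at R n M (p \o theta b0) (theta b0 x)
    (@proj_theta_continuous b0) (@proj_theta_open b0); first exact: proj_theta_locally_inj.
  exists c; first by apply/hC; exists b0.
  by move: dc; rewrite /= thetaK.
- move=> c c' /hC[b _ cb] /hC[b' _ cb'] k; apply: Ck_local => x /(transition cb cb')[g Gg tg].
  by exists (fun z => theta b' (g (theta b z))); split=> //; exact: deck_theta_Ck.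
Qed.

Lemma quotient_smooth_manifold : smooth_manifold (quotient_atlas p).
Proof.
split; first by case: hM.
apply: (@smooth_transitions [set false]); first by exists false.
by move=> c; split=> [hc|[_ -> //]]; exists false.
Qed.

Lemma theta_affine_manifold : affine_manifold (inverse_charts (p \o theta true)).
Proof.
split; first by case: hM.
have [is_c cov _] : atlas (@smooth_on R E E) (inverse_charts (p \o theta true)).
  apply: (@smooth_transitions [set true]); first by exists true.
  by move=> c; split=> [hc|[_ -> //]]; exists true.
split=> // c c' hc hc' x /(transition hc hc')[g Gg tg].
exists (fun z => theta true (g (theta true z))) => //.
exists (A (inv (g 0))), (inv (g 0)); split=> //.
by apply/funext => z; rewrite deck_theta_E // addrC.
Qed.

Lemma theta_compatible :
  smoothly_compatible (quotient_atlas p) (inverse_charts (p \o theta true)).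
Proof.
apply: (@smooth_transitions setT); first by exists true.
move=> c; split=> [[hc|hc]|[[] _ hc]]; [by exists false|by exists true|by right|by left].
Qed.

Local Notation L := (affine_lie_group A0 AU AM).

(** In the charts [p] is locally a deck transformation, whose differential is onto because the
    inverse is differentiable too. *)
Lemma quotient_projection :
  homogeneous_space_projection (L := L) [set id_chart A0 AU AM]
    [set x : E | p x = p 0] (quotient_atlas p) (p : E -> M).
Proof.
have lift c x : quotient_atlas p c -> dom c (p x) -> exists2 g, G g &
    \forall z \near x, fwd c (p z) = g z.
  move=> hc dx; have px : p x = p (fwd c (p x)) by case: hc => _ ->.
  have [g Gg gx] := proj_deck hM px; exists g => //.
  apply: (@chart_lift R n M p c p g x) => //.
  - exact: (proj_locally_inj hM).
  - exact: (proj_continuous hM).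
  - exact: (deck_continuous hM Gg).
  - by move=> z; rewrite (deck_proj hM _ Gg).
have dCk g k : G g -> Ck_on k setT g := @deck_theta_Ck false false g k.
split.
- split.
    split; first exact: (proj_continuous hM).
    move=> _ c -> hc k; apply: Ck_local => _ [x [_ dx] <-].
    by have [g Gg hg] := lift c x hc dx; exists g; split=> //; exact: dCk.
  move=> _ c x -> hc _ dx w; have [g Gg hg] := lift c x hc dx.
  have [g' Gg' [gK g'K]] := deck_inv hM Gg.
  have dg y : differentiable g y by have [+ _] := dCk g 1%N Gg; apply.
  have dg' y : differentiable g' y by have [+ _] := dCk g' 1%N Gg'; apply.
  exists ('d g' (g x) w).
  have [df Df] := near_eq_derive ('d g' (g x) w) hg (dg x).
  rewrite -[LHS](deriveE _ df) Df deriveE //.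
  have gg' : g \o g' = id by apply/funext => y /=; rewrite g'K.
  have := diff_comp (dg' (g x)) (dg (g' (g x))); rewrite gg' gK => /(congr1 (fun f => f w)).
  by rewrite /= => <-; rewrite -deriveE // derive_id.
- exact: (proj_surj hM).
- by move=> x y; exact: proj_gmulV.
Qed.

Theorem quotient_solvmanifold : solvable_group L -> solvmanifold (quotient_atlas p).
Proof.
move=> sol; split; first exact: quotient_smooth_manifold.
exists n, L, [set id_chart A0 AU AM], [set x : E | p x = p 0], p; split=> //.
- exact: affine_group_lie.
- exact: affine_group_connected.
- split.
    split=> //= [x y hx hy|x hx]; first by rewrite -[(x * y)%g]/(gmul A x y) proj_gmul.
    by rewrite -[(x^-1)%g]/(inv x) -(proj_gmul (inv x) hx) gVmul.
  have -> : [set x : E | p x = p 0] = p @^-1` [set p 0] by [].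
  apply: closed_comp => [x _|]; first exact: (proj_continuous hM).
  by apply: accessible_closed_set1; apply: hausdorff_accessible; case: hM => _ _ _ _ [].
- exact: quotient_projection.
Qed.

End Structures.

Lemma simply_transitive_structure (R : realType) (n : nat)
    (G : set ('rV[R]_n -> 'rV[R]_n)) (M : topologicalType) (p : 'rV[R]_n -> M) :
  aspherical_manifold G p -> compact [set: M] -> acts_transitively (Aff0 p) ->
  exists (A L : 'rV[R]_n -> 'M[R]_n) (P : 'M[R[i]]_n),
    [/\ A 0 = 1%:M, forall x, A x \in unitmx & forall x y, A (x + y *m A x) = A y *m A x] /\
    [/\ forall k, Ck_on k setT A /\ Ck_on k setT (Ai A), P \in unitmx,
        forall x, lower_band 0 (triangular_form P (A x)) &
        forall g x, G g -> g x = gmul A x (g 0)].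
Proof.
move=> hM hc ht.
have hh := tangent_fields_lie hM.
have hT := tangent_fields_transitive hM hc ht.
have [L [LP hL lieL Rnil]] := simply_transitive_product hh hT (@frame_matrix_bounded _ _ _ _ _ hM hc ht).
have HH := centralizer_closed_group hM.
have Haff g : affine_centralizer G g -> affine_matrix g by case.
have Hloc := local_transitivity hM hc ht.
have HL X : tangent (affine_centralizer G) X -> exists w, X = field_mx L w.
  by move=> hX; have [B [b XE]] := tangent_affine hX; exists b; rewrite XE /field_mx;
    have /hL <- : tangent_fields G B b by rewrite /tangent_fields -XE.
have [A [A0 HA AM dA]] := group_law HH Haff Hloc LP HL Rnil.
have AU x : A x \in unitmx by case: (HA x).
have [|P PU hP] := real_triangularizable LP lieL.
  by move=> b; apply: mxtrace_nilpotent; exact: Rnil.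
exists A, L, P; split=> //; split=> //.
- apply: (@A_Ai_Ck _ _ _ L) => // e e0; have [d d0 hd] := dA 0 e e0.
  apply: filterS (near_norm_lt 0 d0) => w; rewrite sub0r normrN => /hd.
  have -> : frame L 0 = 1%:M.
    by rewrite /frame (_ : right_mx L 0 = 0) ?addr0 //; apply/row_matrixP => i; rewrite rowK mul0mx row0.
  by rewrite add0r A0 mul1mx invmx1 mulmx1.
- by move=> x; apply: (@group_triangular R n A L).
(* [g] commutes with the element of the centraliser that moves 0 to [x]; evaluate both orders at
   0. *)
- move=> g x Gg; have [[_ _ cg] _] := HA x.
  by have := cg g 0 Gg; rewrite !act_block mul0mx addr0.
Qed.

Theorem proposition3p5 (R : realType) (n : nat)
    (G : set ('rV[R]_n -> 'rV[R]_n)) (M : topologicalType)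
    (p : 'rV[R]_n -> M)
    (hM : aspherical_manifold G p)
    (hdiff : forall g, G g -> diffeomorphism g)
    (hcompact : compact [set: M])
    (htrans : acts_transitively (Aff0 p)) :
  solvmanifold (quotient_atlas p) /\
  exists B : set (chart M 'rV[R]_n),
    affine_manifold B /\ smoothly_compatible (quotient_atlas p) B.
Proof.
have [A [L [P [[A0 AU AM] [cAA PU trig deckE]]]]] := simply_transitive_structure hM hcompact htrans.
have cA k := (cAA k).1; have cAi k := (cAA k).2; split.
  suff sol : solvable_group (affine_lie_group A0 AU AM).
    exact: (quotient_solvmanifold hM cA cAi deckE sol).
  apply: (@affine_group_solvable R n A A0 AU AM _ (triangular_form P)) => //.
  - by rewrite /triangular_form map_mx1 mulmx1 mulmxV.
  - by move=> B C; exact: triangular_formM.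
  - have tK X : invmx P *m triangular_form P X *m P = map_mx (real_complex R) X.
      by rewrite /triangular_form -!mulmxA mulKmx // mulVmx // mulmx1.
    move=> B C BC; have := tK C; rewrite -BC tK => {}BC.
    by apply/matrixP => i j; have /matrixP/(_ i j) := BC; rewrite !mxE => /complexI.
exists (inverse_charts (p \o theta A true)); split.
  exact: (theta_affine_manifold hM A0 AU AM cA cAi deckE).
exact: (theta_compatible hM A0 AU AM cA cAi deckE).
Qed.
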